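(* Let $V$ be a valuation ring with value group $\Gamma$, containing a field $k$ of characteristic exponent $p$, and let $k'$ be a field extension of $k$. There exists a valuation ring $W$ dominating $V$ and containing $k'$ (compatibly with $k\subset V$), with the following properties: (i) if $\Delta$ denotes the value group of $W$, the quotient $\Delta/\Gamma$ is $p$-torsion; (ii) the natural morphism $\mathrm{Spec}(W)\to\mathrm{Spec}(V)$ is a homeomorphism; (iii) for every $\mathfrak{q}'\in\mathrm{Spec}(W)$ with image $\mathfrak{q}$ in $\mathrm{Spec}(V)$, the residue field $\kappa(\mathfrak{q}')$ is purely inseparable over its subfield generated by $k'$ and $\kappa(\mathfrak{q})$; the latter subfield is a maximal composite extension of $k'$ and $\kappa(\mathfrak{q})$ over $k$.
   Context: Rings are commutative with unit; $\kappa(\cdot)$ denotes the residue field at a prime ideal. The value group of a valuation ring $V$ with fraction field $K$ is $K^\times/V^\times$. A valuation ring $W$ dominates $V$ if it is given with an injective local homomorphism $V\to W$, which induces an injection of value groups $\Gamma\hookrightarrow\Delta$. The characteristic exponent of a field is $1$ in characteristic $0$ and the characteristic otherwise. A group is ''$p$-torsion'' if each of its elements is killed by some power of $p$ (so it is trivial if $p=1$). A composite extension of two extensions $L,M$ of a field $K$ is a triple $(E,u,v)$ where $E$ is an extension of $K$ and $u:L\to E$, $v:M\to E$ are $K$-embeddings such that $u(L)\cup v(M)$ generates $E$ as a field. The kernel of $u\otimes v: L\otimes_K M\to E$ defines a point of $\mathrm{Spec}(L\otimes_K M)$; the composite extension is called maximal (over $K$) if this point is a maximal point of $\mathrm{Spec}(L\otimes_K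 M)$, i.e. the generic point of an irreducible component. *)

(* Defs.v *)
From HB Require Import structures.
From mathcomp Require Import all_boot all_order all_algebra.
From mathcomp Require Import all_classical topology.
From mathcomp Require Import ring_quotient generic_quotient fraction.

Set Implicit Arguments.
Unset Strict Implicit.
Unset Printing Implicit Defensive.

Import GRing.Theory.
Local Open Scope classical_set_scope.
Local Open Scope quotient_scope.
Local Open Scope ring_scope.

Definition homeomorphism (S T : topologicalType) (f : S -> T) : Prop :=
  continuous f /\ exists g : T -> S, [/\ continuous g, cancel f g & cancel g f].

Definition irreducible (T : topologicalType) (Z : set T) : Prop :=
  Z !=set0 /\ forall A B : set T, closed A -> closed B ->
    Z `<=` A `|` B -> Z `<=` A \/ Z `<=` B.

Definition irreducible_component (T : topologicalType) (Z : set T) : Prop :=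
  irreducible Z /\ forall Y : set T, irreducible Y -> Z `<=` Y -> Y = Z.

Definition generic_point (T : topologicalType) (Z : set T) (x : T) : Prop :=
  closure [set x] = Z.

Definition maximal_point (T : topologicalType) (x : T) : Prop :=
  exists2 Z : set T, irreducible_component Z & generic_point Z x.

(* The prime ideals of the library are boolean predicates; classically, every
   subset of a ring is of this form. *)
Notation Spec := prime_idealr.

Lemma Spec_ext (R : comNzRingType) (x y : Spec R) :
  (forall a : R, (x : pred R) a = (y : pred R) a) -> x = y.
Proof.
case: x y => [x [[cx1] [cx2] [cx3] [cx4]]] [y [[cy1] [cy2] [cy3] [cy4]]] /= exy.
have {}exy : x = y by apply/funext => a; exact: exy.
subst y; congr (PrimeIdealr.Pack (PrimeIdealr.Class _ _ _ _)).
- by congr Algebra.isOppClosed.Axioms_; exact: Prop_irrelevance.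
- by congr Algebra.isAddClosed.Axioms_; exact: Prop_irrelevance.
- by congr isProperIdeal.Axioms_; exact: Prop_irrelevance.
- by congr isPrimeIdealrClosed.Axioms_; exact: Prop_irrelevance.
Qed.

HB.instance Definition _ (R : comNzRingType) := gen_eqMixin (Spec R).
HB.instance Definition _ (R : comNzRingType) := gen_choiceMixin (Spec R).

Section Zariski.
Variable R : comNzRingType.

Definition zariski_closed (E : set R) : set (Spec R) :=
  [set x | forall a, E a -> (x : pred R) a].

Definition zariski_open : set_system (Spec R) :=
  [set O | exists E : set R, O = ~` zariski_closed E].

Lemma zariski_openT : zariski_open setT.
Proof.
exists [set 1]; apply/seteqP; split => // x _ /= /(_ 1 erefl).
by rewrite -[_ 1]/(1 \in (x : pred R)) idealr1.
Qed.

Lemma zariski_openI : setI_closed zariski_open.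
Proof.
move=> _ _ [E ->] [F ->].
exists [set c | exists a b, [/\ E a, F b & c = a * b]].
rewrite -setCU; congr (~` _); apply/seteqP; split => x /=.
  case=> h c [a [b [Ea Fb ->]]]; rewrite -[_ (a * b)]/(a * b \in (x : pred R)).
    by rewrite prime_idealrM; apply/orP; left; exact: h.
  by rewrite prime_idealrM; apply/orP; right; exact: h.
move=> h; have [hE|/existsNP[a /not_implyP[Ea nxa]]] :=
  pselect (zariski_closed E x); first by left.
right=> b Fb; have := h (a * b) (ex_intro _ a (ex_intro _ b (And3 Ea Fb erefl))).
by rewrite -[_ (a * b)]/(a * b \in (x : pred R)) prime_idealrM => /orP[].
Qed.

Lemma zariski_open_bigU (I : Type) (f : I -> set (Spec R)) :
  (forall i, zariski_open (f i)) -> zariski_open (\bigcup_i f i).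
Proof.
move=> /choice[E fE]; exists (\bigcup_i E i).
rewrite -[LHS]setCK setC_bigcup; congr (~` _); apply/seteqP; split => x /=.
  by move=> h a [i _ Ea]; have := h i Logic.I; rewrite fE setCK; apply.
by move=> h i _; rewrite fE setCK => a Ea; apply: h; exists i.
Qed.

HB.instance Definition _ :=
  isOpenTopological.Build (Spec R) zariski_openT zariski_openI zariski_open_bigU.

End Zariski.

Section SpecMap.
Variables (R S : comNzRingType) (f : {rmorphism R -> S}) (q : Spec S).

Definition preim_ideal : R -> bool := fun a => f a \in (q : pred S).

Lemma in_preim_ideal a : (a \in preim_ideal) = (f a \in (q : pred S)).
Proof. by []. Qed.

Lemma preim_idealr : idealr_closed preim_ideal.
Proof.
split; rewrite ?in_preim_ideal ?rmorph0 ?rmorph1 ?idealr0 ?idealr1 //.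
move=> a u v; rewrite !in_preim_ideal => hu hv.
by rewrite rmorphD rmorphM rpredD // idealMr.
Qed.

Lemma preim_prime : prime_idealr_closed preim_ideal.
Proof. by move=> u v; rewrite !in_preim_ideal rmorphM prime_idealrM. Qed.

HB.instance Definition _ := isIdealr.Build R preim_ideal preim_idealr.
HB.instance Definition _ := isPrimeIdealrClosed.Build R preim_ideal preim_prime.

Definition Spec_map : Spec R := preim_ideal.

End SpecMap.

Section Kernel.
Variables (R : comNzRingType) (D : idomainType) (f : {rmorphism R -> D}).

Definition ker_ideal : R -> bool := fun a => f a == 0.

Lemma in_ker_ideal a : (a \in ker_ideal) = (f a == 0).
Proof. by []. Qed.

Lemma ker_idealr : idealr_closed ker_ideal.
Proof.
split; rewrite ?in_ker_ideal ?rmorph0 ?rmorph1 ?oner_eq0 //.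
move=> a u v; rewrite !in_ker_ideal => /eqP hu /eqP hv.
by rewrite rmorphD rmorphM hu hv mulr0 addr0.
Qed.

Lemma ker_prime : prime_idealr_closed ker_ideal.
Proof. by move=> u v; rewrite !in_ker_ideal rmorphM mulf_eq0. Qed.

HB.instance Definition _ := isIdealr.Build R ker_ideal ker_idealr.
HB.instance Definition _ := isPrimeIdealrClosed.Build R ker_ideal ker_prime.

Definition kernel_point : Spec R := ker_ideal.

End Kernel.

Section QuotientDomain.
Variables (R : comNzRingType) (q : Spec R).

(* [R / q], with its units found by choice so that it is an [idomainType]. *)
Definition quot_domain : Type := {ideal_quot q}.

HB.instance Definition _ := GRing.ComNzRing.on quot_domain.

Definition quot_unit : {pred quot_domain} := fun x => `[< exists y, y * x = 1 >].
Definition quot_inv (x : quot_domain) : quot_domain :=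
  xget x [set y | y * x = 1].

Lemma quot_mulVx : {in quot_unit, left_inverse 1 quot_inv *%R}.
Proof. by move=> x /asboolP ex; exact: (xgetPex x ex). Qed.

Lemma quot_unitPl (x y : quot_domain) : y * x = 1 -> quot_unit x.
Proof. by move=> yx; apply/asboolP; exists y. Qed.

Lemma quot_invr_out : {in [predC quot_unit], quot_inv =1 id}.
Proof.
move=> x /negP nx; apply: xgetPN => y yx; apply: nx.
by apply/asboolP; exists y.
Qed.

HB.instance Definition _ := GRing.ComNzRing_hasMulInverse.Build quot_domain
  quot_mulVx quot_unitPl quot_invr_out.
HB.instance Definition _ := GRing.ComUnitRing_isIntegral.Build quot_domain
  (@Quotient.rquot_IdomainAxiom R q).

Definition to_quot (a : R) : quot_domain := \pi_{ideal_quot q} a.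

Lemma to_quot_is_zmod_morphism : zmod_morphism to_quot.
Proof. by move=> a b; rewrite /to_quot rmorphB. Qed.
Lemma to_quot_is_monoid_morphism : monoid_morphism to_quot.
Proof.
by split=> [|a b]; rewrite /to_quot; [exact: rmorph1|exact: rmorphM].
Qed.

HB.instance Definition _ := GRing.isZmodMorphism.Build R quot_domain to_quot
  to_quot_is_zmod_morphism.
HB.instance Definition _ := GRing.isMonoidMorphism.Build R quot_domain to_quot
  to_quot_is_monoid_morphism.

Lemma to_quot_eq0 a : (to_quot a == 0) = (a \in (q : pred R)).
Proof.
rewrite -[0](rmorph0 to_quot) /to_quot.
by rewrite -Quotient.idealrBE subr0.
Qed.

End QuotientDomain.

Local Notation "x %:F" := (FracField.tofrac x).

Lemma fracE (A : idomainType) (x : {fraction A}) :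
  x = (\n_(repr x))%:F / (\d_(repr x))%:F.
Proof.
have d0 : (\d_(repr x))%:F != 0 by rewrite tofrac_eq0 denom_ratioP.
apply: (canRL (mulfK d0)); rewrite -[in LHS](reprK x).
set y := repr x; rewrite -[LHS]/(FracField.mul _ _).
unlock FracField.tofrac; rewrite -[LHS]FracField.pi_mul; apply/eqmodP.
rewrite /= /FracField.equivf /FracField.mulf.
by rewrite !numden_Ratio ?mulr1 ?oner_eq0 ?denom_ratioP //= reprK mulrC.
Qed.

Section FracMap.
Variables (A B : idomainType) (f : {rmorphism A -> B}).

Definition frac_map of injective f := fun x : {fraction A} =>
  (f \n_(repr x))%:F / (f \d_(repr x))%:F.

Hypothesis f_inj : injective f.

Lemma frac_map_den (d : A) : d != 0 -> (f d)%:F != 0.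
Proof. by rewrite tofrac_eq0 (raddf_eq0 _ f_inj). Qed.

Lemma frac_map_quot (n d : A) :
  d != 0 -> frac_map f_inj (n%:F / d%:F) = (f n)%:F / (f d)%:F.
Proof.
move=> d0; rewrite /frac_map; set x := n%:F / d%:F.
have e0 := denom_ratioP (repr x).
have /eqP := fracE x; rewrite {1}/x eqr_div ?tofrac_eq0 // -!tofracM tofrac_eq.
move=> /eqP/(congr1 f); rewrite !rmorphM => h.
by apply/esym/eqP; rewrite eqr_div ?frac_map_den // -!tofracM h.
Qed.

Lemma frac_map_tofrac (a : A) : frac_map f_inj a%:F = (f a)%:F.
Proof.
by rewrite -[a%:F]divr1 -tofrac1 frac_map_quot ?oner_eq0 // rmorph1 divr1.
Qed.

Lemma frac_map_is_zmod_morphism : zmod_morphism (frac_map f_inj).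
Proof.
move=> x y; rewrite [in LHS](fracE x) [in LHS](fracE y).
have dx := denom_ratioP (repr x); have dy := denom_ratioP (repr y).
rewrite -mulNr -tofracN addf_div ?tofrac_eq0 // -!tofracM -tofracD.
rewrite frac_map_quot ?mulf_neq0 // !(rmorphD, rmorphM, rmorphN) /=.
by rewrite -addf_div ?frac_map_den // mulNr.
Qed.

Lemma frac_map_is_monoid_morphism : monoid_morphism (frac_map f_inj).
Proof.
split=> [|x y]; first by rewrite -tofrac1 frac_map_tofrac rmorph1.
rewrite [in LHS](fracE x) [in LHS](fracE y).
have dx := denom_ratioP (repr x); have dy := denom_ratioP (repr y).
by rewrite mulf_div -!tofracM frac_map_quot ?mulf_neq0 // !rmorphM mulf_div.
Qed.

HB.instance Definition _ := GRing.isZmodMorphism.Build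
  {fraction A} {fraction B} (frac_map f_inj) frac_map_is_zmod_morphism.
HB.instance Definition _ := GRing.isMonoidMorphism.Build
  {fraction A} {fraction B} (frac_map f_inj) frac_map_is_monoid_morphism.

End FracMap.

Section ResidueField.
Variables (R : comNzRingType) (q : Spec R).

Definition residue_field : fieldType := {fraction quot_domain q}.

Definition to_residue : {rmorphism R -> residue_field} :=
  @FracField.tofrac (quot_domain q) \o @to_quot R q.

End ResidueField.

Section ResidueMap.
Variables (R S : comNzRingType) (f : {rmorphism R -> S}) (q : Spec S).

Definition quot_map (x : quot_domain (Spec_map f q)) : quot_domain q :=
  to_quot q (f (repr x)).

Lemma to_quotK (x : quot_domain (Spec_map f q)) :
  to_quot (Spec_map f q) (repr x) = x.
Proof. exact: reprK. Qed.

Lemma quot_map_to_quot a : quot_map (to_quot (Spec_map f q) a) = to_quot q (f a).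
Proof.
apply/eqP; rewrite -subr_eq0 -!rmorphB to_quot_eq0.
rewrite -[_ \in _]/(_ - a \in (Spec_map f q : pred R)) -to_quot_eq0 rmorphB.
by rewrite subr_eq0 /= to_quotK.
Qed.

Lemma quot_map_is_zmod_morphism : zmod_morphism quot_map.
Proof.
move=> x y; rewrite -(to_quotK x) -(to_quotK y) -rmorphB !quot_map_to_quot.
by rewrite !rmorphB.
Qed.

Lemma quot_map_is_monoid_morphism : monoid_morphism quot_map.
Proof.
split=> [|x y]; first by rewrite -(rmorph1 (to_quot _)) /= quot_map_to_quot !rmorph1.
rewrite -(to_quotK x) -(to_quotK y) -rmorphM !quot_map_to_quot.
by rewrite !rmorphM.
Qed.

HB.instance Definition _ := GRing.isZmodMorphism.Build
  (quot_domain (Spec_map f q)) (quot_domain q) quot_map quot_map_is_zmod_morphism.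
HB.instance Definition _ := GRing.isMonoidMorphism.Build
  (quot_domain (Spec_map f q)) (quot_domain q) quot_map quot_map_is_monoid_morphism.

Lemma quot_map_inj : injective quot_map.
Proof.
apply: raddf_inj => x; rewrite -(to_quotK x) /= quot_map_to_quot => /eqP.
by rewrite to_quot_eq0 => h; apply/eqP; rewrite to_quot_eq0.
Qed.

Definition residue_map :
    {rmorphism residue_field (Spec_map f q) -> residue_field q} :=
  frac_map quot_map_inj.

Lemma residue_map_to_residue a :
  residue_map (to_residue (Spec_map f q) a) = to_residue q (f a).
Proof. by rewrite /= frac_map_tofrac /= quot_map_to_quot. Qed.

End ResidueMap.

Section Cokernel.
Variables (A B : zmodType) (f : {additive A -> B}).

Definition range_pred : {pred B} := fun b => `[< exists a, f a = b >].

Lemma range_pred_zmod_closed : zmod_closed range_pred.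
Proof.
split=> [|_ _ /asboolP[a <-] /asboolP[b <-]].
  by apply/asboolP; exists 0; rewrite raddf0.
by apply/asboolP; exists (a - b); rewrite raddfB.
Qed.

HB.instance Definition _ := GRing.isZmodClosed.Build B range_pred
  range_pred_zmod_closed.

Definition cokernel : zmodType := @Quotient.quot B range_pred.

End Cokernel.

(* Also for [p = 1], where it says that [A] is trivial. *)
Definition p_torsion (p : nat) (A : zmodType) : Prop :=
  forall a : A, exists n : nat, a *+ (p ^ n) = 0.

(* The multiplicative group of a field, written additively. *)
Section MultiplicativeGroup.
Variable F : fieldType.

Record mulgroup := Mulgroup { mulgroup_val :> F; _ : mulgroup_val != 0 }.

HB.instance Definition _ := [isSub for mulgroup_val].
HB.instance Definition _ := [Choice of mulgroup by <:].

Lemma mulgroup_neq0 (x : mulgroup) : (x : F) != 0. Proof. by case: x. Qed.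

Definition mg_zero := Mulgroup (oner_neq0 F).
Lemma mulgroup_inv_neq0 (x : mulgroup) : (val x)^-1 != 0.
Proof. by rewrite invr_eq0 mulgroup_neq0. Qed.
Definition mg_opp (x : mulgroup) := Mulgroup (mulgroup_inv_neq0 x).
Definition mg_add (x y : mulgroup) :=
  Mulgroup (mulf_neq0 (mulgroup_neq0 x) (mulgroup_neq0 y)).

Lemma mg_addA : associative mg_add.
Proof. by move=> x y z; apply: val_inj; rewrite /= mulrA. Qed.
Lemma mg_addC : commutative mg_add.
Proof. by move=> x y; apply: val_inj; rewrite /= mulrC. Qed.
Lemma mg_add0 : left_id mg_zero mg_add.
Proof. by move=> x; apply: val_inj; rewrite /= mul1r. Qed.
Lemma mg_addN : left_inverse mg_zero mg_opp mg_add.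
Proof. by move=> x; apply: val_inj; rewrite /= mulVf ?mulgroup_neq0. Qed.

HB.instance Definition _ :=
  GRing.isZmodule.Build mulgroup mg_addA mg_addC mg_add0 mg_addN.

End MultiplicativeGroup.

Section MulgroupMap.
Variables (F G : fieldType) (f : {rmorphism F -> G}).

Lemma mulgroup_map_subproof (x : mulgroup F) : f (val x) != 0.
Proof. by rewrite fmorph_eq0 mulgroup_neq0. Qed.

Definition mulgroup_map (x : mulgroup F) : mulgroup G :=
  Mulgroup (mulgroup_map_subproof x).

Lemma mulgroup_map_is_zmod_morphism : zmod_morphism mulgroup_map.
Proof. by move=> x y; apply: val_inj; rewrite /= rmorphM fmorphV. Qed.

HB.instance Definition _ := GRing.isZmodMorphism.Build
  (mulgroup F) (mulgroup G) mulgroup_map mulgroup_map_is_zmod_morphism.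

End MulgroupMap.

Definition valuation_ring (V : idomainType) : Prop :=
  forall x : {fraction V}, x != 0 ->
    (exists a : V, x = a%:F) \/ (exists a : V, x^-1 = a%:F).

Section ValueGroup.
Variable V : idomainType.

Definition unit_pred : {pred mulgroup {fraction V}} :=
  fun x => `[< exists2 a : V, a \is a GRing.unit & val x = a%:F >].

Lemma unit_pred_zmod_closed : zmod_closed unit_pred.
Proof.
split=> [|x y /asboolP[a ua xa] /asboolP[b ub yb]]; apply/asboolP.
  by exists 1; rewrite ?unitr1 ?tofrac1.
exists (a / b); first by rewrite unitrM ua unitrV.
rewrite /= xa yb; apply: (canLR (mulfK _)).
  by rewrite tofrac_eq0; apply: contraTneq ub => ->; rewrite unitr0.
by rewrite -tofracM divrK.
Qed.

HB.instance Definition _ := GRing.isZmodClosed.Build (mulgroup {fraction V})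
  unit_pred unit_pred_zmod_closed.

(* The group [K^* / V^*] where [K] is the fraction field of [V]. *)
Definition value_group : zmodType := @Quotient.quot (mulgroup {fraction V}) unit_pred.

End ValueGroup.

Record domination (V W : idomainType) := Domination {
  dom_map :> {rmorphism V -> W};
  dom_inj : injective dom_map;
  dom_local : forall a : V, dom_map a \is a GRing.unit -> a \is a GRing.unit
}.

Section ValueMap.
Variables (V W : idomainType) (f : domination V W).

Definition value_map (x : value_group V) : value_group W :=
  \pi_(value_group W) (mulgroup_map (frac_map (@dom_inj _ _ f)) (repr x)).

Lemma value_map_pi (x : mulgroup {fraction V}) :
  value_map (\pi_(value_group V) x)
  = \pi_(value_group W) (mulgroup_map (frac_map (@dom_inj _ _ f)) x).
Proof.
apply/eqP; rewrite /value_map -Quotient.idealrBE -raddfB.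
have : repr (\pi_(value_group V) x) - x \in @unit_pred V.
  by rewrite Quotient.idealrBE reprK.
case/asboolP=> a ua xa; apply/asboolP; exists (f a); first exact: rmorph_unit.
rewrite -[LHS]/(frac_map (@dom_inj _ _ f) (val (repr (\pi_(value_group V) x) - x))).
by rewrite xa frac_map_tofrac.
Qed.

Lemma value_map_is_zmod_morphism : zmod_morphism value_map.
Proof.
move=> x y; rewrite -[x]reprK -[y]reprK -raddfB !value_map_pi.
by rewrite -raddfB -raddfB.
Qed.

HB.instance Definition _ := GRing.isZmodMorphism.Build
  (value_group V) (value_group W) value_map value_map_is_zmod_morphism.

End ValueMap.

Section GeneratedSubfield.
Variables (F : fieldType) (A : set F).

Definition gen_subfield : {pred F} := fun x =>
  `[< forall S : {pred F}, divring_closed S -> (forall a, A a -> a \in S) ->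
      x \in S >].

Lemma gen_subfield_divring_closed : divring_closed gen_subfield.
Proof.
split=> [|x y /asboolP hx /asboolP hy|x y /asboolP hx /asboolP hy];
  apply/asboolP => S cS AS; have [S1 SB SV] := cS => //.
- by apply: SB; [exact: hx|exact: hy].
- by apply: SV; [exact: hx|exact: hy].
Qed.

HB.instance Definition _ :=
  GRing.isDivringClosed.Build F gen_subfield gen_subfield_divring_closed.

Lemma gen_subfieldP a : A a -> a \in gen_subfield.
Proof. by move=> Aa; apply/asboolP => S _; apply. Qed.

Record subfield_of :=
  SubfieldOf { subfield_val :> F; _ : subfield_val \in gen_subfield }.

HB.instance Definition _ := [isSub for subfield_val].
HB.instance Definition _ := [Choice of subfield_of by <:].
HB.instance Definition _ := [SubChoice_isSubIntegralDomain of subfield_of by <:].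
HB.instance Definition _ := [SubIntegralDomain_isSubField of subfield_of by <:].

End GeneratedSubfield.

(* The default value [1] of [xget] is taken in characteristic [0]. *)
Definition charexp (F : fieldType) : nat :=
  xget 1%N [set p : nat | p \in [pchar F]].

Definition purely_inseparable (F : fieldType) (E : {pred F}) : Prop :=
  forall x : F, exists n : nat, x ^+ (charexp F ^ n) \in E.

Section TensorProduct.
Variables (k L M : fieldType) (jL : {rmorphism k -> L}) (jM : {rmorphism k -> M}).

Definition balanced (A : zmodType) (f : L -> M -> A) : Prop :=
  [/\ forall a a' b, f (a + a') b = f a b + f a' b,
      forall a b b', f a (b + b') = f a b + f a b' &
      forall a b c, f (a * jL c) b = f a (jM c * b)].

Definition eval_sum (A : zmodType) (f : L -> M -> A) (s : seq (L * M)) : A :=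
  \sum_(z <- s) f z.1 z.2.

(* Two finite sums of pure tensors agree when every [k]-balanced biadditive map
   takes the same value on both; this is the tensor product, as the latter is
   the target of the universal such map. *)
Definition tensor_eqv (s t : seq (L * M)) : bool :=
  `[< forall (A : zmodType) (f : L -> M -> A),
      balanced f -> eval_sum f s = eval_sum f t >].

Lemma tensor_eqv_is_equiv : equiv_class_of tensor_eqv.
Proof.
split=> [s|s t|t s u]; first exact/asboolP.
  by apply/asboolP/asboolP => h A f bf; rewrite h.
by move=> /asboolP h1 /asboolP h2; apply/asboolP => A f bf; rewrite h1 ?h2.
Qed.

Canonical tensor_eqv_equiv := EquivRelPack tensor_eqv_is_equiv.

Definition tensor : Type := {eq_quot tensor_eqv}.

HB.instance Definition _ := Choice.on tensor.
HB.instance Definition _ : EqQuotient _ tensor_eqv tensor := EqQuotient.on tensor.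

Definition tens (s : seq (L * M)) : tensor := \pi_tensor s.

Lemma tensP s t : tens s = tens t <->
  forall (A : zmodType) (f : L -> M -> A),
    balanced f -> eval_sum f s = eval_sum f t.
Proof.
by split=> [/eqmodP/asboolP//|h]; apply/eqmodP/asboolP.
Qed.

Lemma tensK x : tens (repr x) = x. Proof. exact: reprK. Qed.

Lemma eval_repr (A : zmodType) (f : L -> M -> A) s :
  balanced f -> eval_sum f (repr (tens s)) = eval_sum f s.
Proof. by have /tensP h := tensK (tens s); exact: h. Qed.

Definition opp_sum (s : seq (L * M)) := [seq (- z.1, z.2) | z <- s].
Definition mul_sum (s t : seq (L * M)) :=
  [seq (x.1 * y.1, x.2 * y.2) | x <- s, y <- t].

Definition tensor_add (x y : tensor) := tens (repr x ++ repr y).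
Definition tensor_opp (x : tensor) := tens (opp_sum (repr x)).
Definition tensor_mul (x y : tensor) := tens (mul_sum (repr x) (repr y)).

Section Balanced.
Variables (A : zmodType) (f : L -> M -> A).
Hypothesis bf : balanced f.

Lemma eval_cat s t : eval_sum f (s ++ t) = eval_sum f s + eval_sum f t.
Proof. exact: big_cat. Qed.

Lemma balanced0l b : f 0 b = 0.
Proof.
have [h _ _] := bf; apply: (addrI (f 0 b)).
by rewrite -h !addr0.
Qed.

Lemma balancedNl a b : f (- a) b = - f a b.
Proof.
have [h _ _] := bf; apply: (addrI (f a b)).
by rewrite -h !subrr balanced0l.
Qed.

Lemma eval_opp s : eval_sum f (opp_sum s) = - eval_sum f s.
Proof.
by rewrite /eval_sum big_map -sumrN; apply: eq_bigr => z _; rewrite balancedNl.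
Qed.

Lemma balanced_mul a b : balanced (fun c d => f (a * c) (b * d)).
Proof.
have [h1 h2 h3] := bf; split=> *; rewrite ?mulrDr ?h1 ?h2 //.
by rewrite mulrA h3 mulrCA.
Qed.

Lemma eval_mul s t : eval_sum f (mul_sum s t) =
  \sum_(x <- s) eval_sum (fun c d => f (x.1 * c) (x.2 * d)) t.
Proof. by rewrite /eval_sum /mul_sum big_allpairs_dep. Qed.

Lemma eval_mulC s t : eval_sum f (mul_sum s t) = eval_sum f (mul_sum t s).
Proof.
rewrite !eval_mul /eval_sum exchange_big; apply: eq_bigr => x _.
by apply: eq_bigr => y _; rewrite mulrC [_.2 * _]mulrC.
Qed.

End Balanced.

Lemma tens_cat s t : tens (s ++ t) = tensor_add (tens s) (tens t).
Proof. by apply/tensP => A f bf; rewrite !eval_cat !eval_repr. Qed.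

Lemma tens_opp s : tens (opp_sum s) = tensor_opp (tens s).
Proof. by apply/tensP => A f bf; rewrite !eval_opp // eval_repr. Qed.

Lemma tens_mul s t : tens (mul_sum s t) = tensor_mul (tens s) (tens t).
Proof.
apply/tensP => A f bf.
have er u v : eval_sum f (mul_sum u v) = eval_sum f (mul_sum u (repr (tens v))).
  rewrite !eval_mul; apply: eq_bigr => x _.
  by rewrite eval_repr //; exact: balanced_mul.
by rewrite er eval_mulC er eval_mulC.
Qed.

Lemma tens_ind (P : tensor -> Prop) : (forall s, P (tens s)) -> forall x, P x.
Proof. by move=> h x; rewrite -[x]tensK. Qed.

Lemma tensor_addA : associative tensor_add.
Proof.
do 3!elim/tens_ind => ?; rewrite -!tens_cat; congr tens; exact: catA.
Qed.

Lemma tensor_addC : commutative tensor_add.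
Proof.
elim/tens_ind => s; elim/tens_ind => t; rewrite -!tens_cat.
by apply/tensP => A f bf; rewrite !eval_cat addrC.
Qed.

Lemma tensor_add0 : left_id (tens [::]) tensor_add.
Proof. by elim/tens_ind => s; rewrite -tens_cat. Qed.

Lemma tensor_addN : left_inverse (tens [::]) tensor_opp tensor_add.
Proof.
elim/tens_ind => s; rewrite -tens_opp -tens_cat; apply/tensP => A f bf.
by rewrite eval_cat eval_opp // addNr /eval_sum big_nil.
Qed.

HB.instance Definition _ := GRing.isZmodule.Build tensor
  tensor_addA tensor_addC tensor_add0 tensor_addN.

Lemma tensor_mulA : associative tensor_mul.
Proof.
elim/tens_ind => s; elim/tens_ind => t; elim/tens_ind => u; rewrite -!tens_mul.
apply/tensP => A f bf; rewrite !eval_mul /eval_sum.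
rewrite [RHS]big_allpairs_dep; apply: eq_bigr => x _.
rewrite [LHS]big_allpairs_dep; apply: eq_bigr => y _ /=.
by apply: eq_bigr => z _; rewrite !mulrA.
Qed.

Lemma tensor_mulC : commutative tensor_mul.
Proof.
elim/tens_ind => s; elim/tens_ind => t; rewrite -!tens_mul.
by apply/tensP => A f bf; rewrite eval_mulC.
Qed.

Lemma tensor_mul1 : left_id (tens [:: (1, 1)]) tensor_mul.
Proof.
elim/tens_ind => s; rewrite -tens_mul; apply/tensP => A f bf.
rewrite eval_mul big_seq1 /eval_sum; apply: eq_bigr => x _ /=.
by rewrite !mul1r.
Qed.

Lemma tensor_mulDl : left_distributive tensor_mul +%R.
Proof.
elim/tens_ind => s; elim/tens_ind => t; elim/tens_ind => u.
rewrite -[_ + _]tens_cat -!tens_mul -[RHS]tens_cat; congr tens.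
by rewrite /mul_sum allpairs_cat.
Qed.

(* A [k]-linear retraction of [jL] makes [1 (x) 1] nonzero. *)
Lemma linear_retraction : exists r : L -> k,
  [/\ r 1 = 1, forall a b, r (a + b) = r a + r b &
      forall a c, r (a * jL c) = r a * c].
Proof.
pose P (X : set L) := ~ X 1 /\ forall x y c, X x -> X y -> X (x + y * jL c).
have [F FP Ftot|H [[H1 HP] Hmax]] := @Zorn_bigcup L P.
  split=> [[X /FP[]]//|x y c [X FX Xx] [Y FY Yy]].
  have [XY|YX] := Ftot _ _ FX FY.
    by exists Y => //; have [_ h] := FP _ FY; apply: h => //; exact: XY.
  by exists X => //; have [_ h] := FP _ FX; apply: h => //; exact: YX.
have P0 : P [set 0].
  split=> [/eqP|x y c -> ->]; first by rewrite oner_eq0.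
  by rewrite mul0r addr0.
have H0 : H 0.
  have [[x Hx]|nH] := pselect (exists x, H x).
    by have := HP _ _ (- 1) Hx Hx; rewrite rmorphN1 mulrN1 subrr.
  exfalso; apply: (Hmax _ _ P0); split; last by move=> /(_ 0 erefl) H0; apply: nH; exists 0.
  by move=> x Hx; exfalso; apply: nH; exists x.
have HD x y : H x -> H y -> H (x + y).
  by move=> Hx Hy; have := HP _ _ 1 Hx Hy; rewrite rmorph1 mulr1.
have HZ x c : H x -> H (x * jL c).
  by move=> Hx; have := HP _ _ c H0 Hx; rewrite add0r.
have HN x : H x -> H (- x).
  by move=> /(HZ _ (- 1)); rewrite rmorphN1 mulrN1.
have dec x : exists c, H (x - jL c).
  have [Hx|nHx] := pselect (H x); first by exists 0; rewrite rmorph0 subr0.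
  pose X : set L := [set y | exists2 h, H h & exists c, y = h + x * jL c].
  have [X1|nX1] := pselect (X 1); last first.
    exfalso; apply: (Hmax X); last split => //.
      split=> [y Hy|]; first by exists y => //; exists 0; rewrite rmorph0 mulr0 addr0.
      move=> /(_ x) XH; apply: nHx; apply: XH; exists 0 => //.
      by exists 1; rewrite rmorph1 mulr1 add0r.
    move=> _ _ c [h Hh [a ->]] [h' Hh' [b ->]].
    exists (h + h' * jL c); first exact: HP.
    by exists (a + b * c); rewrite rmorphD rmorphM mulrDl mulrDr mulrA addrACA.
  have [h Hh [c e]] := X1.
  have c0 : c != 0.
    by apply: contra_notN H1 => /eqP c0; rewrite e c0 rmorph0 mulr0 addr0.
  exists c^-1; have -> : x - jL c^-1 = - (h * jL c^-1).
    have jc0 : jL c != 0 by rewrite fmorph_eq0.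
    rewrite fmorphV; apply: (mulIf jc0); rewrite mulrBl mulNr mulVf // divfK //.
    by rewrite e opprD addrCA subrr addr0.
  by apply: HN; exact: HZ.
have uni x c d : H (x - jL c) -> H (x - jL d) -> c = d.
  move=> hc hd; apply/eqP; rewrite -subr_eq0; apply: contra_notT H1 => cd0.
  have := HZ _ (c - d)^-1 (HD _ _ hd (HN _ hc)).
  rewrite opprB addrC addrA subrK -rmorphB -rmorphM divff ?rmorph1 //.
have [r rP] := choice dec; exists r; split.
- by apply: (uni 1) => //; rewrite rmorph1 subrr.
- move=> a b; apply: (uni (a + b)) => //.
  by rewrite rmorphD opprD addrACA; exact: HD.
- move=> a c; apply: (uni (a * jL c)) => //.
  by rewrite rmorphM -mulrBl; exact: HZ.
Qed.

Lemma tensor_oner_neq0 : tens [:: (1, 1)] != 0.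
Proof.
have [r [r1 rD rZ]] := linear_retraction.
apply/eqP => e; have {}e : tens [:: (1, 1)] = tens [::] := e.
suff bf : balanced (fun a b => jM (r a) * b).
  have /eqP := (tensP _ _).1 e M _ bf.
  by rewrite /eval_sum big_seq1 big_nil /= r1 rmorph1 mulr1 oner_eq0.
split=> [a a' b|a b b'|a b c]; rewrite ?rD ?rmorphD ?mulrDl ?mulrDr //.
by rewrite rZ rmorphM mulrA.
Qed.

HB.instance Definition _ := GRing.Zmodule_isComNzRing.Build tensor
  tensor_mulA tensor_mulC tensor_mul1 tensor_mulDl tensor_oner_neq0.

Lemma tens_sum s : tens s = \sum_(z <- s) tens [:: z].
Proof.
elim: s => [|z s IHs]; first by rewrite big_nil.
by rewrite big_cons -IHs -cat1s tens_cat.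
Qed.

Lemma balanced_tens : balanced (fun a b => tens [:: (a, b)]).
Proof.
split=> [a a' b|a b b'|a b c]; rewrite -?[RHS]tens_cat.
- by apply/tensP => A f [h _ _]; rewrite eval_cat /eval_sum !big_seq1 h.
- by apply/tensP => A f [_ h _]; rewrite eval_cat /eval_sum !big_seq1 h.
- by apply/tensP => A f [_ _ h]; rewrite /eval_sum !big_seq1 h.
Qed.

Section TensorMap.
Variables (D : fieldType) (u : {rmorphism L -> D}) (v : {rmorphism M -> D}).

Definition compatible : Prop := forall c : k, u (jL c) = v (jM c).

Definition tensor_map of compatible := fun x : tensor =>
  eval_sum (fun a b => u a * v b) (repr x).

Hypothesis uv : compatible.

Lemma balanced_map : balanced (fun a b => u a * v b).
Proof.
split=> [a a' b|a b b'|a b c]; rewrite ?rmorphD ?mulrDl ?mulrDr //.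
by rewrite !rmorphM uv mulrA.
Qed.

Lemma tensor_map_tens s :
  tensor_map uv (tens s) = \sum_(z <- s) u z.1 * v z.2.
Proof. by rewrite /tensor_map eval_repr //; exact: balanced_map. Qed.

Lemma tensor_map_eval s :
  tensor_map uv (tens s) = eval_sum (fun a b => u a * v b) s.
Proof. exact: tensor_map_tens. Qed.

Lemma tensor_map_is_zmod_morphism : zmod_morphism (tensor_map uv).
Proof.
elim/tens_ind => s; elim/tens_ind => t.
rewrite -[- tens t]tens_opp -[_ + _]tens_cat !tensor_map_eval.
by rewrite eval_cat eval_opp //; exact: balanced_map.
Qed.

Lemma tensor_map_is_monoid_morphism : monoid_morphism (tensor_map uv).
Proof.
split.
  by rewrite -[1 in LHS]/(tens [:: (1, 1)]) tensor_map_tens big_seq1 !rmorph1 mulr1.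
elim/tens_ind => s; elim/tens_ind => t.
rewrite -[_ * _ in LHS]tens_mul !tensor_map_eval eval_mul.
rewrite [in RHS]/eval_sum big_distrl; apply: eq_bigr => x _.
by rewrite big_distrr; apply: eq_bigr => y _ /=; rewrite !rmorphM mulrACA.
Qed.

HB.instance Definition _ := GRing.isZmodMorphism.Build
  tensor D (tensor_map uv) tensor_map_is_zmod_morphism.
HB.instance Definition _ := GRing.isMonoidMorphism.Build
  tensor D (tensor_map uv) tensor_map_is_monoid_morphism.

End TensorMap.

End TensorProduct.

Section Composite.
Variables (k L M : fieldType) (jL : {rmorphism k -> L}) (jM : {rmorphism k -> M}).

Record composite_extension := CompositeExtension {
  ce_field : fieldType;
  ce_left : {rmorphism L -> ce_field};
  ce_right : {rmorphism M -> ce_field};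
  ce_compatible : compatible jL jM ce_left ce_right;
  ce_generated :
    forall x, x \in gen_subfield (range ce_left `|` range ce_right)
}.

Definition maximal_composite (E : composite_extension) : Prop :=
  maximal_point (kernel_point (tensor_map (ce_compatible E))).

End Composite.

Section SubfieldComposite.
Variables (k L M F : fieldType) (jL : {rmorphism k -> L}) (jM : {rmorphism k -> M}).
Variables (u : {rmorphism L -> F}) (v : {rmorphism M -> F}).

Definition compositum_set : set F := range u `|` range v.

Local Notation E := (subfield_of compositum_set).

Lemma compositum_left a : u a \in gen_subfield compositum_set.
Proof. by apply: gen_subfieldP; left; exists a. Qed.
Lemma compositum_right b : v b \in gen_subfield compositum_set.
Proof. by apply: gen_subfieldP; right; exists b. Qed.

Definition to_compositum_left (a : L) : E := SubfieldOf (compositum_left a).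
Definition to_compositum_right (b : M) : E := SubfieldOf (compositum_right b).

Lemma to_compositum_left_zmod : zmod_morphism to_compositum_left.
Proof. by move=> a b; apply: val_inj; rewrite rmorphB /= rmorphB. Qed.
Lemma to_compositum_left_monoid : monoid_morphism to_compositum_left.
Proof.
by split=> [|a b]; apply: val_inj; rewrite ?rmorph1 ?rmorphM /= ?rmorph1 ?rmorphM.
Qed.
Lemma to_compositum_right_zmod : zmod_morphism to_compositum_right.
Proof. by move=> a b; apply: val_inj; rewrite rmorphB /= rmorphB. Qed.
Lemma to_compositum_right_monoid : monoid_morphism to_compositum_right.
Proof.
by split=> [|a b]; apply: val_inj; rewrite ?rmorph1 ?rmorphM /= ?rmorph1 ?rmorphM.
Qed.

HB.instance Definition _ := GRing.isZmodMorphism.Build L E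
  to_compositum_left to_compositum_left_zmod.
HB.instance Definition _ := GRing.isMonoidMorphism.Build L E
  to_compositum_left to_compositum_left_monoid.
HB.instance Definition _ := GRing.isZmodMorphism.Build M E
  to_compositum_right to_compositum_right_zmod.
HB.instance Definition _ := GRing.isMonoidMorphism.Build M E
  to_compositum_right to_compositum_right_monoid.

Lemma compositum_generated (x : E) :
  x \in gen_subfield (range to_compositum_left `|` range to_compositum_right).
Proof.
set A := (X in gen_subfield X).
have [A1 AB AV] := gen_subfield_divring_closed A.
pose S : {pred F} := fun y => `[< exists2 z : E, z \in gen_subfield A & val z = y >].
have : val x \in S.
  have /asboolP := valP x; apply.
    split=> [|y z /asboolP[a Aa <-] /asboolP[b Ab <-]|
              y z /asboolP[a Aa <-] /asboolP[b Ab <-]]; apply/asboolP.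
    - by exists 1 => //; rewrite rmorph1.
    - by exists (a - b); [exact: AB|rewrite rmorphB].
    - by exists (a / b); [exact: AV|rewrite fmorph_div].
  move=> _ [[a _ <-]|[b _ <-]]; apply/asboolP.
    by exists (to_compositum_left a) => //; apply: gen_subfieldP; left; exists a.
  by exists (to_compositum_right b) => //; apply: gen_subfieldP; right; exists b.
by move=> /asboolP[z Az /val_inj <-].
Qed.

Hypothesis uv : compatible jL jM u v.

Lemma to_compositum_compatible :
  compatible jL jM to_compositum_left to_compositum_right.
Proof. by move=> c; apply: val_inj; exact: uv. Qed.

(* The subfield of [F] generated by the images of [u] and [v]. *)
Definition compositum : composite_extension jL jM :=
  CompositeExtension to_compositum_compatible compositum_generated.

End SubfieldComposite.

(* Main.v *)
From HB Require Import structures.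
Require Import Defs.
From mathcomp Require Import all_boot all_order all_algebra.
From mathcomp Require Import all_classical topology ring_quotient fraction.
From mathcomp Require Import generic_quotient mxpoly.
From mathcomp Require separable.

Set Implicit Arguments.
Unset Strict Implicit.
Unset Printing Implicit Defensive.

Import GRing.Theory.
Local Open Scope classical_set_scope.
Local Open Scope quotient_scope.
Local Open Scope ring_scope.

Local Notation "x %:F" := (FracField.tofrac x).

(** Let K be the fraction field of V, kappa its residue field and p the
    characteristic exponent. The ring W is a valuation ring of a field E generated
    by K and k'; what has to be controlled is its value group and its residue
    fields.

    Choice of E and W. A subfield k0 of k', maximal for the property that
    k0 (x)_k kappa is a domain, makes k' algebraic over it
    ([exists_regular_subfield]): it stands for the field generated by a
    transcendence basis of k' over k. Call a tensor in k0 (x) V primitive if its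
    image in k0 (x) kappa is nonzero. Primitive tensors form a multiplicative set,
    so some prime ideal of k' (x) K avoids it; E is the residue field of that
    prime, and Chevalley's theorem provides a valuation ring of E that dominates V
    and in which primitive tensors are units ([exists_valued_field]). Since every
    nonzero tensor in k0 (x) K is an element of K times a primitive one
    ([left_part_normal]), this is the Gauss valuation on the fraction field of
    k0 (x) K. The valuation ring contains k' because it contains k0 and is integrally
    closed.

    Control of W. Every x in E satisfies x ^ (p ^ e) = a * z / y for some e, some a
    in K, and some z and y in the ring V[k'] that are units of W ([all_good]). This
    holds on the fraction field of k0 (x) K; a maximal subfield B on which it holds
    is stable under p-th roots, and contains each theta of k' that is separable over
    it, hence all of k'. For the separable step, consider theta and its conjugates:
    their differences are algebraic over k0, hence units. By Lagrange interpolation,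
    an element h(theta) whose value is the smallest among those of its conjugates
    has the value of a coefficient of h ([dominated_value]). Any x = g(theta) is a
    quotient of two such elements: some t = x ^ e / a with a in B is a unit, and f
    can be chosen in Z[T] so that 1 / f(t) and x / f(t) are both of this kind
    ([good_value]).

    Conclusions. By [all_good] every b in W has a power b ^ (p ^ e) associated to an
    element of V; this gives the p-torsion of the quotient of value groups and, a
    prime of W being determined by the elements of V that it contains, the
    homeomorphism. It also shows that residues of elements of W are purely
    inseparable over the field generated by k' and kappa(q). Finally k0 (x) kappa(q) embeds in
    kappa(q') because primitive tensors are units of W, and k' (x) kappa(q) is
    integral over it, so by incomparability the kernel of
    k' (x) kappa(q) -> kappa(q') is a minimal prime. *)

(** * Zorn's lemma and prime ideals *)

(** Starting from [A0] disposes of the empty chain, so that only nonempty chains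
    have to be dealt with in applications. *)
Lemma Zorn_above (T : Type) (P : set (set T)) (A0 : set T) :
  P A0 ->
  (forall F : set (set T), F !=set0 -> F `<=` P -> total_on F subset ->
    P (\bigcup_(X in F) X)) ->
  exists A, [/\ A0 `<=` A, P A & forall B, A `<=` B -> P B -> B = A].
Proof.
move=> PA0 Pch; pose Q (X : set T) := P (A0 `|` X).
have [|A [QA Amax]] := @Zorn_bigcup T Q.
  move=> F FQ Ftot; rewrite /Q.
  have [[X0 FX0]|F0] := pselect (F !=set0); last first.
    suff -> : \bigcup_(X in F) X = set0 by rewrite setU0.
    by apply/seteqP; split=> // x [X FX _]; apply: F0; exists X.
  have -> : A0 `|` \bigcup_(X in F) X = \bigcup_(Y in [set A0 `|` X | X in F]) Y.
    apply/seteqP; split=> x.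
      case=> [A0x|[X FX Xx]]; last by exists (A0 `|` X); [exists X|right].
      by exists (A0 `|` X0); [exists X0|left].
    by case=> _ [X FX <-] [A0x|Xx]; [left|right; exists X].
  apply: Pch; first by exists (A0 `|` X0), X0.
    by move=> _ [X /FQ QX <-].
  move=> _ _ [X FX <-] [Y FY <-].
  have [XY|YX] := Ftot _ _ FX FY; first by left; exact: setUS.
  by right; exact: setUS.
exists (A0 `|` A); split=> //.
move=> B AB PB; apply: contrapT => nBA.
have A0B : A0 `<=` B by move=> x A0x; apply: AB; left.
apply: (Amax B); last by rewrite /Q (setUidPr A0 B).2.
split=> [x Ax|BA]; first by apply: AB; right.
by apply: nBA; apply/seteqP; split=> // x /BA; right.
Qed.

Lemma chain_common (T : Type) (F : set (set T)) a b : total_on F subset ->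
  (\bigcup_(X in F) X) a -> (\bigcup_(X in F) X) b -> exists X, [/\ F X, X a & X b].
Proof.
move=> Ftot [X FX Xa] [Y FY Yb]; have [XY|YX] := Ftot _ _ FX FY.
  by exists Y; split=> //; exact: XY.
by exists X; split=> //; exact: YX.
Qed.

Section SpecOfSet.
Variables (R : comNzRingType) (I : set R).
Hypothesis I0 : I 0.
Hypothesis IN1 : ~ I 1.
Hypothesis ID : forall a b, I a -> I b -> I (a + b).
Hypothesis IM : forall a b, I b -> I (a * b).
Hypothesis IP : forall a b, I (a * b) -> I a \/ I b.

Definition pred_of_ideal : R -> bool := fun a => `[< I a >].

Lemma pred_of_ideal_idealr : idealr_closed pred_of_ideal.
Proof.
split; [exact/asboolP|exact/asboolP|].
move=> a u v /asboolP Iu /asboolP Iv; apply/asboolP.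
by apply: ID => //; exact: IM.
Qed.

Lemma pred_of_ideal_prime : prime_idealr_closed pred_of_ideal.
Proof.
by move=> u v /asboolP/IP[h|h]; apply/orP; [left|right]; apply/asboolP.
Qed.

HB.instance Definition _ := isIdealr.Build R pred_of_ideal pred_of_ideal_idealr.
HB.instance Definition _ :=
  isPrimeIdealrClosed.Build R pred_of_ideal pred_of_ideal_prime.

Lemma Spec_of_set : exists x : Spec R, forall a, a \in (x : pred R) <-> I a.
Proof. by exists pred_of_ideal => a; split=> /asboolP. Qed.

End SpecOfSet.

(** An ideal maximal among those that contain [I] and miss [S] is prime: if it
    contains neither [a] nor [b], then [S] meets both ideals obtained by adding one
    of them, and the product of two such elements of [S] lies in the ideal as soon
    as [a * b] does. *)
Lemma prime_avoiding (R : comNzRingType) (I S : set R) :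
  I 0 -> (forall a b, I a -> I b -> I (a + b)) -> (forall a b, I b -> I (a * b)) ->
  S 1 -> (forall a b, S a -> S b -> S (a * b)) -> (forall a, S a -> ~ I a) ->
  exists x : Spec R, (forall a, I a -> a \in (x : pred R)) /\
                     (forall a, S a -> a \notin (x : pred R)).
Proof.
move=> I0 ID IM S1 SM SI.
pose P (J : set R) := [/\ J 0, (forall a b, J a -> J b -> J (a + b)),
  (forall a b, J b -> J (a * b)) & (forall a, S a -> ~ J a)].
have PI : P I by split.
have [|J [IJ [J0 JD JM JS] Jmax]] := Zorn_above PI.
  move=> F [X0 FX0] FP Ftot; split.
  - by exists X0 => //; have [] := FP _ FX0.
  - move=> a b Fa Fb; have [X [FX Xa Xb]] := chain_common Ftot Fa Fb.
    by exists X => //; have [_ h _ _] := FP _ FX; exact: h.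
  - by move=> a b [X FX Xb]; exists X => //; have [_ _ h _] := FP _ FX; exact: h.
  - by move=> a Sa [X FX Xa]; have [_ _ _ h] := FP _ FX; exact: h Xa.
have meet u : ~ J u -> exists s a r, [/\ S s, J a & s = a + r * u].
  move=> nJu; apply: contrapT => none; apply: nJu.
  pose B : set R := [set z | exists a r, J a /\ z = a + r * u].
  suff <- : B = J by exists 0, 1; rewrite add0r mul1r.
  apply: Jmax; first by move=> a Ja; exists a, 0; rewrite mul0r addr0.
  split.
  - by exists 0, 0; rewrite mul0r addr0.
  - move=> _ _ [a [r [Ja ->]]] [b [t [Jb ->]]]; exists (a + b), (r + t).
    by split; [exact: JD|rewrite mulrDl addrACA].
  - move=> c _ [a [r [Ja ->]]]; exists (c * a), (c * r).
    by split; [exact: JM|rewrite mulrDr mulrA].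
  - by move=> s Ss [a [r [Ja e]]]; apply: none; exists s, a, r.
have [|a b Jab|x xJ] := Spec_of_set J0 _ JD JM; first exact: JS.
  apply: contrapT => /not_orP[/meet[s [c [r [Ss Jc es]]]] /meet[s' [d [t [Ss' Jd es']]]]].
  apply: (JS (s * s')); first exact: SM.
  rewrite es' mulrDr; apply: (JD); first exact: JM.
  rewrite es mulrDl; apply: (JD); first by rewrite mulrC; exact: JM.
  by rewrite mulrACA; exact: JM.
exists x; split=> a; first by move=> Ia; apply/xJ; exact: IJ.
by move=> Sa; apply/negP => /xJ; exact: JS.
Qed.

(** * Valuation rings of a field *)

(** Since [0^-1 = 0], the condition [vs_total] needs no exception at [0]. *)
Record valsub (E : fieldType) := Valsub {
  vs_pred :> {pred E};
  vs_subring : subring_closed vs_pred;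
  vs_total : forall x, x \in vs_pred \/ x^-1 \in vs_pred
}.

HB.instance Definition _ (E : fieldType) (w : valsub E) :=
  GRing.isSubringClosed.Build E (vs_pred w) (@vs_subring E w).

Section ValsubTheory.
Variables (E : fieldType) (w : valsub E).
Implicit Types x y : E.

Definition vs_unit : {pred E} := [pred x | [&& x != 0, x \in vs_pred w & x^-1 \in vs_pred w]].
Definition vs_max : {pred E} := [pred x | (x \in vs_pred w) && (x \notin vs_unit)].

Lemma vs_unitP x : reflect [/\ x != 0, x \in vs_pred w & x^-1 \in vs_pred w] (x \in vs_unit).
Proof. exact: and3P. Qed.

Lemma vs_unit_in x : x \in vs_unit -> x \in vs_pred w.
Proof. by case/vs_unitP. Qed.

Lemma vs_unit_neq0 x : x \in vs_unit -> x != 0.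
Proof. by case/vs_unitP. Qed.

Lemma vs_unit1 : 1 \in vs_unit.
Proof. by apply/vs_unitP; rewrite oner_neq0 invr1 rpred1. Qed.

Lemma vs_unitV x : x \in vs_unit -> x^-1 \in vs_unit.
Proof. by case/vs_unitP=> *; apply/vs_unitP; rewrite invr_eq0 invrK. Qed.

Lemma vs_unitM x y : x \in vs_unit -> y \in vs_unit -> x * y \in vs_unit.
Proof.
case/vs_unitP=> x0 wx wxV /vs_unitP[y0 wy wyV]; apply/vs_unitP.
by rewrite mulf_neq0 // invfM !rpredM.
Qed.

Lemma vs_unitX x n : x \in vs_unit -> x ^+ n \in vs_unit.
Proof.
by move=> ux; elim: n => [|n IHn]; rewrite ?vs_unit1 // exprS vs_unitM.
Qed.

Lemma vs_max_in x : x \in vs_max -> x \in vs_pred w.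
Proof. by case/andP. Qed.

Lemma vs_max0 : 0 \in vs_max.
Proof.
by apply/andP; split; [exact: rpred0|apply/negP => /vs_unitP[/eqP]].
Qed.

Lemma vs_maxP x : x \in vs_pred w -> (x \notin vs_unit) = (x \in vs_max).
Proof. by move=> wx; rewrite [RHS]inE wx. Qed.

Lemma vs_max_nunit x : x \in vs_max -> x \notin vs_unit.
Proof. by case/andP. Qed.

Lemma vs_notin x : x \notin vs_pred w -> x^-1 \in vs_max.
Proof.
move=> nwx; have [wx|wxV] := vs_total w x; first by rewrite wx in nwx.
rewrite -vs_maxP //; apply: contra nwx => /vs_unitP[_ _].
by rewrite invrK.
Qed.

Lemma vs_maxV x : x \in vs_max -> x != 0 -> x^-1 \notin vs_pred w.
Proof.
move=> /andP[wx nux] x0; apply: contra nux => wxV; exact/vs_unitP.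
Qed.

Lemma vs_maxM x y : x \in vs_pred w -> y \in vs_max -> x * y \in vs_max.
Proof.
move=> wx my; have wy := vs_max_in my; rewrite -vs_maxP ?rpredM //.
apply: contra (vs_max_nunit my) => /vs_unitP[xy0 _ wV]; apply/vs_unitP.
move: xy0; rewrite mulf_eq0 negb_or => /andP[x0 y0]; split=> //.
by rewrite -[y^-1](mulKf x0) mulrCA -invfM rpredM.
Qed.

Lemma vs_maxD x y : x \in vs_max -> y \in vs_max -> x + y \in vs_max.
Proof.
have key a b : a \in vs_max -> b \in vs_max -> a / b \in vs_pred w -> a + b \in vs_max.
  move=> ma mb wab; have [->|b0] := eqVneq b 0; first by rewrite addr0.
  have -> : a + b = (a / b + 1) * b by rewrite mulrDl divfK // mul1r.
  by apply: vs_maxM; rewrite ?rpredD ?rpred1.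
move=> mx my; have [h|h] := vs_total w (x / y); first exact: key.
by rewrite addrC; apply: key => //; rewrite invf_div in h.
Qed.

Lemma vs_maxN x : x \in vs_max -> - x \in vs_max.
Proof. by move=> mx; rewrite -mulN1r; apply: vs_maxM => //; rewrite rpredN rpred1. Qed.

Lemma vs_unitD x y : x \in vs_unit -> y \in vs_max -> x + y \in vs_unit.
Proof.
move=> ux my; apply: contraLR ux => nuxy.
rewrite -[x](addrK y); have [wx|wx] := boolP (x \in vs_pred w); last first.
  by apply: contra wx; rewrite addrK; exact: vs_unit_in.
by apply/vs_max_nunit/vs_maxD; rewrite ?vs_maxN // -vs_maxP ?rpredD ?(vs_max_in my).
Qed.

Lemma vs_max_sum (I : Type) (r : seq I) (P : pred I) (F : I -> E) :
  (forall i, P i -> F i \in vs_max) -> \sum_(i <- r | P i) F i \in vs_max.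
Proof.
by move=> h; elim/big_ind: _ => //; [exact: vs_max0|move=> *; exact: vs_maxD].
Qed.

Lemma vs_expr_in x n : (0 < n)%N -> x ^+ n \in vs_pred w -> x \in vs_pred w.
Proof.
move=> n0 wxn; apply: contraT => nwx; have m := vs_notin nwx.
have x0 : x != 0 by apply: contraNneq nwx => ->; rewrite rpred0.
have : 1 \in vs_max.
  rewrite -(mulfV (expf_neq0 n x0)) -exprVn -(prednK n0) [x^-1 ^+ _]exprSr mulrA.
  by apply: vs_maxM => //; rewrite prednK // rpredM // rpredX // vs_max_in.
by move/vs_max_nunit; rewrite vs_unit1.
Qed.

(** At a point outside [w], the leading term dominates all the others. *)
Lemma monic_pole (p : {poly E}) t : p \is monic -> p \is a polyOver (vs_pred w) ->
  t \notin vs_pred w -> p.[t] / t ^+ (size p).-1 \in vs_unit.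
Proof.
move=> pm pw nt; have m := vs_notin nt.
have t0 : t != 0 by apply: contraNneq nt => ->; rewrite rpred0.
have p0 : (0 < size p)%N by rewrite size_poly_gt0 monic_neq0.
have -> : p.[t] = \sum_(i < (size p).-1.+1) p`_i * t ^+ i by rewrite prednK // -horner_coef.
rewrite big_ord_recr /= -/(lead_coef p) (monicP pm) mul1r mulrDl divff ?expf_neq0 //.
rewrite addrC; apply: vs_unitD; first exact: vs_unit1.
rewrite mulr_suml; apply: vs_max_sum => i _; rewrite -mulrA; apply: vs_maxM.
  exact: (polyOverP pw).
have lt := ltn_ord i; rewrite -invf_div -expfB // -exprVn.
have : (0 < (size p).-1 - i)%N by rewrite subn_gt0.
case: (_ - _)%N => // d _; rewrite exprSr; apply: vs_maxM => //.
by rewrite rpredX // vs_max_in.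
Qed.

Lemma vs_integral x (p : {poly E}) :
  p \is monic -> p \is a polyOver (vs_pred w) -> root p x -> x \in vs_pred w.
Proof.
move=> pm pw /rootP px; apply: contraT => /(monic_pole pm pw)/vs_unit_neq0.
by rewrite px mul0r eqxx.
Qed.

End ValsubTheory.

Section Chevalley.
Variables (E : fieldType) (R0 N0 : set E).

Definition nonunital (N : set E) :=
  [/\ N 0, (forall a b, N a -> N b -> N (a - b)), (forall a b, N a -> N b -> N (a * b)),
      (forall a b, R0 a -> N b -> N (a * b)) & ~ N 1].

(** Chevalley's extension theorem. The maximal ideal of [w] is built first, as a
    maximal element [N] among the sets satisfying [nonunital], and [w] is the ring of
    all [x] such that [x * N] is contained in [N]. If [w] contained neither [x] nor
    [x^-1], then [1] would belong to both [N[x]] and [N[x^-1]], and two relations of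
    minimal degree expressing this contradict each other. *)
Lemma Chevalley : nonunital N0 -> exists w : valsub E,
  (forall x, R0 x -> x \in vs_pred w) /\ (forall x, N0 x -> x \in vs_max w).
Proof.
move=> PN0.
have [|N [N0N [Nz NB NM NR N1] Nmax]] := Zorn_above PN0.
  move=> F [X0 FX0] FP Ftot.
  have pair := chain_common Ftot.
  split.
  - by exists X0 => //; have [] := FP _ FX0.
  - move=> a b Fa Fb; have [X [FX Xa Xb]] := pair _ _ Fa Fb; exists X => //.
    by have [_ H _ _ _] := FP _ FX; exact: H.
  - move=> a b Fa Fb; have [X [FX Xa Xb]] := pair _ _ Fa Fb; exists X => //.
    by have [_ _ H _ _] := FP _ FX; exact: H.
  - by move=> a b Ra [X FX Xb]; exists X => //; have [_ _ _ H _] := FP _ FX; exact: H.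
  - by case=> X FX X1; have [_ _ _ _ H] := FP _ FX; exact: H.
have NN a : N a -> N (- a) by move=> Na; rewrite -sub0r; exact: NB.
have ND a b : N a -> N b -> N (a + b) by move=> Na Nb; rewrite -[b]opprK; exact/NB/NN.
have Nsum (I : Type) (r : seq I) (P : pred I) (f : I -> E) :
    (forall i, P i -> N (f i)) -> N (\sum_(i <- r | P i) f i).
  by move=> h; elim/big_ind: _.
pose W : {pred E} := fun x => `[< forall n, N n -> N (x * n) >].
have WP x : reflect (forall n, N n -> N (x * n)) (x \in W) by exact: asboolP.
have Wring : subring_closed W.
  split=> [|x y /WP hx /WP hy|x y /WP hx /WP hy]; apply/WP => n Nn.
  - by rewrite mul1r.
  - by rewrite mulrBl; apply: NB; [exact: hx|exact: hy].
  - by rewrite -mulrA; exact/hx/hy.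
(* Otherwise [N] could be enlarged by the fractions whose denominators are powers of
   [1 - n]. *)
have inv1B n : N n -> n != 1 /\ (1 - n)^-1 \in W.
  move=> Nn; have u0 : 1 - n != 0.
    by rewrite subr_eq0 eq_sym; apply: contra_notN N1 => /eqP <-.
  split; first by rewrite eq_sym -subr_eq0.
  set u := 1 - n in u0 *.
  have Nu k a : N a -> N (a * u ^+ k).
    elim: k a => [|k IHk] a Na; first by rewrite mulr1.
    by rewrite exprS mulrA; apply: IHk; rewrite mulrBr mulr1; apply/NB/NM.
  pose B : set E := [set y | exists a k, N a /\ y = a / u ^+ k].
  suff BN : B = N by apply/WP => a Na; rewrite -BN; exists a, 1%N; rewrite mulrC.
  apply: Nmax; first by move=> a Na; exists a, 0%N; rewrite expr0 divr1.
  split.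
  - by exists 0, 0%N; rewrite mul0r.
  - move=> _ _ [a [k [Na ->]]] [b [l [Nb ->]]].
    exists (a * u ^+ l - b * u ^+ k), (k + l)%N; split; first by apply: NB; exact: Nu.
    by rewrite -mulNr addf_div ?expf_neq0 // mulNr exprD.
  - move=> _ _ [a [k [Na ->]]] [b [l [Nb ->]]].
    by exists (a * b), (k + l)%N; rewrite mulf_div exprD; split=> //; exact: NM.
  - move=> r _ Rr [a [k [Na ->]]].
    by exists (r * a), k; rewrite mulrA; split=> //; exact: NR.
  - case=> a [k [Na e]]; apply: N1.
    have {}e : u ^+ k = a by rewrite -[a](divfK (expf_neq0 k u0)) -e mul1r.
    have : N (1 - u ^+ k).
      elim: (k) => [|j IHj]; first by rewrite expr0 subrr.
      have -> : 1 - u ^+ j.+1 = (1 - u ^+ j) * u + n.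
        by rewrite exprSr mulrBl mul1r /u addrAC subrK.
      by apply: ND => //; exact: (Nu 1%N).
    by rewrite e => h; rewrite -[1](subrK a); exact: ND.
have one_poly x : x \notin W -> exists2 p : {poly E}, (forall i, N p`_i) & p.[x] = 1.
  move=> nWx; apply: contrapT => none; case/negP: nWx; apply/WP.
  pose B : set E := [set y | exists2 p : {poly E}, (forall i, N p`_i) & y = p.[x]].
  suff BN : B = N.
    move=> n Nn; rewrite -BN; exists (n *: 'X); last by rewrite hornerZ hornerX mulrC.
    by move=> i; rewrite coefZ coefX; case: (_ == _); rewrite ?mulr1 ?mulr0.
  apply: Nmax.
    by move=> n Nn; exists n%:P; rewrite ?hornerC // => i; rewrite coefC; case: ifP.
  split.
  - by exists 0; rewrite ?horner0 // => i; rewrite coef0.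
  - move=> _ _ [p Np ->] [q Nq ->]; exists (p - q); last by rewrite hornerD hornerN.
    by move=> i; rewrite coefB; exact: NB.
  - move=> _ _ [p Np ->] [q Nq ->]; exists (p * q); last by rewrite hornerM.
    by move=> i; rewrite coefM; apply: Nsum => l _; exact: NM.
  - move=> r _ Rr [p Np ->]; exists (r *: p); last by rewrite hornerZ.
    by move=> i; rewrite coefZ; exact: NR.
  - by case=> p Np e; apply: none; exists p.
(* The relation of smaller degree, divided by [1 - q`_0], cancels the leading term
   of the other one. *)
have nopair m (p q : {poly E}) x : (size p + size q <= m)%N -> x != 0 ->
    (forall i, N p`_i) -> (forall i, N q`_i) -> p.[x] = 1 -> q.[x^-1] = 1 -> False.
  elim: m p q x => [|m IHm] p q x szm x0 Np Nq px qx.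
    have p0 : p = 0 by apply/eqP; rewrite -size_poly_eq0; move: szm; case: (size p).
    by move/eqP: px; rewrite p0 horner0 eq_sym oner_eq0.
  wlog qp : p q x szm x0 Np Nq px qx / (size q <= size p)%N.
    move=> h; have [qp|/ltnW pq] := leqP (size q) (size p); first exact: (h p q x).
    by apply: (h q p x^-1) => //; rewrite ?invr_eq0 ?invrK // addnC.
  have p0 : (0 < size p)%N.
    rewrite size_poly_gt0; apply: contraTneq (oner_neq0 E) => p0.
    by rewrite -px p0 horner0 eqxx.
  pose d := (size p).-1; pose u := (1 - q`_0)^-1; pose a := p`_d.
  have [q01 Wu] := inv1B _ (Nq 0%N).
  have Nc j : N (u * q`_j) by move/WP: Wu; apply.
  pose p' := \poly_(i < d) (p`_i + a * (u * q`_(d - i))).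
  apply: (IHm p' q x) => //.
  - rewrite -ltnS; apply: leq_trans szm; rewrite ltn_add2r.
    by apply: leq_ltn_trans (size_poly _ _) _; rewrite /d prednK.
  - move=> i; rewrite coef_poly; case: ifP => // _.
    by apply: ND => //; exact: (NM _ _ (Np d) (Nc _)).
  rewrite horner_poly -px.
  have -> : p.[x] = \sum_(i < d.+1) p`_i * x ^+ i by rewrite prednK // -horner_coef.
  rewrite big_ord_recr /= -/a.
  under eq_bigr do rewrite mulrDl; rewrite big_split /=; congr (_ + _).
  have e : x ^+ d * (1 - q`_0) = \sum_(i < d) q`_(d - i) * x ^+ i.
    rewrite -qx.
    have -> : q.[x^-1] = \sum_(i < d.+1) q`_i * x^-1 ^+ i.
      by apply: horner_coef_wide; rewrite prednK.
    rewrite big_ord_recl expr0 mulr1 addrAC subrr add0r mulr_sumr.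
    rewrite (reindex_inj rev_ord_inj) /=; apply: eq_bigr => i _.
    rewrite /bump /= add1n subnSK // mulrCA; congr (_ * _).
    by rewrite exprVn -expfB_cond ?(negPf x0) ?leq_subr // subKn // ltnW.
  have -> : a * x ^+ d = a * u * \sum_(i < d) q`_(d - i) * x ^+ i.
    by rewrite -e -mulrA [_ ^+ _ * _]mulrC mulKf // subr_eq0 eq_sym.
  rewrite mulr_sumr; apply: eq_bigr => i _; rewrite !mulrA //.
have Wtot x : x \in W \/ x^-1 \in W.
  have [->|x0] := eqVneq x 0.
    by left; apply/WP => n _; rewrite mul0r.
  have [?|/one_poly[p Np px]] := boolP (x \in W); first by left.
  have [?|/one_poly[q Nq qx]] := boolP (x^-1 \in W); first by right.
  by case: (nopair _ p q x (leqnn _)).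
exists (@Valsub E W Wring Wtot); split=> x /=.
  by move=> Rx; apply/WP => n Nn; exact: NR.
move=> /N0N Nx; have Wx : x \in W by apply/WP => n Nn; exact: NM.
rewrite -vs_maxP //; apply/negP => /vs_unitP[/= x0 _ /WP/(_ _ Nx)].
by rewrite mulVf.
Qed.

End Chevalley.

(** * Tensor products of fields *)

Definition klinear (k L : fieldType) (jL : {rmorphism k -> L}) (r : L -> k) :=
  (forall a b, r (a + b) = r a + r b) /\ (forall a c, r (a * jL c) = r a * c).

(** A maximal subspace [H] that contains [U] but not [e] is a complement of the line
    generated by [e]; [r] is the projection onto that line. *)
Lemma klinear_extension (k L : fieldType) (jL : {rmorphism k -> L}) (U : set L) (e : L) :
  U 0 -> (forall a b, U a -> U b -> U (a + b)) -> (forall a c, U a -> U (a * jL c)) ->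
  ~ U e -> exists r : L -> k, [/\ klinear jL r, r e = 1 & forall u, U u -> r u = 0].
Proof.
move=> U0 UD UZ Ue.
pose P (X : set L) := [/\ X 0, (forall a b, X a -> X b -> X (a + b)),
  (forall a c, X a -> X (a * jL c)) & ~ X e].
have PU : P U by split.
have [|H [UH [H0 HD HZ He] Hmax]] := Zorn_above PU.
  move=> F [X0 FX0] FP Ftot; split.
  - by exists X0 => //; have [] := FP _ FX0.
  - move=> a b Fa Fb; have [X [FX Xa Xb]] := chain_common Ftot Fa Fb.
    by exists X => //; have [_ h _ _] := FP _ FX; exact: h.
  - by move=> a c [X FX Xa]; exists X => //; have [_ _ h _] := FP _ FX; exact: h.
  - by case=> X FX Xe; have [_ _ _] := FP _ FX.
have HN x : H x -> H (- x) by move=> /(HZ _ (- 1)); rewrite rmorphN1 mulrN1.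
have dec x : exists c, H (x - e * jL c).
  have [Hx|nHx] := pselect (H x); first by exists 0; rewrite rmorph0 mulr0 subr0.
  pose X : set L := [set y | exists h c, H h /\ y = h + x * jL c].
  have [[h [c [Hh eh]]]|nXe] := pselect (X e); last first.
    case: nHx; suff <- : X = H by exists 0, 1; rewrite rmorph1 mulr1 add0r.
    apply: Hmax; first by move=> y Hy; exists y, 0; rewrite rmorph0 mulr0 addr0.
    split=> //.
    - by exists 0, 0; rewrite rmorph0 mulr0 addr0.
    - move=> _ _ [h [c [Hh ->]]] [h' [c' [Hh' ->]]]; exists (h + h'), (c + c').
      by split; [exact: HD|rewrite rmorphD mulrDr addrACA].
    - move=> _ d [h [c [Hh ->]]]; exists (h * jL d), (c * d).
      by split; [exact: HZ|rewrite rmorphM mulrDl mulrA].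
  have c0 : jL c != 0.
    by apply: contra_notN He => /eqP c0; rewrite eh c0 mulr0 addr0.
  exists c^-1; rewrite eh fmorphV mulrDl mulfK // opprD addrCA subrr addr0 -fmorphV.
  exact/HN/HZ.
have uni x c d : H (x - e * jL c) -> H (x - e * jL d) -> c = d.
  move=> hc hd; apply/eqP; rewrite -subr_eq0; apply: contra_notT He => cd0.
  have := HZ _ (c - d)^-1 (HD _ _ hd (HN _ hc)).
  rewrite opprB addrC addrA subrK -mulrBr -rmorphB fmorphV mulfK //.
  by rewrite fmorph_eq0.
have [r rP] := choice dec; exists r; split.
- split=> [a b|a c].
    apply: (uni (a + b)) => //; rewrite rmorphD mulrDr opprD addrACA; exact: HD.
  by apply: (uni (a * jL c)) => //; rewrite rmorphM mulrA -mulrBl; exact: HZ.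
- by apply: (uni e) => //; rewrite rmorph1 mulr1 subrr.
- by move=> u /UH Hu; apply: (uni u) => //; rewrite rmorph0 mulr0 subr0.
Qed.

Section TensorCalculus.
Variables (k L M : fieldType) (jL : {rmorphism k -> L}) (jM : {rmorphism k -> M}).
Local Notation T := (tensor jL jM).
Local Notation tens := (tens jL jM).

Definition tens_left (a : L) : T := tens [:: (a, 1)].
Definition tens_right (b : M) : T := tens [:: (1, b)].

Lemma tens_left_is_zmod_morphism : zmod_morphism tens_left.
Proof.
have [bl _ _] := balanced_tens jL jM.
by move=> a b; apply/eqP; rewrite eq_sym subr_eq /tens_left -bl subrK.
Qed.

Lemma tens_left_is_monoid_morphism : monoid_morphism tens_left.
Proof.
split=> // a b; rewrite /tens_left -[RHS]tens_mul /mul_sum /=.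
by rewrite mulr1.
Qed.

Lemma tens_right_is_zmod_morphism : zmod_morphism tens_right.
Proof.
have [_ br _] := balanced_tens jL jM.
by move=> a b; apply/eqP; rewrite eq_sym subr_eq /tens_right -br subrK.
Qed.

Lemma tens_right_is_monoid_morphism : monoid_morphism tens_right.
Proof.
split=> // a b; rewrite /tens_right -[RHS]tens_mul /mul_sum /=.
by rewrite mulr1.
Qed.

HB.instance Definition _ := GRing.isZmodMorphism.Build L T tens_left
  tens_left_is_zmod_morphism.
HB.instance Definition _ := GRing.isMonoidMorphism.Build L T tens_left
  tens_left_is_monoid_morphism.
HB.instance Definition _ := GRing.isZmodMorphism.Build M T tens_right
  tens_right_is_zmod_morphism.
HB.instance Definition _ := GRing.isMonoidMorphism.Build M T tens_right
  tens_right_is_monoid_morphism.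

Lemma tens_pure s : tens s = \sum_(z <- s) tens_left z.1 * tens_right z.2.
Proof.
rewrite tens_sum; apply: eq_bigr => -[a b] _.
by rewrite /tens_left /tens_right -[RHS]tens_mul /mul_sum /= mulr1 mul1r.
Qed.

Lemma tens_cons z s : tens (z :: s) = tens_left z.1 * tens_right z.2 + tens s.
Proof. by rewrite !tens_pure big_cons. Qed.

Lemma tens_linking c : tens_left (jL c) = tens_right (jM c).
Proof.
have [_ _ h] := balanced_tens jL jM.
by rewrite /tens_left -[jL c]mul1r h mulr1.
Qed.

Section Contraction.
Variables (r : L -> k) (lr : klinear jL r).

Lemma balanced_contraction : balanced jL jM (fun a b => jM (r a) * b).
Proof.
case: lr => rD rZ; split=> *; rewrite ?rD ?rmorphD ?mulrDl ?mulrDr //.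
by rewrite rZ rmorphM mulrA.
Qed.

(** The map from L (x) M to k (x) M = M induced by [r]. *)
Definition contraction (x : T) : M := eval_sum (fun a b => jM (r a) * b) (repr x).

Lemma contraction_tens s : contraction (tens s) = \sum_(z <- s) jM (r z.1) * z.2.
Proof. by rewrite /contraction eval_repr //; exact: balanced_contraction. Qed.

End Contraction.

(** The k-linear span of the first components of [t]; this recursive form matches the
    induction in [tens_span]. *)
Fixpoint span (t : seq (L * M)) (e : L) : Prop :=
  if t is y :: t' then exists c, span t' (e - y.1 * jL c) else e = 0.

Lemma span0 t : span t 0.
Proof. by elim: t => //= y t IHt; exists 0; rewrite rmorph0 mulr0 subr0. Qed.

Lemma spanD t a b : span t a -> span t b -> span t (a + b).
Proof.
elim: t a b => [|y t IHt] a b /=; first by move=> -> ->; rewrite addr0.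
move=> [c /IHt hc] [d /hc]; exists (c + d).
by rewrite rmorphD mulrDr opprD addrACA.
Qed.

Lemma spanZ t a c : span t a -> span t (a * jL c).
Proof.
elim: t a => [|y t IHt] a /=; first by move=> ->; rewrite mul0r.
by move=> [d /IHt]; exists (d * c); rewrite rmorphM mulrA -mulrBl.
Qed.

Lemma span_mem t y : y \in t -> span t y.1.
Proof.
elim: t => // z t IHt; rewrite inE => /orP[/eqP <-|/IHt h] /=.
  by exists 1; rewrite rmorph1 mulr1 subrr; exact: span0.
by exists 0; rewrite rmorph0 mulr0 subr0.
Qed.

(** A pure tensor whose first component depends linearly on those of [t] can be
    absorbed by changing only the second components of [t]. *)
Lemma tens_span t e b : span t e ->
  exists t', unzip1 t' = unzip1 t /\ tens ((e, b) :: t) = tens t'.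
Proof.
elim: t e b => [|y t IHt] e b /=.
  move=> ->; exists [::]; split=> //.
  by rewrite !tens_pure big_seq1 big_nil rmorph0 mul0r.
move=> [c /(IHt _ b) [t' [u1 et]]]; exists ((y.1, y.2 + jM c * b) :: t').
split; first by rewrite /= u1.
move: et; rewrite !tens_cons /= => <-.
rewrite rmorphB rmorphD !rmorphM /= tens_linking mulrDr mulrBl.
rewrite addrCA -[RHS]addrA; congr (_ + _); rewrite [RHS]addrA; congr (_ + _).
by rewrite mulrA addrC subrK.
Qed.

(** In a representation of minimal length the first components are linearly
    independent, so they admit a dual family of functionals. Linear independence is
    used only in this form below. *)
Lemma tens_dual s : exists s', [/\ tens s' = tens s,
  {subset unzip1 s' <= unzip1 s}, forall z, z \in s' -> z.2 != 0 &
  forall s1 z s2, s' = s1 ++ z :: s2 -> exists r, [/\ klinear jL r, r z.1 = 1 &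
     forall y, y \in s1 ++ s2 -> r y.1 = 0]].
Proof.
have [m] := ubnP (size s); elim: m s => // m IHm s szm.
have front s1 z s2 : tens (s1 ++ z :: s2) = tens (z :: s1 ++ s2).
  by rewrite !tens_pure; apply: perm_big; rewrite perm_catC /= perm_cons perm_catC.
have [[s1 [z [s2 [es bz]]]]|good] := pselect (exists s1 z s2,
    s = s1 ++ z :: s2 /\ (z.2 = 0 \/ span (s1 ++ s2) z.1)).
  have [t' [u1 et]] : exists t', unzip1 t' = unzip1 (s1 ++ s2) /\ tens s = tens t'.
    rewrite es front; case: z bz {es} => e b /= [->|]; last exact: tens_span.
    by exists (s1 ++ s2); rewrite tens_pure big_cons rmorph0 mulr0 add0r -tens_pure.
  have szt : size t' = size (s1 ++ s2) by rewrite -(size_map fst) -/(unzip1 t') u1 size_map.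
  have [|s' [e1 e2 e3 e4]] := IHm t'.
    by rewrite szt -ltnS; apply: leq_trans szm; rewrite es !size_cat /= addnS.
  exists s'; split=> //; first by rewrite e1.
  move=> a /e2; rewrite u1 es /unzip1 !map_cat /= !mem_cat inE.
  by case/orP=> ->; rewrite ?orbT.
exists s; split=> //.
  move=> z /splitPr es; case: es good => s1 s2 good.
  by apply: contra_notN good => /eqP z0; exists s1, z, s2; exact: (conj erefl (or_introl z0)).
move=> s1 z s2 es.
have nsp : ~ span (s1 ++ s2) z.1.
  by move=> sp; apply: good; exists s1, z, s2; exact: (conj es (or_intror sp)).
have [r [lr rz rU]] := @klinear_extension k L jL (span (s1 ++ s2)) z.1 (span0 _)
  (fun a b => @spanD _ a b) (fun a c => @spanZ _ a c) nsp.
by exists r; split=> // y /span_mem; exact: rU.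
Qed.

Lemma contraction_separates (x : T) : x != 0 ->
  exists2 r, klinear jL r & contraction r x != 0.
Proof.
elim/tens_ind: x => s; have [s' [<- _ nz dual]] := tens_dual s.
case: s' nz dual => [|z s'] nz dual; first by rewrite tens_pure big_nil eqxx.
have [r [lr rz r0]] := dual [::] z s' erefl.
exists r => //; rewrite contraction_tens // big_cons rz rmorph1 mul1r.
rewrite big_seq big1 ?addr0; first by apply: nz; rewrite mem_head.
by move=> y ys; rewrite r0 // rmorph0 mul0r.
Qed.

End TensorCalculus.

Section RightContraction.
Variables (k L M : fieldType) (jL : {rmorphism k -> L}) (jM : {rmorphism k -> M}).
Local Notation T := (tensor jL jM).
Local Notation tens := (tens jL jM).

Section Fun.
Variables (r : M -> k) (lr : klinear jM r).

Lemma balanced_contraction_right : balanced jL jM (fun a b => a * jL (r b)).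
Proof.
case: lr => rD rZ; split=> [a a' b|a b b'|a b c]; rewrite ?rD ?rmorphD ?mulrDl ?mulrDr //.
by rewrite [jM c * b]mulrC rZ rmorphM -mulrA [jL c * _]mulrC.
Qed.

(** The map from L (x) M to L (x) k = L induced by [r]. *)
Definition contraction_right (x : T) : L := eval_sum (fun a b => a * jL (r b)) (repr x).

Lemma contraction_right_tens s :
  contraction_right (tens s) = \sum_(z <- s) z.1 * jL (r z.2).
Proof. by rewrite /contraction_right eval_repr //; exact: balanced_contraction_right. Qed.

Lemma contraction_rightD x y :
  contraction_right (x + y) = contraction_right x + contraction_right y.
Proof.
elim/tens_ind: x => s; elim/tens_ind: y => t.
by rewrite -[tens s + _]tens_cat !contraction_right_tens big_cat.
Qed.

Lemma contraction_right0 : contraction_right 0 = 0.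
Proof. by rewrite -[0]/(tens [::]) contraction_right_tens big_nil. Qed.

Lemma contraction_rightM x b :
  contraction_right (x * tens_left jL jM b) = contraction_right x * b.
Proof.
elim/tens_ind: x => s; rewrite {1}tens_pure big_distrl /=.
under eq_bigr => z _ do rewrite mulrAC -rmorphM /=.
rewrite -(big_map (fun z : L * M => (z.1 * b, z.2)) xpredT
  (fun y : L * M => tens_left jL jM y.1 * tens_right jL jM y.2)) -tens_pure.
rewrite !contraction_right_tens big_map big_distrl /=.
by apply: eq_bigr => z _; rewrite mulrAC.
Qed.

End Fun.

Lemma contraction_right_separates (x : T) : x != 0 ->
  exists2 r, klinear jM r & contraction_right r x != 0.
Proof.
elim/tens_ind: x => s s0; pose sw (z : L * M) := (z.2, z.1).
have : Defs.tens jM jL (map sw s) != 0.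
  apply: contraNneq s0 => e; apply/eqP; apply/tensP => A f [f1 f2 f3].
  have {}e : Defs.tens jM jL (map sw s) = Defs.tens jM jL [::] by [].
  move/tensP: e => /(_ A (fun b a => f a b)); rewrite /eval_sum big_map !big_nil; apply.
  by split=> // a b c; rewrite [jL c * b]mulrC f3 [a * _]mulrC.
case/contraction_separates => r lr.
rewrite contraction_tens // big_map => h; exists r => //.
rewrite contraction_right_tens //; apply: contra_neq h => e; rewrite -[RHS]e.
by apply: eq_bigr => z _; rewrite mulrC.
Qed.

End RightContraction.

(** * A subfield standing for a transcendence basis *)

(** Subrings and subfields are handled as sets, since they are obtained by Zorn's
    lemma. *)
Definition ring_set (E : pzRingType) (A : set E) : Prop :=
  [/\ A 1, forall x y, A x -> A y -> A (x - y) & forall x y, A x -> A y -> A (x * y)].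

Definition field_set (E : fieldType) (A : set E) : Prop :=
  [/\ A 1, forall x y, A x -> A y -> A (x - y) & forall x y, A x -> A y -> A (x / y)].

Section RingSet.
Variables (E : comNzRingType) (A : set E).
Hypothesis rA : ring_set A.

Lemma ring_set0 : A 0.
Proof. by case: rA => A1 AB _; rewrite -(subrr 1); exact: AB. Qed.

Lemma ring_setN x : A x -> A (- x).
Proof. by case: rA => _ AB _ Ax; rewrite -sub0r; apply: AB => //; exact: ring_set0. Qed.

Lemma ring_setD x y : A x -> A y -> A (x + y).
Proof. by case: rA => _ AB _ Ax Ay; rewrite -[y]opprK; apply: AB => //; exact: ring_setN. Qed.

Lemma ring_setX x n : A x -> A (x ^+ n).
Proof.
case: rA => A1 _ AM Ax; elim: n => [|n IHn]; first by rewrite expr0.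
by rewrite exprS; exact: AM.
Qed.

Lemma ring_set_sum (I : Type) (r : seq I) (P : pred I) (F : I -> E) :
  (forall i, P i -> A (F i)) -> A (\sum_(i <- r | P i) F i).
Proof. by move=> h; elim/big_ind: _ => //; [exact: ring_set0|exact: ring_setD]. Qed.

Definition poly_set (p : {poly E}) : Prop := forall i, A p`_i.

Lemma poly_setC a : A a -> poly_set a%:P.
Proof. by move=> Aa i; rewrite coefC; case: ifP => // _; exact: ring_set0. Qed.

Lemma poly_setD p q : poly_set p -> poly_set q -> poly_set (p + q).
Proof. by move=> Ap Aq i; rewrite coefD; exact: ring_setD. Qed.

Lemma poly_setM p q : poly_set p -> poly_set q -> poly_set (p * q).
Proof.
move=> Ap Aq i; rewrite coefM; apply: ring_set_sum => l _.
by case: rA => _ _; apply.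
Qed.

Lemma poly_set_ring : ring_set poly_set.
Proof.
split; last exact: poly_setM.
  by case: rA => A1 _ _; exact: poly_setC.
by move=> p q Ap Aq i; rewrite coefB; case: rA => _ AB _; exact: AB.
Qed.

Definition adjoin_set (t : E) : set E := [set y | exists2 p, poly_set p & y = p.[t]].

Lemma adjoin_set_ring t : ring_set (adjoin_set t).
Proof.
have [P1 PB PM] := poly_set_ring; split.
- by exists 1; rewrite ?hornerC.
- by move=> _ _ [p Ap ->] [q Aq ->]; exists (p - q); rewrite ?hornerD ?hornerN //; exact: PB.
- by move=> _ _ [p Ap ->] [q Aq ->]; exists (p * q); rewrite ?hornerM //; exact: PM.
Qed.

Lemma adjoin_set_sub t : A `<=` adjoin_set t.
Proof. by move=> a Aa; exists a%:P; rewrite ?hornerC //; exact: poly_setC. Qed.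

Lemma adjoin_set_mem t : adjoin_set t t.
Proof.
exists 'X; rewrite ?hornerX // => i; rewrite coefX; case: (_ == _) => /=.
  by case: rA.
exact: ring_set0.
Qed.

End RingSet.

Section FieldSet.
Variable E : fieldType.
Implicit Type A : set E.

Lemma field_setV A x : field_set A -> A x -> A x^-1.
Proof. by case=> A1 _ AV Ax; rewrite -div1r; exact: AV. Qed.

Lemma field_set_ring A : field_set A -> ring_set A.
Proof.
move=> fA; have [A1 AB AV] := fA; split=> // x y Ax Ay.
by rewrite -[y]invrK; apply: AV => //; exact: field_setV.
Qed.

(** The pairs with [y = 0] contribute nothing but [0]. *)
Definition fractions_set A : set E := [set z | exists x y, [/\ A x, A y & z = x / y]].

Lemma fractions_set_neq0 A z : ring_set A -> fractions_set A z ->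
  exists x y, [/\ A x, A y, y != 0 & z = x / y].
Proof.
move=> rA [x [y [Ax Ay ->]]]; have [->|y0] := eqVneq y 0; last by exists x, y.
have [A1 _ _] := rA; exists 0, 1; rewrite invr0 mulr0 mul0r oner_neq0.
by split=> //; exact: ring_set0.
Qed.

Lemma fractions_set_field A : ring_set A -> field_set (fractions_set A).
Proof.
move=> rA; have [A1 AB AM] := rA; split.
- by exists 1, 1; rewrite divr1.
- move=> z1 z2 /(fractions_set_neq0 rA)[x [y [Ax Ay y0 ->]]].
  move=> /(fractions_set_neq0 rA)[x' [y' [Ax' Ay' y0' ->]]].
  exists (x * y' - x' * y), (y * y'); split; last by rewrite -mulNr addf_div // mulNr.
    by apply: AB; exact: AM.
  exact: AM.
- move=> _ _ [x [y [Ax Ay ->]]] [x' [y' [Ax' Ay' ->]]].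
  by exists (x * y'), (y * x'); rewrite invf_div mulf_div; split=> //; exact: AM.
Qed.

Lemma fractions_set_sub A : ring_set A -> A `<=` fractions_set A.
Proof. by move=> [A1 _ _] x Ax; exists x, 1; rewrite divr1. Qed.

Lemma range_field (F : fieldType) (f : {rmorphism F -> E}) : field_set (range f).
Proof.
split; first by exists 1; rewrite ?rmorph1.
  by move=> _ _ [a _ <-] [b _ <-]; exists (a - b); rewrite ?rmorphB.
by move=> _ _ [a _ <-] [b _ <-]; exists (a / b); rewrite ?fmorph_div.
Qed.

Lemma gen_subfield_set A x : field_set A -> (x \in gen_subfield A) <-> A x.
Proof.
move=> [A1 AB AV]; split=> [/asboolP h|Ax]; last exact: gen_subfieldP.
suff /asboolP : x \in ([pred y | `[< A y >]] : {pred E}) by [].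
apply: h; last by move=> a Aa; exact/asboolP.
split; first exact/asboolP.
  by move=> y z /asboolP Ay /asboolP Az; apply/asboolP; exact: AB.
by move=> y z /asboolP Ay /asboolP Az; apply/asboolP; exact: AV.
Qed.

Lemma poly_set_lift A (p : {poly E}) : field_set A -> poly_set A p ->
  exists q : {poly subfield_of A}, map_poly val q = p.
Proof.
move=> fA Ap; have gp i : p`_i \in gen_subfield A by apply/gen_subfield_set.
exists (\poly_(i < size p) SubfieldOf (gp i)); apply/polyP => i.
rewrite coef_map coef_poly; case: ltnP => // h.
by rewrite nth_default.
Qed.

Lemma field_set_chain (F : set (set E)) : F !=set0 -> F `<=` @field_set E ->
  total_on F subset -> field_set (\bigcup_(X in F) X).
Proof.
move=> [X0 FX0] FP Ftot.
have pair := chain_common Ftot.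
split.
- by exists X0 => //; have [] := FP _ FX0.
- move=> a b Fa Fb; have [X [FX Xa Xb]] := pair _ _ Fa Fb; exists X => //.
  by have [_ H _] := FP _ FX; exact: H.
- move=> a b Fa Fb; have [X [FX Xa Xb]] := pair _ _ Fa Fb; exists X => //.
  by have [_ _ H] := FP _ FX; exact: H.
Qed.

End FieldSet.

Section LeftPart.
Variables (k L M : fieldType) (jL : {rmorphism k -> L}) (jM : {rmorphism k -> M}).
Local Notation T := (tensor jL jM).
Local Notation tens := (tens jL jM).
Local Notation tl := (tens_left jL jM).
Local Notation tr := (tens_right jL jM).

(** The image of A (x) M in L (x) M. *)
Definition left_part (A : set L) : set T :=
  [set x | exists2 s, (forall z, z \in s -> A z.1) & x = tens s].

(** A (x) M has no zero divisors. *)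
Definition left_domain (A : set L) : Prop :=
  forall x y, left_part A x -> left_part A y -> x * y = 0 -> x = 0 \/ y = 0.

Lemma left_part_ring A : ring_set A -> ring_set (left_part A).
Proof.
move=> rA; have [A1 AB AM] := rA; split.
- by exists [:: (1, 1)] => // z; rewrite inE => /eqP ->.
- move=> _ _ [s As ->] [t At ->]; exists (s ++ opp_sum t); last by rewrite tens_cat tens_opp.
  move=> z; rewrite mem_cat => /orP[/As//|/mapP[y /At Ay ->]] /=.
  exact: ring_setN.
- move=> _ _ [s As ->] [t At ->]; exists (mul_sum s t); last by rewrite tens_mul.
  by move=> z /allpairsP[[x y] /= [/As Ax /At Ay ->]] /=; exact: AM.
Qed.

Lemma left_part_left A a : A a -> left_part A (tl a).
Proof. by move=> Aa; exists [:: (a, 1)] => // z; rewrite inE => /eqP ->. Qed.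

Lemma left_part_right A b : A 1 -> left_part A (tr b).
Proof. by move=> A1; exists [:: (1, b)] => // z; rewrite inE => /eqP ->. Qed.

Lemma left_part_sub A B : A `<=` B -> left_part A `<=` left_part B.
Proof. by move=> AB x [s As ->]; exists s => // z /As; exact: AB. Qed.

Lemma contraction_right_part A r x : ring_set A -> range jL `<=` A -> klinear jM r ->
  left_part A x -> A (contraction_right r x).
Proof.
move=> rA jA lr [s As ->]; rewrite contraction_right_tens // big_seq.
apply: ring_set_sum => // z /As Az.
by have [_ _ AM] := rA; apply: AM => //; apply: jA; eexists.
Qed.

Lemma left_domain_range : left_domain (range jL).
Proof.
have key x : left_part (range jL) x -> exists b, x = tr b.
  case=> s; elim: s x => [|z s IHs] x h ->.
    by exists 0; rewrite tens_pure big_nil rmorph0.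
  have [|b eb] := IHs _ _ erefl; first by move=> y ys; apply: h; rewrite inE ys orbT.
  have [c _ ec] := h z (mem_head _ _).
  exists (jM c * z.2 + b); rewrite tens_cons eb rmorphD rmorphM /= -tens_linking.
  by rewrite -ec.
move=> _ _ /key[a ->] /key[b ->] /eqP; rewrite -rmorphM fmorph_eq0 mulf_eq0.
by case/orP=> /eqP ->; [left|right]; rewrite rmorph0.
Qed.

Section Adjoin.
Variables (A : set L) (t : L).
Hypotheses (fA : field_set A) (jA : range jL `<=` A) (iA : left_domain A).
Hypothesis tA : forall p, poly_set A p -> p.[t] = 0 -> p = 0.

Let rA := field_set_ring fA.
Let A' := fractions_set (adjoin_set A t).

(** The powers of [t] are linearly independent over A (x) M: contractions by functionals
    on M turn a relation into one with coefficients in [A], where [t] is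
    transcendental. *)
Lemma left_part_horner_eq0 P : poly_set (left_part A) P -> P.[tl t] = 0 -> P = 0.
Proof.
move=> AP Pt; apply/eqP; apply: contraT; rewrite -lead_coef_eq0.
case/contraction_right_separates => r lr /eqP[].
pose q := \poly_(i < size P) contraction_right r P`_i.
have Aq : poly_set A q.
  move=> i; rewrite coef_poly; case: ifP => _; last exact: ring_set0.
  exact: contraction_right_part.
have : q`_(size P).-1 = 0.
  rewrite (tA Aq) ?coef0 // horner_poly.
  have e : contraction_right r P.[tl t] = 0 by rewrite Pt contraction_right0.
  rewrite -[RHS]e horner_coef; elim: (index_enum _) => [|i s IHs].
    by rewrite !big_nil contraction_right0.
  by rewrite !big_cons contraction_rightD // IHs -rmorphXn contraction_rightM.
rewrite coef_poly; case: ltnP => //.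
case e: (size P) => [|n]; rewrite ?ltnn // => _ _.
by move/eqP: e; rewrite size_poly_eq0 => /eqP ->; rewrite lead_coef0 contraction_right0.
Qed.

(** Clearing denominators, an element of A(t) (x) M becomes a polynomial in [t] over
    A (x) M. *)
Lemma left_part_clear x : left_part A' x -> exists D P,
  [/\ poly_set A D, D.[t] != 0, poly_set (left_part A) P & tl D.[t] * x = P.[tl t]].
Proof.
have rP := left_part_ring rA.
have mapP N : poly_set A N -> poly_set (left_part A) (map_poly tl N).
  by move=> AN i; rewrite coef_map; exact: left_part_left.
case=> s; elim: s x => [|z s IHs] x As ->.
  exists 1, 0; rewrite hornerC oner_neq0 horner0 tens_pure big_nil mulr0; split=> // i.
    by apply: (poly_setC rA); case: rA.
  by rewrite coef0; exact: ring_set0.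
have [|d [P [Ad d0 AP e]]] := IHs _ _ erefl.
  by move=> y ys; apply: As; rewrite inE ys orbT.
have [_ [_ [[N AN ->] [D AD ->] D0 ez]]] :=
  fractions_set_neq0 (adjoin_set_ring rA t) (As z (mem_head _ _)).
exists (d * D), ((tr z.2)%:P * map_poly tl (d * N) + map_poly tl D * P).
have AM := poly_setM rA; split.
- exact: AM.
- by rewrite hornerM mulf_neq0.
- apply: (poly_setD rP); apply: (poly_setM rP) => //; try exact: mapP.
    by apply: (poly_setC rP); apply: left_part_right; case: rA.
  by apply: mapP; exact: AM.
rewrite tens_cons ez hornerD [in RHS]hornerM [in RHS]hornerM hornerC !horner_map -e.
rewrite mulrDr mulrA -rmorphM; congr (_ + _).
  by rewrite [RHS]mulrC !hornerM -mulrA [D.[t] * _]mulrC divfK.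
by rewrite hornerM rmorphM mulrA [tl d.[t] * _]mulrC.
Qed.

(** By the two lemmas above, A(t) (x) M is a localization of the polynomial ring in [t]
    over the domain A (x) M. *)
Lemma adjoin_domain : left_domain A'.
Proof.
move=> x y /left_part_clear[D [P [AD D0 AP ex]]] /left_part_clear[D' [Q [AD' D0' AQ ey]]] xy.
have null a z : a != 0 -> tl a * z = 0 -> z = 0.
  by move=> a0 e; rewrite -[z]mul1r -(rmorph1 tl) -(mulVf a0) rmorphM -mulrA e mulr0.
have rP := left_part_ring rA.
have PQ : P * Q = 0.
  apply: left_part_horner_eq0; first exact: poly_setM.
  by rewrite hornerM -ex -ey mulrACA xy mulr0.
have [P0|P0] := eqVneq P 0.
  by left; apply: null D0 _; rewrite ex P0 horner0.
have [Q0|Q0] := eqVneq Q 0.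
  by right; apply: null D0' _; rewrite ey Q0 horner0.
have [|||e|e] := @iA (lead_coef P) (lead_coef Q) => //.
- exact: AP.
- exact: AQ.
- apply/eqP; rewrite -[_ == 0]negbK; apply/negP => h.
  by have := lead_coef_proper_mul h; rewrite PQ lead_coef0 => /esym/eqP; rewrite (negPf h).
- by move/eqP: e; rewrite lead_coef_eq0 (negPf P0).
- by move/eqP: e; rewrite lead_coef_eq0 (negPf Q0).
Qed.

End Adjoin.

(** Take [A] maximal among the subfields over [k] such that A (x) M is a domain. By
    [adjoin_domain] an element transcendental over [A] could be adjoined, so there is
    none. *)
Lemma exists_regular_subfield : exists A : set L,
  [/\ field_set A, left_domain A & forall x, algebraicOver (val : subfield_of A -> L) x].
Proof.
pose P (A : set L) := [/\ field_set A, range jL `<=` A & left_domain A].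
have P0 : P (range jL).
  by split=> //; [exact: range_field|exact: left_domain_range].
have [|A [_ [fA jA iA] Amax]] := Zorn_above P0.
  move=> F F0 FP Ftot; split.
  - by apply: field_set_chain => // X /FP[].
  - by have [X FX] := F0 => y jy; exists X => //; have [_ h _] := FP _ FX; exact: h.
  - have one (s : seq (L * M)) : (forall z, z \in s -> (\bigcup_(X in F) X) z.1) ->
        exists2 X, F X & forall z, z \in s -> X z.1.
      elim: s => [|z s IHs] h; first by have [X FX] := F0; exists X.
      have [|X FX Xs] := IHs; first by move=> y ys; apply: h; rewrite inE ys orbT.
      have [Y FY Yz] := h z (mem_head _ _).
      have [XY|YX] := Ftot _ _ FX FY.
        by exists Y => // y; rewrite inE => /orP[/eqP ->//|/Xs]; exact: XY.
      by exists X => // y; rewrite inE => /orP[/eqP ->|/Xs//]; exact: YX.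
    move=> x y [s /one[X FX Xs] ex] [t /one[Y FY Yt] ey].
    have Xx : left_part X x by exists s.
    have Yy : left_part Y y by exists t.
    have [XY|YX] := Ftot _ _ FX FY.
      have [_ _ iY] := FP _ FY; apply: iY => //; exact: (left_part_sub XY).
    have [_ _ iX] := FP _ FX; apply: iX => //; exact: (left_part_sub YX).
exists A; split=> // t; apply: contrapT => nt.
have rA := field_set_ring fA.
have tA p : poly_set A p -> p.[t] = 0 -> p = 0.
  move=> /(poly_set_lift fA)[q <-] e; apply/eqP; apply: contra_notT nt => q0.
  by exists q; [apply: contraNneq q0 => ->; rewrite rmorph0|exact/rootP].
have rAt := adjoin_set_ring rA t.
have AA' : A `<=` fractions_set (adjoin_set A t).
  by move=> a /(adjoin_set_sub rA t); exact: fractions_set_sub.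
have At : A t.
  rewrite -(Amax _ AA'); first by apply: fractions_set_sub => //; exact: adjoin_set_mem.
  split; [exact: fractions_set_field|exact: subset_trans AA'|exact: adjoin_domain].
have gt : t \in gen_subfield A by exact: gen_subfieldP.
by apply: nt; exact: (algebraic_id _ (SubfieldOf gt)).
Qed.

End LeftPart.

(** * Primitive tensors over a valuation ring *)

Section ValuationRing.
Variables (V : idomainType) (HV : valuation_ring V).

Lemma valuation_dvd (a b : V) : (exists c, a = c * b) \/ (exists c, b = c * a).
Proof.
have [->|a0] := eqVneq a 0; first by left; exists 0; rewrite mul0r.
have [->|b0] := eqVneq b 0; first by right; exists 0; rewrite mul0r.
have fa : a%:F != 0 by rewrite tofrac_eq0.
have fb : b%:F != 0 by rewrite tofrac_eq0.
have [|[c e]|[c e]] := HV (x := a%:F / b%:F); first by rewrite mulf_neq0 ?invr_eq0.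
  by left; exists c; apply/eqP; rewrite -tofrac_eq tofracM -e divfK.
by right; exists c; apply/eqP; rewrite -tofrac_eq tofracM -e invf_div divfK.
Qed.

Lemma valuation_max : exists m : Spec V,
  forall a, (a \in (m : pred V)) <-> a \isn't a GRing.unit.
Proof.
have [] := @Spec_of_set V [set a | a \isn't a GRing.unit].
- by rewrite /= unitr0.
- by rewrite /= unitr1.
- move=> a b na nb.
  have [[c e]|[c e]] := valuation_dvd a b.
    by rewrite /= e -[X in _ + X]mul1r -mulrDl unitrM negb_and nb orbT.
  by rewrite /= e -[X in X + _]mul1r -mulrDl unitrM negb_and na orbT.
- by move=> a b nb; rewrite /= unitrM negb_and nb orbT.
- move=> a b; rewrite /= unitrM negb_and => /orP[]; by [left|right].
by move=> m mP; exists m.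
Qed.

Section Normal.
Variables (k L M : fieldType) (j : {rmorphism k -> L}) (i : {rmorphism k -> V})
  (rho : {rmorphism V -> M}).
Hypothesis rho_frac : forall x : M, exists a b, rho b != 0 /\ x = rho a / rho b.

Local Notation T := (tensor j (rho \o i)).

Definition push (s : seq (L * V)) : seq (L * M) := [seq (z.1, rho z.2) | z <- s].

Lemma rho_dvd (x y : M) : (exists c, x = rho c * y) \/ (exists c, y = rho c * x).
Proof.
have [a [b [b0 ->]]] := rho_frac x; have [c [d [d0 ->]]] := rho_frac y.
have [[e h]|[e h]] := valuation_dvd (a * d) (c * b); [left|right]; exists e.
  by apply/eqP; rewrite mulrA eqr_div // -!rmorphM h mulrA.
by apply/eqP; rewrite mulrA eqr_div // -!rmorphM h mulrA.
Qed.

Lemma rho_min (s : seq (L * M)) : s != [::] ->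
  exists2 z0, z0 \in s & forall z, z \in s -> exists c, z.2 = rho c * z0.2.
Proof.
elim: s => // z [|y s] IHs _.
  exists z; rewrite ?mem_head // => y; rewrite inE => /eqP ->.
  by exists 1; rewrite rmorph1 mul1r.
have [//|z0 z0s h] := IHs.
have [[c e]|[c e]] := rho_dvd z.2 z0.2.
  exists z0; first by rewrite inE z0s orbT.
  by move=> x; rewrite inE => /orP[/eqP ->|/h//]; exists c.
exists z; first exact: mem_head.
move=> x; rewrite inE => /orP[/eqP ->|/h[d ->]]; first by exists 1; rewrite rmorph1 mul1r.
by exists (d * c); rewrite e rmorphM mulrA.
Qed.

(** Division by a coefficient [c] of smallest value brings all coefficients into [V] and
    makes one of them equal to [1]. The functional [r], dual to the corresponding first
    component, exhibits that the tensor given by [s] is nonzero modulo every prime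
    of [V]. *)
Lemma left_part_normal (A : set L) (x : T) : left_part A x -> x != 0 ->
  exists (c : M) (s : seq (L * V)) (r : L -> k),
  [/\ c != 0, forall z, z \in s -> A z.1, klinear j r,
      \sum_(z <- s) i (r z.1) * z.2 = 1 &
      x = tens_right j (rho \o i) c * tens j (rho \o i) (push s)].
Proof.
case=> s0 As0 ->; have [s [<- sub nz dual]] := tens_dual j (rho \o i) s0.
have As z : z \in s -> A z.1.
  by move=> /(map_f fst)/sub/mapP[y /As0 Ay ->].
case es : s => [|y t]; first by rewrite tens_pure big_nil eqxx.
rewrite -es => _; have [|z0 z0s h] := rho_min (s := s); first by rewrite es.
have {}h z : exists c, z \in s -> z.2 = rho c * z0.2.
  by have [/h[c e]|_] := boolP (z \in s); [exists c|exists 0].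
have [g gP] := choice h.
case/splitPr: z0s => s1 s2 in h As dual nz gP *.
have z00 : z0.2 != 0 by apply: nz; rewrite mem_cat mem_head orbT.
have [r [lr rz r0]] := dual s1 z0 s2 erefl.
pose g' z := if z == z0 then 1 else g z.
have g'P z : z \in s1 ++ z0 :: s2 -> z.2 = rho (g' z) * z0.2.
  by rewrite /g'; case: eqP => [->|_ /gP//]; rewrite rmorph1 mul1r.
exists z0.2, [seq (z.1, g' z) | z <- s1 ++ z0 :: s2], r; split=> //.
- by move=> _ /mapP[z zs ->]; exact: As.
- rewrite big_map /= big_cat big_cons /= rz /g' eqxx rmorph1 mul1r addrCA -big_cat /=.
  rewrite big_seq big1 ?addr0 // => u us.
  by rewrite r0 // rmorph0 mul0r.
- rewrite !tens_pure !big_map mulr_sumr; apply: eq_big_seq => z zs /=.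
  by rewrite (g'P z zs) rmorphM [RHS]mulrC mulrA.
Qed.

End Normal.
End ValuationRing.

(** * The Gauss extension *)

Section ValuedField.
Variables (k k' : fieldType) (j : {rmorphism k -> k'}).
Variables (V : idomainType) (i : {rmorphism k -> V}).
Local Notation K := {fraction V}.

Let rK : {rmorphism V -> K} := @FracField.tofrac V.

Lemma push_cat (M : fieldType) (rho : {rmorphism V -> M}) s t :
  push rho (s ++ t : seq (k' * V)) = push rho s ++ push rho t.
Proof. exact: map_cat. Qed.

Definition opp_pairs (s : seq (k' * V)) := [seq (- z.1, z.2) | z <- s].
Definition mul_pairs (s t : seq (k' * V)) :=
  [seq (x.1 * y.1, x.2 * y.2) | x <- s, y <- t].

Section Push.
Variables (M : fieldType) (rho : {rmorphism V -> M}).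
Local Notation T := (tensor j (rho \o i)).

Definition pushT (s : seq (k' * V)) : T := tens j (rho \o i) (push rho s).

Lemma pushT_sub s t : pushT (s ++ opp_pairs t) = pushT s - pushT t.
Proof.
rewrite /pushT push_cat; have -> : push rho (opp_pairs t) = opp_sum (push rho t).
  by rewrite /push /opp_sum /opp_pairs -!map_comp.
by rewrite tens_cat tens_opp.
Qed.

Lemma pushT_mul s t : pushT (mul_pairs s t) = pushT s * pushT t.
Proof.
rewrite /pushT; have -> : push rho (mul_pairs s t) = mul_sum (push rho s) (push rho t).
  rewrite /push /mul_sum /mul_pairs map_allpairs allpairs_mapl allpairs_mapr.
  by apply: eq_allpairs => x y /=; rewrite rmorphM.
by rewrite tens_mul.
Qed.

Lemma pushT_nil : pushT [::] = 0. Proof. by []. Qed.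

Lemma pushT_one : pushT [:: (1, 1)] = 1.
Proof. by rewrite /pushT /push /= rmorph1. Qed.

Lemma contraction_push r s : klinear j r ->
  contraction r (pushT s) = rho (\sum_(z <- s) i (r z.1) * z.2).
Proof.
move=> lr; rewrite contraction_tens // big_map rmorph_sum.
by apply: eq_bigr => z _; rewrite rmorphM.
Qed.

End Push.

Variables (m : Spec V) (A : set k').
Hypothesis mP : forall a, (a \in (m : pred V)) <-> a \isn't a GRing.unit.
Hypothesis fA : field_set A.
Hypothesis iA : left_domain j (to_residue m \o i) A.

Definition over (s : seq (k' * V)) : Prop := forall z, z \in s -> A z.1.

(* The tensor defined by a sequence of pairs, over the fraction field and over the
   residue field of [V]. *)
Local Notation genT := (pushT rK).
Local Notation redT := (pushT (to_residue m)).

Let rA := field_set_ring fA.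

Lemma over_sub s t : over s -> over t -> over (s ++ opp_pairs t).
Proof.
move=> As At z; rewrite mem_cat => /orP[/As//|/mapP[y /At Ay ->]] /=.
exact: ring_setN.
Qed.

Lemma over_mul s t : over s -> over t -> over (mul_pairs s t).
Proof.
move=> As At z /allpairsP[[x y] /= [/As Ax /At Ay ->]] /=.
by have [_ _ AM] := rA; exact: AM.
Qed.

Lemma over_one : over [:: (1, 1)].
Proof. by move=> z; rewrite inE => /eqP ->; case: rA. Qed.

Lemma left_part_red s : over s -> left_part A (redT s).
Proof.
by move=> As; exists (push (to_residue m) s) => // _ /mapP[z /As Az ->].
Qed.

(** Contractions commute with reduction, and tensors are separated by contractions;
    so the reduction of a tensor with coefficients in [V] is well defined. *)
Lemma genT_eq0_redT s : genT s = 0 -> redT s = 0.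
Proof.
move=> s0; apply/eqP; apply: contraT => /contraction_separates[r lr].
rewrite contraction_push //.
have : contraction r (genT s) = 0.
  by rewrite s0 -(pushT_nil rK) contraction_push // big_nil rmorph0.
rewrite contraction_push // => /eqP; rewrite tofrac_eq0 => /eqP ->.
by rewrite rmorph0 eqxx.
Qed.

Lemma unit_redT s r : klinear j r -> \sum_(z <- s) i (r z.1) * z.2 \is a GRing.unit ->
  redT s != 0.
Proof.
move=> lr us; apply: contraTneq us => s0; apply/mP.
have : contraction r (redT s) = 0.
  by rewrite s0 -(pushT_nil (to_residue m)) contraction_push // big_nil rmorph0.
rewrite contraction_push // => /eqP; rewrite tofrac_eq0 to_quot_eq0 //.
Qed.

Lemma redT_mul_neq0 s t : over s -> over t -> redT s != 0 -> redT t != 0 ->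
  redT (mul_pairs s t) != 0.
Proof.
move=> As At s0 t0; apply/eqP; rewrite pushT_mul => /(iA _ _)[||/eqP|/eqP].
- exact: left_part_red.
- exact: left_part_red.
- by rewrite (negPf s0).
- by rewrite (negPf t0).
Qed.

(** The primitive tensors, those with nonzero reduction, are stable under products
    because A (x) kappa is a domain. Let [E] be the residue field of a prime ideal of
    k' (x) K that avoids them, [R0] the ring of fractions of A (x) V whose denominators
    are primitive, and [N0] the ideal of fractions whose numerator reduces to [0];
    [w] is a valuation ring of [E] dominating [R0] at [N0]. *)
Lemma exists_valued_field_aux :
  exists (E : fieldType) (uL : {rmorphism k' -> E}) (uK : {rmorphism K -> E}) (w : valsub E),
  [/\ forall c, uL (j c) = uK (i c)%:F,
      forall x : E, exists s t : seq (k' * K),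
        x = (\sum_(z <- s) uL z.1 * uK z.2) / (\sum_(z <- t) uL z.1 * uK z.2),
      forall a, uK a%:F \in vs_pred w,
      forall a, a \isn't a GRing.unit -> uK a%:F \in vs_max w &
      forall s r, over s -> klinear j r ->
        \sum_(z <- s) i (r z.1) * z.2 \is a GRing.unit ->
        \sum_(z <- s) uL z.1 * uK z.2%:F \in vs_unit w].
Proof.
pose S x := exists s, [/\ over s, redT s != 0 & x = genT s].
have [||||||P0 [_ PS]] := @prime_avoiding (tensor j (rK \o i)) [set 0] S.
- by [].
- by move=> a b -> ->; rewrite addr0.
- by move=> a b ->; rewrite mulr0.
- exists [:: (1, 1)]; rewrite !pushT_one oner_neq0.
  by split=> //; exact: over_one.
- move=> _ _ [s [As s0 ->]] [t [At t0 ->]]; exists (mul_pairs s t).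
  by split; [exact: over_mul|exact: redT_mul_neq0|rewrite pushT_mul].
- by move=> _ [s [As s0 ->]] /genT_eq0_redT /eqP; rewrite (negPf s0).
pose E := residue_field P0; pose phi := to_residue P0.
have phi0 x : S x -> phi x != 0.
  by move=> /PS; rewrite tofrac_eq0 to_quot_eq0.
pose uL : {rmorphism k' -> E} := phi \o tens_left j (rK \o i).
pose uK : {rmorphism K -> E} := phi \o tens_right j (rK \o i).
pose R0 : set E := [set x | exists s t,
  [/\ over s, over t, redT t != 0 & x = phi (genT s) / phi (genT t)]].
pose N0 : set E := [set x | exists s t,
  [/\ over s, over t, redT s = 0, redT t != 0 & x = phi (genT s) / phi (genT t)]].
have nuN : nonunital R0 N0.
  have RN a b : R0 a -> N0 b -> N0 (a * b).
    case=> s [t [As At t0 ->]] [s' [t' [As' At' s0' t0' ->]]].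
    exists (mul_pairs s s'), (mul_pairs t t'); split; try exact: over_mul.
    - by rewrite pushT_mul s0' mulr0.
    - exact: redT_mul_neq0.
    by rewrite !pushT_mul !rmorphM mulf_div.
  split=> //.
  - exists [::], [:: (1, 1)]; rewrite !pushT_nil !pushT_one oner_neq0 rmorph0 mul0r.
    by split=> //; exact: over_one.
  - move=> _ _ [s [t [As At s0 t0 ->]]] [s' [t' [As' At' s0' t0' ->]]].
    exists (mul_pairs s t' ++ opp_pairs (mul_pairs s' t)), (mul_pairs t t'); split.
    + by apply: over_sub; exact: over_mul.
    + exact: over_mul.
    + by rewrite pushT_sub !pushT_mul s0 s0' !mul0r subr0.
    + exact: redT_mul_neq0.
    rewrite pushT_sub !pushT_mul rmorphB !rmorphM -[in LHS]mulNr addf_div ?mulNr //.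
      by apply: phi0; exists t.
    by apply: phi0; exists t'.
  - move=> a b [s [t [As At _ t0 ->]]]; apply: RN.
    by exists s, t.
  - case=> s [t [As At s0 t0 e]].
    have : phi (genT (t ++ opp_pairs s)) != 0.
      apply: phi0; exists (t ++ opp_pairs s); split=> //; first exact: over_sub.
      by rewrite pushT_sub s0 subr0.
    have pt : phi (genT t) != 0 by apply: phi0; exists t.
    by rewrite pushT_sub rmorphB -[phi (genT s)](divfK pt) -e mul1r subrr eqxx.
have [w [wR wN]] := Chevalley nuN.
have evg s : \sum_(z <- s) uL z.1 * uK z.2%:F = phi (genT s).
  by rewrite /genT tens_pure rmorph_sum big_map; apply: eq_bigr => z _; rewrite rmorphM.
have S1 : redT [:: (1, 1)] != 0 by rewrite pushT_one oner_neq0.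
have one1 a : over [:: (1, a)] by move=> z; rewrite inE => /eqP ->; case: rA.
have ev1 a : uK a%:F = phi (genT [:: (1, a)]) / phi (genT [:: (1, 1)]).
  by rewrite -!evg !big_seq1 /= tofrac1 !rmorph1 !mul1r divr1.
exists E, uL, uK, w; split.
- by move=> c; rewrite /= tens_linking.
- move=> x; pose y := repr x; have := fracE x; rewrite -/y => ->.
  have ev (a : quot_domain P0) : exists s, a%:F = \sum_(z <- s) uL z.1 * uK z.2 :> E.
    rewrite -[a]reprK; elim/tens_ind: (repr a) => s; exists s.
    rewrite -[LHS]/(phi (tens j (rK \o i) s)) tens_pure rmorph_sum.
    by apply: eq_bigr => z _; rewrite rmorphM.
  have [s es] := ev (\n_y); have [t et] := ev (\d_y).
  by exists s, t; rewrite es et.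
- by move=> a; apply: wR; exists [:: (1, a)], [:: (1, 1)].
- move=> a na; apply: wN; exists [:: (1, a)], [:: (1, 1)]; split=> //.
  have ra : to_residue m a = 0.
    by apply/eqP; rewrite tofrac_eq0 to_quot_eq0; apply/mP.
  by rewrite /pushT tens_pure big_map big_seq1 ra rmorph0 mulr0.
- move=> s r As lr us; rewrite evg; have s0 := unit_redT lr us.
  have ps : phi (genT s) != 0 by apply: phi0; exists s.
  apply/vs_unitP; split=> //; apply: wR.
    by exists s, [:: (1, 1)]; split=> //; rewrite pushT_one rmorph1 divr1.
  by exists [:: (1, 1)], s; split=> //; rewrite pushT_one rmorph1 div1r.
Qed.

End ValuedField.

(** The last property says that primitive tensors are units of [w]: by contraction with
    [r], the tensor defined by [s] is nonzero modulo the maximal ideal. *)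
Lemma exists_valued_field (k k' : fieldType) (j : {rmorphism k -> k'}) (V : idomainType)
    (i : {rmorphism k -> V}) (HV : valuation_ring V) :
  exists A : set k', [/\ field_set A,
    forall x, algebraicOver (val : subfield_of A -> k') x &
  exists (E : fieldType) (uL : {rmorphism k' -> E}) (uK : {rmorphism {fraction V} -> E})
    (w : valsub E),
  [/\ forall c, uL (j c) = uK (i c)%:F,
      forall x : E, exists s t : seq (k' * {fraction V}),
        x = (\sum_(z <- s) uL z.1 * uK z.2) / (\sum_(z <- t) uL z.1 * uK z.2),
      forall a, uK a%:F \in vs_pred w,
      forall a, a \isn't a GRing.unit -> uK a%:F \in vs_max w &
      forall s r, (forall z, z \in s -> A z.1) -> klinear j r ->
        \sum_(z <- s) i (r z.1) * z.2 \is a GRing.unit ->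
        \sum_(z <- s) uL z.1 * uK z.2%:F \in vs_unit w]].
Proof.
have [m mP] := valuation_max HV.
have [A [fA iA algA]] := exists_regular_subfield j (to_residue m \o i).
by exists A; split=> //; exact: exists_valued_field_aux mP fA iA.
Qed.

(** * Conjugates and interpolation *)

(** The root is the class of the variable in the residue field of a prime ideal of
    [{poly E}] containing [p]. *)
Lemma exists_root (E : fieldType) (p : {poly E}) : (1 < size p)%N ->
  exists (E' : fieldType) (f : {rmorphism E -> E'}) (z : E'), root (map_poly f p) z.
Proof.
move=> szp; have [||||||x [xp _]] := @prime_avoiding {poly E} [set q | p %| q] [set 1].
- by rewrite /= dvdp0.
- by move=> a b pa pb; exact: dvdp_add.
- by move=> a b pb; exact: dvdp_mull.
- by [].
- by move=> a b -> ->; rewrite mulr1.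
- by move=> a -> /=; rewrite dvdp1 => /eqP e; rewrite e in szp.
pose phi := to_residue x.
exists (residue_field x), (phi \o polyC), (phi 'X); apply/rootP.
rewrite map_poly_comp horner_map -[_.['X]]/(p \Po 'X) comp_polyXr.
by apply/eqP; rewrite tofrac_eq0 to_quot_eq0; apply: xp => /=; exact: dvdpp.
Qed.

Lemma exists_splitting (E : fieldType) (p : {poly E}) : p != 0 ->
  exists (E' : fieldType) (f : {rmorphism E -> E'}) (rs : seq E'),
    map_poly f p = f (lead_coef p) *: \prod_(r <- rs) ('X - r%:P).
Proof.
have [n] := ubnP (size p); elim: n E p => // n IHn E p szp p0.
have [sz1|sz1] := leqP (size p) 1.
  exists E, idfun, [::]; rewrite big_nil map_poly_id // (size1_polyC sz1).
  by rewrite lead_coefC -alg_polyC.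
have [E1 [f1 [z /factor_theorem[q eq]]]] := exists_root sz1.
have fp0 : map_poly f1 p != 0 by rewrite map_poly_eq0.
have q0 : q != 0 by apply: contraNneq fp0 => q0; rewrite eq q0 mul0r.
have [|E' [f [rs e]]] := IHn E1 q _ q0.
  rewrite -ltnS; apply: leq_trans szp; rewrite ltnS -(size_map_poly f1) eq.
  by rewrite size_Mmonic ?monicXsubC // size_XsubC addn2.
exists E', (f \o f1), (f z :: rs); rewrite map_poly_comp eq rmorphM /= e.
rewrite rmorphB /= map_polyX map_polyC /= big_cons -scalerAl mulrC; congr (_ *: _).
suff -> : lead_coef q = f1 (lead_coef p) by [].
by rewrite -lead_coef_map eq lead_coef_Mmonic ?monicXsubC.
Qed.

Lemma valsub_extension (E E' : fieldType) (f : {rmorphism E -> E'}) (w : valsub E) :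
  exists w' : valsub E', forall x, (f x \in vs_pred w') = (x \in vs_pred w).
Proof.
pose im (S : {pred E}) := [set y | exists2 x, x \in S & y = f x].
have [|w' [wR wN]] := @Chevalley E' (im (vs_pred w)) (im (vs_max w)).
  split.
  - by exists 0; rewrite ?rmorph0 // vs_max0.
  - move=> _ _ [x mx ->] [y my ->]; exists (x - y); rewrite ?rmorphB //.
    by apply: vs_maxD => //; exact: vs_maxN.
  - move=> _ _ [x mx ->] [y my ->]; exists (x * y); rewrite ?rmorphM //.
    by apply: vs_maxM => //; exact: vs_max_in.
  - move=> _ _ [x wx ->] [y my ->]; exists (x * y); rewrite ?rmorphM //.
    exact: vs_maxM.
  - case=> x mx /esym/eqP; rewrite fmorph_eq1 => /eqP x1.
    by move: mx; rewrite x1 => /vs_max_nunit; rewrite vs_unit1.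
exists w' => x; apply/idP/idP => [fx|wx]; last by apply: wR; exists x.
apply: contraT => nx; have m := vs_notin nx.
have x0 : x != 0 by apply: contraNneq nx => ->; rewrite rpred0.
have /wN/vs_maxV : im (vs_max w) (f x^-1) by exists x^-1.
by rewrite fmorph_eq0 invr_eq0 fmorphV invrK fx => /(_ x0).
Qed.

Section Approximation.
Variables (E : fieldType) (w : valsub E).

Lemma vs_unit_ext (E' : fieldType) (f : {rmorphism E -> E'}) (w' : valsub E') :
  (forall x, (f x \in vs_pred w') = (x \in vs_pred w)) ->
  forall x, (f x \in vs_unit w') = (x \in vs_unit w).
Proof.
by move=> h x; apply/vs_unitP/vs_unitP; rewrite -fmorphV !h fmorph_eq0.
Qed.

Lemma vs_min (I : eqType) (s : seq I) (F : I -> E) : (exists2 z, z \in s & F z != 0) ->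
  exists z0, [/\ z0 \in s, F z0 != 0 & forall z, z \in s -> F z / F z0 \in vs_pred w].
Proof.
elim: s => [|y s IHs]; first by case.
have [/IHs[z0 [z0s z00 h]] _|ns [z]] := pselect (exists2 z, z \in s & F z != 0).
  have [h0|h0] := vs_total w (F y / F z0).
    exists z0; split=> //; first by rewrite inE z0s orbT.
    by move=> z; rewrite inE => /orP[/eqP ->|/h].
  have [y0|y0] := eqVneq (F y) 0.
    exists z0; split=> //; first by rewrite inE z0s orbT.
    by move=> z; rewrite inE => /orP[/eqP ->|/h//]; rewrite y0 mul0r rpred0.
  rewrite invf_div in h0; exists y; split=> //; first exact: mem_head.
  move=> z; rewrite inE => /orP[/eqP ->|/h wz]; first by rewrite divff ?rpred1.
  have -> : F z / F y = (F z / F z0) * (F z0 / F y) by rewrite mulrA divfK.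
  exact: rpredM.
rewrite inE => /orP[/eqP ->|zs] z0; last by case: ns; exists z.
exists y; split=> //; first exact: mem_head.
move=> u; rewrite inE => /orP[/eqP ->|us]; first by rewrite divff ?rpred1.
have [->|u0] := eqVneq (F u) 0; first by rewrite mul0r rpred0.
by case: ns; exists u.
Qed.

Lemma int_poly_over (f : {poly int}) : map_poly intr f \is a polyOver (vs_pred w).
Proof. by apply/polyOverP => i; rewrite coef_map rpred_int. Qed.

(** Built by induction on [ts]: a polynomial congruent to [1] modulo [f] takes unit values
    wherever [f] takes values in the maximal ideal. So when the polynomial [f] found
    for [ts] fails at a new point [t], it is replaced by one congruent to [1] modulo
    [g * f], where [g] is the product of the variable and of the polynomials discarded
    before. *)
Lemma exists_unit_poly (ts : seq E) : exists f : {poly int},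
  [/\ f \is monic, (1 < size f)%N & forall t, t \in ts -> t \in vs_pred w ->
     (map_poly intr f).[t] \in vs_unit w].
Proof.
suff [f [fm szf _ h]] : exists f : {poly int},
  [/\ f \is monic, (1 < size f)%N, exists h, f = 1 + 'X * h &
    forall t, t \in ts -> t \in vs_pred w -> (map_poly intr f).[t] \in vs_unit w].
  by exists f.
have : (1 < size ('X : {poly int}))%N by rewrite size_polyX.
have : ('X : {poly int}) \is monic by exact: monicX.
elim: ts 'X => [|t ts IHts] g gm szg.
  have e : size (1 + g) = size g.
    by rewrite addrC size_polyDl // size_poly1.
  exists (1 + g); split=> //.
  - by rewrite monicE addrC lead_coefDl ?size_poly1 // -monicE.
  - by rewrite e.
  - by exists 1; rewrite mulr1.
have [f [fm szf [h eh] fu]] := IHts g gm szg.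
have [|tf] := boolP ((t \in vs_pred w) ==> ((map_poly intr f).[t] \in vs_unit w)).
  move=> /implyP ft; exists f; split=> //; first by exists h.
  by move=> u; rewrite inE => /orP[/eqP ->//|]; exact: fu.
move: tf; rewrite negb_imply => /andP[wt ft].
have gf : g * f \is monic by rewrite monicMl.
have szgf : (1 < size (g * f)%R)%N.
  rewrite size_Mmonic ?monic_neq0 //; move: szg szf.
  by case: (size g) => [|[|a]] // _; case: (size f) => [|[|b]] // _; rewrite !addnS.
have [f' [fm' szf' [h' eh'] fu']] := IHts _ gf szgf.
exists f'; split=> //; first by exists (f * h'); rewrite mulrA.
move=> u; rewrite inE => /orP[/eqP ->|us] wu; last exact: fu'.
rewrite eh' rmorphD rmorph1 !rmorphM hornerD hornerC !hornerM.
apply: vs_unitD; first exact: vs_unit1.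
have wh (q : {poly int}) : (map_poly intr q).[t] \in vs_pred w.
  by apply: rpred_horner => //; exact: int_poly_over.
rewrite mulrAC; apply: vs_maxM; first by apply: rpredM; exact: wh.
by rewrite -(vs_maxP (wh f)).
Qed.

(** Lagrange interpolation at points of [w] whose differences are units. *)
Lemma lagrange_over (rs : seq E) (h : {poly E}) : uniq rs -> (size h <= size rs)%N ->
  (forall r, r \in rs -> r \in vs_pred w) ->
  (forall r s, r \in rs -> s \in rs -> (r - s)^-1 \in vs_pred w) ->
  (forall r, r \in rs -> h.[r] \in vs_pred w) -> h \is a polyOver (vs_pred w).
Proof.
move=> urs szh wr wrs wh.
pose l r := (\prod_(s <- rem r rs) (r - s)^-1) *: \prod_(s <- rem r rs) ('X - s%:P).
have lr r : r \in rs -> (l r).[r] = 1.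
  move=> rrs; rewrite hornerZ horner_prod -big_split /= big_seq big1 // => s.
  rewrite mem_rem_uniq // inE => /andP[sr _]; rewrite hornerXsubC mulVf //.
  by rewrite subr_eq0 eq_sym.
have ls r s : r \in rs -> s \in rs -> s != r -> (l r).[s] = 0.
  move=> rrs srs sr; rewrite hornerZ.
  suff -> : (\prod_(s <- rem r rs) ('X - s%:P)).[s] = 0 by rewrite mulr0.
  by apply/rootP; rewrite root_prod_XsubC mem_rem_uniq // inE sr.
have lw r : r \in rs -> l r \is a polyOver (vs_pred w).
  move=> rrs; apply: polyOverZ.
    rewrite big_seq; apply: rpred_prod => s.
    by rewrite mem_rem_uniq // inE => /andP[_ srs]; exact: wrs.
  rewrite big_seq; apply: rpred_prod => s.
  rewrite mem_rem_uniq // inE => /andP[_ srs].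
  by rewrite rpredB ?polyOverX // polyOverC wr.
have szl r : r \in rs -> (size (l r) <= size rs)%N.
  move=> rrs; apply: leq_trans (size_scale_leq _ _) _.
  rewrite size_prod_XsubC size_rem //; case: (rs) rrs => //.
suff -> : h = \sum_(r <- rs) h.[r] *: l r.
  by rewrite big_seq; apply: rpred_sum => r rrs; apply: polyOverZ; [exact: wh|exact: lw].
apply/eqP; rewrite -subr_eq0; apply: contraT => D0.
have := max_poly_roots D0 _ urs.
rewrite ltnNge (leq_trans (size_polyD _ _)) ?geq_max ?szh ?size_polyN; last first.
  by rewrite (leq_trans (size_sum _ _ _)) //; apply/bigmax_leqP_seq => r rrs _;
     exact: leq_trans (size_scale_leq _ _) (szl r rrs).
apply; apply/allP => s srs; apply/rootP; rewrite hornerD hornerN horner_sum.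
rewrite (bigD1_seq s) //= hornerZ lr // mulr1 big_seq_cond big1 ?addr0 ?subrr //.
by move=> r /andP[rrs rs']; rewrite hornerZ ls ?mulr0 // eq_sym.
Qed.

(** In an algebraic relation satisfied by [x], two terms have the same smallest value. *)
Lemma algebraic_value (F : fieldType) (f : {rmorphism F -> E}) x :
  algebraicOver f x -> x != 0 ->
  exists e a, [/\ (0 < e)%N, a != 0 & x ^+ e / f a \in vs_unit w].
Proof.
case=> p p0 /rootP px x0.
pose t (l : 'I_(size p)) := f p`_l * x ^+ l.
have sz0 : (0 < size p)%N by rewrite size_poly_gt0.
have [|l0 [_ tl0 h]] := @vs_min _ (index_enum 'I_(size p)) t.
  have lt : ((size p).-1 < size p)%N by rewrite prednK.
  exists (Ordinal lt); first exact: mem_index_enum.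
  by rewrite mulf_neq0 ?expf_neq0 // fmorph_eq0 -/(lead_coef p) lead_coef_eq0.
have sum0 : \sum_l t l / t l0 = 0.
  rewrite -mulr_suml; suff -> : \sum_l t l = 0 by rewrite mul0r.
  rewrite -[RHS]px (@horner_coef_wide _ (size p)) ?size_map_poly //.
  by apply: eq_bigr => l _; rewrite coef_map.
have [l1 l10 u] : exists2 l1, l1 != l0 & t l1 / t l0 \in vs_unit w.
  apply: contrapT => none; have : - 1 \in vs_max w.
    move: sum0; rewrite (bigD1 l0) //= divff // => /eqP; rewrite addrC addr_eq0 => /eqP <-.
    apply: vs_max_sum => l ll0; rewrite -vs_maxP; last by apply: h; exact: mem_index_enum.
    by apply/negP => ul; apply: none; exists l.
  by move/vs_maxN; rewrite opprK => /vs_max_nunit; rewrite vs_unit1.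
have key (a b : 'I_(size p)) : (a < b)%N -> t b / t a \in vs_unit w ->
    exists e c, [/\ (0 < e)%N, c != 0 & x ^+ e / f c \in vs_unit w].
  move=> ab uab; have := vs_unit_neq0 uab.
  rewrite mulf_eq0 invr_eq0 !mulf_eq0 !negb_or !fmorph_eq0 => /andP[/andP[b0 _] /andP[a0 _]].
  exists (b - a)%N, (p`_a / p`_b); split; rewrite ?subn_gt0 // ?mulf_neq0 ?invr_eq0 //.
  move: uab; rewrite /t expfB // fmorph_div invf_div mulf_div.
  by rewrite [x ^+ b * _]mulrC [x ^+ a * _]mulrC.
have := l10; rewrite neq_ltn => /orP[lt|lt]; last exact: key lt u.
by apply: key lt _; rewrite -invf_div vs_unitV.
Qed.

End Approximation.

Lemma algebraic_in (k0 E : fieldType) (w : valsub E) (f : {rmorphism k0 -> E}) x :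
  (forall c, f c \in vs_pred w) -> algebraicOver f x -> x \in vs_pred w.
Proof.
move=> fw /integral_algebraic[p pm px]; apply: (vs_integral _ _ px).
  by rewrite map_monic.
by apply/polyOverP => l; rewrite coef_map /= fw.
Qed.

(** * Adjoining a separable element *)

(** [theta] is algebraic over a field contained in [w], and [P] is its minimal
    polynomial over [F], whose derivative is nonzero. The set [G] is the property of
    elements of [E] to be extended from [F] to its extension by [theta]; it is not
    stable under addition, but [Gsum] allows sums that happen to be units. *)
Section SeparableStep.
Variables (E : fieldType) (w : valsub E) (G : set E).
Variables (k0 F : fieldType) (g0 : {rmorphism k0 -> E}) (iF : {rmorphism F -> E}).
Variables (theta : E) (P : {poly F}).
Hypothesis GM : forall x y, G x -> G y -> G (x * y).
Hypothesis GV : forall x, G x -> G x^-1.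
Hypothesis GF : forall c, G (iF c).
Hypothesis Gsum : forall h : {poly E}, (forall l, G h`_l) -> h \is a polyOver (vs_pred w) ->
  h.[theta] \in vs_unit w -> G h.[theta].
Hypothesis k0F : forall c, exists c', iF c' = g0 c.
Hypothesis k0w : forall c, g0 c \in vs_pred w.
Hypothesis theta_alg : algebraicOver g0 theta.
Hypothesis Ptheta : root (map_poly iF P) theta.
Hypothesis Pmin : forall g, root (map_poly iF g) theta -> P %| g.
Hypothesis P0 : P != 0.
Hypothesis Psep : P^`() != 0.

Lemma minpoly_coprime q : ~~ root (map_poly iF q) theta -> coprimep q P.
Proof.
move=> qt; have := dvdp_gcdr q P => /dvdpP[e eP].
have : root (map_poly iF e) theta || root (map_poly iF (gcdp q P)) theta.
  by rewrite -rootM -rmorphM -eP.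
case/orP=> [/Pmin|].
  rewrite {1}eP => /dvdp_leq; have gcd0 : gcdp q P != 0 by rewrite gcdp_eq0 negb_and P0 orbT.
  have e0 : e != 0 by apply: contraNneq P0 => e0; rewrite eP e0 mul0r.
  rewrite e0 size_mul // /coprimep => /(_ isT).
  have : (0 < size e)%N by rewrite size_poly_gt0.
  move: gcd0; rewrite -size_poly_gt0; case: (size (gcdp q P)) => [|[|n]] // _.
  by case: (size e) => // m _; rewrite addSn !addnS /= ltnS ltnNge leq_addr.
move=> r; case/negP: qt; move: r; rewrite -!dvdp_XsubCl => /dvdp_trans; apply.
by rewrite dvdp_map dvdp_gcdl.
Qed.

Lemma minpoly_separable : separable.separable_poly P.
Proof.
rewrite separable.separable_poly.unlock coprimep_sym; apply: minpoly_coprime.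
apply/negP => /Pmin/dvdp_leq; rewrite Psep => /(_ isT).
by rewrite leqNgt lt_size_deriv.
Qed.

Lemma theta_in : theta \in vs_pred w.
Proof. exact: algebraic_in theta_alg. Qed.

Section Conjugates.
Variables (E' : fieldType) (f : {rmorphism E -> E'}) (w' : valsub E') (rs : seq E').
Hypothesis fw : forall x, (f x \in vs_pred w') = (x \in vs_pred w).
Hypothesis Psplit : map_poly f (map_poly iF P) =
  f (lead_coef (map_poly iF P)) *: \prod_(r <- rs) ('X - r%:P).

Let H : {rmorphism F -> E'} := f \o iF.
(** The conjugate of [g(theta)] attached to a root [r] of [P]. *)
Definition conj_value r (g : {poly F}) := (map_poly H g).[r].

Lemma map_comp g : map_poly H g = map_poly f (map_poly iF g).
Proof. exact: map_poly_comp. Qed.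

Lemma conj_value_theta g : conj_value (f theta) g = f (map_poly iF g).[theta].
Proof. by rewrite /conj_value map_comp horner_map. Qed.

Let c0 : f (lead_coef (map_poly iF P)) != 0.
Proof. by rewrite fmorph_eq0 lead_coef_eq0 map_poly_eq0. Qed.

Lemma conj_root r : (r \in rs) = (conj_value r P == 0).
Proof.
by rewrite /conj_value map_comp Psplit hornerZ mulf_eq0 (negPf c0) -root_prod_XsubC.
Qed.

Lemma theta_conj : f theta \in rs.
Proof. by rewrite conj_root conj_value_theta (rootP Ptheta) rmorph0. Qed.

Lemma conj_uniq : uniq rs.
Proof.
rewrite -separable.separable_prod_XsubC; have := minpoly_separable.
rewrite -(separable.separable_map iF) -(separable.separable_map f) Psplit.
by rewrite (separable.eqp_separable (eqp_scale _ c0)).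
Qed.

Lemma conj_size : size P = (size rs).+1.
Proof.
by rewrite -(size_map_poly iF) -(size_map_poly f) Psplit size_scale // size_prod_XsubC.
Qed.

Let jE : {rmorphism k0 -> E'} := f \o g0.

Let jEw c : jE c \in vs_pred w'.
Proof. by rewrite fw. Qed.

Lemma conj_alg r : r \in rs -> algebraicOver jE r.
Proof.
case: theta_alg => Q Q0 Qt rrs; exists Q => //.
have [l lP] := choice k0F.
have [Q' eQ'] : exists Q', map_poly iF Q' = map_poly g0 Q.
  exists (\poly_(n < size Q) l Q`_n); apply/polyP => n.
  rewrite !coef_map coef_poly; case: ltnP => [_|h]; first exact: lP.
  by rewrite nth_default // !raddf0.
have /dvdpP[e eQ] : P %| Q' by apply: Pmin; rewrite eQ'.
rewrite map_poly_comp -eQ' -map_comp eQ rmorphM rootM orbC /root; move: rrs.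
by rewrite conj_root /conj_value => ->.
Qed.

Lemma conj_in r : r \in rs -> r \in vs_pred w'.
Proof. by move=> /conj_alg; exact: algebraic_in. Qed.

(** Like [r - s], the element [(r - s)^-1] is algebraic over a field contained in [w']. *)
Lemma conj_diff_in r s : r \in rs -> s \in rs -> (r - s)^-1 \in vs_pred w'.
Proof.
move=> /conj_alg ar /conj_alg as_; apply: (algebraic_in jEw).
exact/algebraic_inv/algebraic_sub.
Qed.

(** Let [y = h(theta)]. When no conjugate of [y] has a smaller value than [y], Lagrange
    interpolation shows that the coefficients of [h / y] lie in [w]. As they combine
    with powers of [theta] to give [1], one of them is a unit: [y] is a coefficient of
    [h] times a unit that is a polynomial in [theta] with coefficients in [w]. *)
Lemma dominated_value (h : {poly F}) : (size h <= size rs)%N ->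
  (map_poly iF h).[theta] != 0 ->
  (forall r, r \in rs -> conj_value r h / f (map_poly iF h).[theta] \in vs_pred w') ->
  G (map_poly iF h).[theta].
Proof.
set y := _.[theta] => szh y0 hy.
have hyw l : iF h`_l / y \in vs_pred w.
  have : (f y)^-1 *: map_poly H h \is a polyOver (vs_pred w').
    apply: (lagrange_over conj_uniq).
    - by rewrite size_scale ?invr_eq0 ?fmorph_eq0 // size_map_poly.
    - exact: conj_in.
    - exact: conj_diff_in.
    - by move=> r rrs; rewrite hornerZ mulrC; exact: hy.
  move/polyOverP/(_ l); rewrite coefZ coef_map mulrC /=.
  by rewrite -fmorph_div fw.
have sum1 : \sum_(l < size h) iF h`_l / y * theta ^+ l = 1.
  under eq_bigr => l _ do rewrite mulrAC.
  rewrite -mulr_suml; apply: (canLR (mulfK y0)); rewrite mul1r /y.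
  rewrite (@horner_coef_wide _ (size h)) ?size_map_poly //.
  by apply: eq_bigr => l _; rewrite coef_map.
have [l0 u0] : exists l, iF h`_l / y \in vs_unit w.
  apply: contrapT => none; have : 1 \in vs_max w; last first.
    by move/vs_max_nunit; rewrite vs_unit1.
  rewrite -sum1; apply: vs_max_sum => l _; rewrite mulrC; apply: vs_maxM.
    by rewrite rpredX // theta_in.
  by rewrite -vs_maxP //; apply/negP => u; apply: none; exists l.
set c := iF h`_l0 in u0.
have cn0 : c != 0 by have := vs_unit_neq0 u0; rewrite mulf_eq0 negb_or => /andP[].
have uV : y / c \in vs_unit w by rewrite -invf_div vs_unitV.
rewrite -[y](divfK cn0); apply: GM; last exact: GF.
have e : y / c = (c^-1 *: map_poly iF h).[theta] by rewrite hornerZ mulrC.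
rewrite e; apply: Gsum; last by rewrite -e.
  by move=> l; rewrite coefZ coef_map; apply: GM; [exact/GV/GF|exact: GF].
apply/polyOverP => l; rewrite coefZ coef_map /= mulrC.
have -> : iF h`_l / c = iF h`_l / y * (y / c) by rewrite mulrA divfK.
by apply: rpredM; [exact: hyw|exact: vs_unit_in].
Qed.

Lemma conj_valueM r g h : conj_value r (g * h) = conj_value r g * conj_value r h.
Proof. by rewrite /conj_value rmorphM hornerM. Qed.

Lemma conj_value_mod r g : r \in rs -> conj_value r (g %% P) = conj_value r g.
Proof.
rewrite conj_root => /eqP rP; rewrite {2}(divp_eq g P) /conj_value rmorphD hornerD.
by rewrite -/(conj_value r (_ * P)) conj_valueM rP mulr0 add0r.
Qed.

Lemma conj_inverse q : (map_poly iF q).[theta] != 0 -> exists h, forall r, r \in rs ->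
  conj_value r h * conj_value r q = 1.
Proof.
move=> q0; have /Bezout_eq1_coprimepP[[u v] /= e] : coprimep q P by exact: minpoly_coprime.
exists u => r; rewrite conj_root => /eqP rP; rewrite -conj_valueM.
have : conj_value r 1 = 1 by rewrite /conj_value rmorph1 hornerC.
rewrite -e {1}/conj_value rmorphD hornerD -/(conj_value r (v * P)) conj_valueM rP.
by rewrite mulr0 addr0.
Qed.

Lemma conj_value_int (f0 : {poly int}) g r :
  conj_value r (map_poly intr f0 \Po g) = (map_poly intr f0).[conj_value r g].
Proof.
rewrite /conj_value map_comp_poly horner_comp -map_poly_comp.
by congr (_.[_]); apply: eq_map_poly => z /=; rewrite !rmorph_int.
Qed.

(** Either [v] lies in [w'] and [f0] takes a unit value there, or the leading term of
    [f0] dominates at [v]. *)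
Lemma int_value_bounds (f0 : {poly int}) e v :
  f0 \is monic -> (1 < size f0)%N -> (0 < e)%N ->
  (v \in vs_pred w' -> (map_poly intr f0).[v] \in vs_unit w') ->
  (map_poly intr f0).[v]^-1 \in vs_pred w' /\
  v / (map_poly intr f0).[v] ^+ e \in vs_pred w'.
Proof.
move=> fm szf e0 fv; set p := map_poly intr f0; set b := p.[v].
have pm : p \is monic by exact: monic_map.
have szp : size p = size f0.
  by apply: size_map_poly_id0; rewrite (monicP fm) oner_eq0.
have [wv|nv] := boolP (v \in vs_pred w').
  have [_ _ wb] := vs_unitP _ _ (fv wv).
  by rewrite -exprVn rpredM // rpredX.
have := monic_pole pm (int_poly_over w' f0) nv; rewrite szp -/b => u.
have wV := vs_max_in (vs_notin nv); set d := (size f0).-1 in u.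
have d0 : (0 < d)%N by rewrite /d; move: szf; case: (size f0) => [|[]].
have v0 : v != 0 by apply: contraNneq nv => ->; rewrite rpred0.
have vd0 : v ^+ d != 0 by rewrite expf_neq0.
have eb : b^-1 = (b / v ^+ d)^-1 * v^-1 ^+ d.
  by rewrite invf_div exprVn mulrAC divff // mul1r.
have wu := vs_unit_in (vs_unitV u).
rewrite -exprVn eb; split; first by rewrite rpredM // rpredX.
rewrite exprMn mulrCA rpredM //; first by rewrite rpredX.
rewrite -exprM; have : (0 < d * e)%N by rewrite muln_gt0 d0.
by case: (d * e)%N => // n _; rewrite exprS mulVKf // rpredX.
Qed.

(** For [x = g(theta)], choose [e] and [a] in [F] such that [t = x ^+ e / a] is a unit, and
    then [f0] taking unit values at those conjugates of [t] that lie in [w']. Both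
    [1 / f0(t)] and [x / f0(t)] satisfy the hypothesis of [dominated_value]: by
    [int_value_bounds] this holds for the first one and for the [e]-th power of the
    second one. *)
Lemma good_value g : G (map_poly iF g).[theta].
Proof.
set x := _.[theta]; have [->|x0] := eqVneq x 0; first by rewrite -(rmorph0 iF); exact: GF.
have xalg : algebraicOver iF x.
  apply/integral_algebraic/integral_horner; last first.
    by apply/integral_algebraic; exists P.
  by apply/integral_poly => l; rewrite coef_map; exact: integral_id.
have [e [a [e0 a0 u]]] := algebraic_value w xalg x0.
pose gt := a^-1 *: g ^+ e.
have conj_gt r : conj_value r gt = (H a)^-1 * conj_value r g ^+ e.
  by rewrite /conj_value map_polyZ rmorphXn hornerZ horner_exp fmorphV.
have [f0 [fm szf fu]] := exists_unit_poly w' [seq conj_value r gt | r <- rs].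
pose q := map_poly intr f0 \Po gt.
pose v r := conj_value r gt; pose b r := conj_value r q.
have bv r : b r = (map_poly intr f0).[v r] by exact: conj_value_int.
have bP r : r \in rs -> (b r)^-1 \in vs_pred w' /\ v r / b r ^+ e \in vs_pred w'.
  by move=> rrs; rewrite bv; apply: int_value_bounds => // wv; apply: fu => //; exact: map_f.
have uv : v (f theta) \in vs_unit w'.
  rewrite /v conj_gt conj_value_theta -/x mulrC -rmorphXn -[H a]/(f (iF a)) -fmorph_div.
  by rewrite (vs_unit_ext fw).
have ub : b (f theta) \in vs_unit w'.
  by rewrite bv; apply: fu; [exact/map_f/theta_conj|exact: vs_unit_in].
have q0 : (map_poly iF q).[theta] != 0.
  by rewrite -(fmorph_eq0 f) -conj_value_theta; exact: vs_unit_neq0 ub.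
have [h hq] := conj_inverse q0.
have hb r : r \in rs -> conj_value r h = (b r)^-1.
  move=> rrs; have br : b r != 0.
    apply/eqP => br; have := hq r rrs; rewrite -/(b r) br mulr0 => /esym/eqP.
    by rewrite oner_eq0.
  by rewrite -[RHS]mul1r -(hq r rrs) mulfK.
have red (y : {poly F}) : (size (y %% P)%R <= size rs)%N by rewrite -ltnS -conj_size ltn_modp.
have bt := theta_conj.
have Gred y : conj_value (f theta) y != 0 ->
    (forall r, r \in rs -> conj_value r y / conj_value (f theta) y \in vs_pred w') ->
    G (map_poly iF (y %% P)).[theta].
  move=> y0 hy; have ey : f (map_poly iF (y %% P)).[theta] = conj_value (f theta) y.
    by rewrite -conj_value_theta conj_value_mod.
  apply: dominated_value => //; first by rewrite -(fmorph_eq0 f) ey.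
  by move=> r rrs; rewrite ey conj_value_mod //; exact: hy.
have fq : f (map_poly iF q).[theta] = b (f theta) by rewrite -conj_value_theta.
have fx : f x = conj_value (f theta) g by rewrite conj_value_theta.
have b0 := vs_unit_neq0 ub.
have e1 : (map_poly iF (h %% P)).[theta] = ((map_poly iF q).[theta])^-1.
  apply: (fmorph_inj f); rewrite -conj_value_theta conj_value_mod // hb //.
  by rewrite fmorphV fq.
have e2 : (map_poly iF ((g * h) %% P)).[theta] = x / (map_poly iF q).[theta].
  apply: (fmorph_inj f); rewrite -conj_value_theta conj_value_mod // conj_valueM hb //.
  by rewrite fmorph_div fq fx.
rewrite -[x](divfK q0) -e2; apply: GM; last first.
  rewrite -[_.[theta]]invrK -e1; apply/GV/Gred; rewrite hb ?invr_eq0 //.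
  move=> r rrs; rewrite hb // invrK rpredM //; first by have [] := bP r rrs.
  exact: vs_unit_in.
have xt0 : conj_value (f theta) g != 0 by rewrite -fx fmorph_eq0.
apply: Gred; first by rewrite conj_valueM hb // mulf_neq0 // invr_eq0.
move=> r rrs; rewrite !conj_valueM !hb //; apply: (vs_expr_in e0).
have [_ wr] := bP r rrs.
have -> : (conj_value r g / b r / (conj_value (f theta) g / b (f theta))) ^+ e =
    v r / b r ^+ e * (b (f theta) ^+ e / v (f theta)).
  have Ha : H a != 0 by rewrite fmorph_eq0.
  rewrite /v !conj_gt !exprMn !exprVn exprMn exprVn !invfM !invrK.
  rewrite -!mulrA [RHS]mulrCA; congr (_ * _).
  rewrite [RHS]mulrCA; congr (_ * _).
  by rewrite [b _ ^+ e * _]mulrCA mulKf // mulrC.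
rewrite rpredM //; apply: vs_unit_in.
by rewrite vs_unitM ?vs_unitV // vs_unitX.
Qed.
End Conjugates.
End SeparableStep.

(** * Elements controlled up to p-powers *)

Lemma charexpP (F : fieldType) : (charexp F = 1%N /\ [pchar F] =i pred0) \/
  charexp F \in [pchar F].
Proof.
rewrite /charexp; case: xgetP => [p _ Fp|none]; [by right|left; split=> // p].
by rewrite [RHS]inE; apply/negP => /none.
Qed.

Lemma charexp_morph (F F' : fieldType) (f : {rmorphism F -> F'}) : charexp F' = charexp F.
Proof.
by congr (xget _ _); apply/seteqP; split=> p /=; rewrite (fmorph_pchar f).
Qed.

Lemma charexp_gt0 (F : fieldType) : (0 < charexp F)%N.
Proof. by case: (charexpP F) => [[-> _]//|/pcharf_prime/prime_gt0]. Qed.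

Lemma charexp_nat (F : fieldType) e : [pchar F].-nat (charexp F ^ e)%N.
Proof.
case: (charexpP F) => [[-> _]|Fp]; first by rewrite exp1n.
by rewrite pnatX pnatE ?Fp // (pcharf_prime Fp).
Qed.

Lemma frobeniusD (F : fieldType) e (x y : F) :
  (x + y) ^+ (charexp F ^ e) = x ^+ (charexp F ^ e) + y ^+ (charexp F ^ e).
Proof. by apply: exprDn_pchar; exact: charexp_nat. Qed.

Lemma frobeniusN (F : fieldType) e (x : F) :
  (- x) ^+ (charexp F ^ e) = - x ^+ (charexp F ^ e).
Proof. by apply: exprNn_pchar; exact: charexp_nat. Qed.

Section Good.
Variables (E : fieldType) (w : valsub E) (C K : set E).
Hypothesis rC : ring_set C.
Hypothesis fK : field_set K.
Hypothesis KC : forall x, K x -> x \in vs_pred w -> C x.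
Local Notation p := (charexp E).

(** Proved below for all elements of the field, with [C] the ring generated by the
    images of [V] and [k'] and with [K] the image of the fraction field of [V]. The
    factor [a] controls values, and [z / y] controls residues. *)
Definition good : set E := [set x | exists e a y z,
  [/\ K a, C y /\ y \in vs_unit w, C z /\ z \in vs_unit w & x ^+ (p ^ e) = a * (z / y)]].

(** Some p-power of [x] lies in the localization of [C] at the units of [w]: the additive
    counterpart of [good] for elements of [w]. *)
Definition good_int : set E := [set x | exists e y z,
  [/\ C y, y \in vs_unit w, C z & x ^+ (p ^ e) * y = z]].

Let CM x y : C x -> C y -> C (x * y). Proof. by case: rC => _ _; apply. Qed.
Let CX x n : C x -> C (x ^+ n). Proof. exact: ring_setX. Qed.
Let rK := field_set_ring fK.
Let KX x n : K x -> K (x ^+ n). Proof. exact: ring_setX. Qed.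

Lemma goodM x x' : good x -> good x' -> good (x * x').
Proof.
case=> e [a [y [z [Ka [Cy uy] [Cz uz] ex]]]] [e' [a' [y' [z' [Ka' [Cy' uy'] [Cz' uz'] ex']]]]].
exists (e + e')%N, (a ^+ (p ^ e') * a' ^+ (p ^ e)), (y ^+ (p ^ e') * y' ^+ (p ^ e)),
  (z ^+ (p ^ e') * z' ^+ (p ^ e)).
split.
- by case: rK => _ _; apply; exact: KX.
- by split; [apply: CM; exact: CX|apply: vs_unitM; exact: vs_unitX].
- by split; [apply: CM; exact: CX|apply: vs_unitM; exact: vs_unitX].
rewrite exprMn expnD {1}exprM ex mulnC exprM ex' !exprMn !exprVn -mulf_div.
by rewrite mulrACA.
Qed.

Lemma goodV x : good x -> good x^-1.
Proof.
case=> e [a [y [z [Ka Cy Cz ex]]]]; exists e, a^-1, z, y; split=> //.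
  exact: field_setV.
by rewrite exprVn ex invfM invf_div.
Qed.

Lemma good_root x e : good (x ^+ (p ^ e)) -> good x.
Proof.
case=> e' [a [y [z [Ka Cy Cz ex]]]]; exists (e + e')%N, a, y, z; split=> //.
by rewrite expnD exprM.
Qed.

Lemma good_intP x : good x -> x \in vs_pred w -> good_int x.
Proof.
case=> e [a [y [z [Ka [Cy uy] [Cz uz] ex]]]] wx.
have y0 := vs_unit_neq0 uy; have z0 := vs_unit_neq0 uz.
exists e, y, (a * z); split=> //; last by rewrite ex mulrA divfK.
apply: CM => //; apply: KC => //.
have -> : a = x ^+ (p ^ e) * (y / z).
  by rewrite ex -mulrA mulf_div [z * y]mulrC divff ?mulr1 // mulf_neq0.
by rewrite rpredM ?rpredX // vs_unit_in // vs_unitM // vs_unitV.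
Qed.

Lemma good_int_unit x : good_int x -> x \in vs_unit w -> good x.
Proof.
case=> e [y [z [Cy uy Cz ex]]] ux; exists e, 1, y, z; split=> //.
- by case: fK.
- by split=> //; rewrite -ex vs_unitM // vs_unitX.
- by rewrite mul1r -ex mulfK ?(vs_unit_neq0 uy).
Qed.

Lemma good_int_sub : C `<=` good_int.
Proof.
move=> x Cx; exists 0%N, 1, x; rewrite expn0 expr1 mulr1.
by split=> //; [case: rC|exact: vs_unit1].
Qed.

Lemma good_int_ring : ring_set good_int.
Proof.
have [C1 CB _] := rC; split; first exact: good_int_sub.
- move=> x x' [e [y [z [Cy uy Cz ex]]]] [e' [y' [z' [Cy' uy' Cz' ex']]]].
  exists (e + e')%N, (y ^+ (p ^ e') * y' ^+ (p ^ e)),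
    (z ^+ (p ^ e') * y' ^+ (p ^ e) - z' ^+ (p ^ e) * y ^+ (p ^ e')); split.
  + by apply: CM; exact: CX.
  + by apply: vs_unitM; exact: vs_unitX.
  + by apply: CB; apply: CM; exact: CX.
  rewrite frobeniusD frobeniusN mulrDl mulNr; congr (_ - _).
    by rewrite -ex exprMn -exprM -expnD mulrA.
  by rewrite -ex' exprMn -exprM -expnD [(e' + e)%N]addnC mulrA mulrAC.
- move=> x x' [e [y [z [Cy uy Cz ex]]]] [e' [y' [z' [Cy' uy' Cz' ex']]]].
  exists (e + e')%N, (y ^+ (p ^ e') * y' ^+ (p ^ e)), (z ^+ (p ^ e') * z' ^+ (p ^ e)); split.
  + by apply: CM; exact: CX.
  + by apply: vs_unitM; exact: vs_unitX.
  + by apply: CM; exact: CX.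
  rewrite exprMn -ex -ex' !exprMn -!exprM -!expnD [(e' + e)%N]addnC.
  by rewrite mulrACA.
Qed.

Section Maximal.
Variable B : set E.
Hypothesis fB : field_set B.
Hypothesis BG : B `<=` good.
Hypothesis Bmax : forall D, field_set D -> D `<=` good -> B `<=` D -> D = B.

(** The elements with a p-power in [B] form a field of good elements, which is [B] by
    maximality. *)
Lemma maximal_root x e : B (x ^+ (p ^ e)) -> B x.
Proof.
move=> Bx; pose D : set E := [set y | exists e, B (y ^+ (p ^ e))].
have up y n m : B (y ^+ (p ^ n)) -> B (y ^+ (p ^ (n + m))).
  by move=> By; rewrite expnD exprM; apply: ring_setX => //; exact: field_set_ring.
have [B1 BB BV] := fB.
rewrite -(Bmax (D := D)); first by exists e.
- split.
  + by exists 0%N; rewrite expr1n.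
  + move=> y y' [n By] [n' By']; exists (n + n')%N; rewrite frobeniusD frobeniusN.
    by apply: BB; [exact: up|rewrite addnC; exact: up].
  + move=> y y' [n By] [n' By']; exists (n + n')%N; rewrite expr_div_n.
    by apply: BV; [exact: up|rewrite addnC; exact: up].
- by move=> y [n /BG]; exact: good_root.
- by move=> y By; exists 0%N.
Qed.

Variables (k0 : fieldType) (g0 : {rmorphism k0 -> E}).
Hypothesis g0B : forall c, B (g0 c).
Hypothesis g0w : forall c, g0 c \in vs_pred w.

Local Notation F := (subfield_of B).

(** By [good_value] the polynomials in [theta] over [B] are good, hence so are their
    quotients, which form a field containing [B]. *)
Lemma maximal_separable (theta : E) (P : {poly F}) : C theta -> algebraicOver g0 theta ->
  root (map_poly val P) theta -> (forall g, root (map_poly val g) theta -> P %| g) ->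
  P != 0 -> P^`() != 0 -> B theta.
Proof.
move=> Ct talg Pt Pmin P0 Psep.
have rB := field_set_ring fB.
have iP0 : map_poly (val : F -> E) P != 0 by rewrite map_poly_eq0.
have [E' [f [rs Psplit]]] := exists_splitting iP0.
have [w' fw] := valsub_extension f w.
have allG (g : {poly F}) : good (map_poly (val : F -> E) g).[theta].
  apply: (@good_value E w good k0 F g0 val theta P) => //.
  - exact: goodM.
  - exact: goodV.
  - by move=> c; apply: BG; apply/gen_subfield_set => //; exact: valP.
  - move=> h Gh hw; apply: good_int_unit; rewrite horner_coef.
    apply: (ring_set_sum good_int_ring) => l _; have [_ _ IM] := good_int_ring.
    apply: IM; first by apply: good_intP => //; exact: (polyOverP hw).
    by apply: ring_setX; [exact: good_int_ring|exact: good_int_sub].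
  - move=> c; have /(gen_subfield_set (g0 c) fB) gc := g0B c.
    by exists (SubfieldOf gc).
  - exact: Psplit.
have Dr : ring_set (adjoin_set B theta) by exact: adjoin_set_ring.
have Bsub := adjoin_set_sub rB theta.
have eD : fractions_set (adjoin_set B theta) = B.
  apply: Bmax; first exact: fractions_set_field.
    have G1 : adjoin_set B theta `<=` good.
      move=> _ [q /(poly_set_lift fB)[h <-] ->]; exact: allG.
    by move=> _ [x [y [/G1 Gx /G1 Gy ->]]]; apply: goodM => //; exact: goodV.
  by move=> b /Bsub; exact: fractions_set_sub.
suff : fractions_set (adjoin_set B theta) theta by rewrite eD.
by apply: fractions_set_sub => //; exact: adjoin_set_mem.
Qed.

Lemma deriv0_Xp (P : {poly F}) : P^`() = 0 -> (1 < size P)%N ->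
  p \in [pchar E] /\ exists R : {poly F}, P = R \Po 'X^p.
Proof.
move=> dP szP.
have coef0 n : (n%:R != 0 :> E) -> P`_n = 0.
  case: n => [|n]; first by rewrite eqxx.
  have -> : (n.+1%:R : E) = val (n.+1%:R : F) by rewrite rmorph_nat.
  move=> n0; have /eqP : P^`()`_n = 0 by rewrite dP coef0.
  rewrite coef_deriv -mulr_natr mulf_eq0 => /orP[/eqP //|/eqP e].
  by rewrite e rmorph0 eqxx in n0.
have pE : p \in [pchar E].
  case: (charexpP E) => // -[_ /pcharf0P p0].
  have : lead_coef P = 0.
    apply: coef0; rewrite p0; move: szP; case: (size P) => [|[]] //.
  by move/eqP; rewrite lead_coef_eq0 => /eqP P0; rewrite P0 size_poly0 in szP.
split=> //; exists (\poly_(n < size P) P`_(n * p)); apply/polyP => n.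
have p0 := charexp_gt0 E; rewrite coef_comp_poly_Xn //.
case: ifP => [pn|/negbT pn]; last by apply: coef0; rewrite -(dvdn_pcharf pE).
rewrite coef_poly divnK //; case: ltnP => // h; rewrite nth_default //.
by apply: leq_trans h _; rewrite leq_div.
Qed.

(** Induction on the degree of [theta] over [B]: if its minimal polynomial is not
    separable, it is a polynomial in [X ^ p], so that [theta ^+ p] has smaller degree
    over [B], and [maximal_root] applies. *)
Lemma maximal_algebraic (theta : E) (q : {poly F}) : C theta -> 
  (forall n, algebraicOver g0 (theta ^+ n)) -> q != 0 -> root (map_poly val q) theta ->
  B theta.
Proof.
have [n] := ubnP (size q); elim: n theta q => // n IHn theta q szq Ct talg q0 qt.
pose a m := exists Q : {poly F}, [/\ Q != 0, root (map_poly val Q) theta & size Q = m].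
have [m /asboolP[P [P0 Pt szP]] Pmin] :
    {m : nat | `[< a m >] & forall m', `[< a m' >] -> (m <= m')%N}.
  have ex : exists m, `[< a m >] by exists (size q); apply/asboolP; exists q.
  by case: (ex_minnP ex) => m; exists m.
have Pdvd g : root (map_poly val g) theta -> P %| g.
  move=> gt; rewrite /dvdp; apply: contraT => r0.
  suff : (size P <= size (g %% P)%R)%N by rewrite leqNgt ltn_modp P0.
  rewrite szP; apply: Pmin; apply/asboolP; exists (g %% P); split=> //.
  move/rootP: gt; rewrite {1}(divp_eq g P) rmorphD rmorphM hornerD hornerM.
  by rewrite (rootP Pt) mulr0 add0r => /rootP.
have szPq : (size P <= size q)%N by rewrite szP; apply: Pmin; apply/asboolP; exists q.
have [dP|dP] := eqVneq P^`() 0; last first.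
  by apply: (maximal_separable Ct _ Pt) => //; rewrite -[theta]expr1.
have szP1 : (1 < size P)%N.
  by rewrite -(size_map_poly (val : F -> E)); apply: root_size_gt1 Pt; rewrite map_poly_eq0.
have [pE [R eR]] := deriv0_Xp dP szP1.
have R0 : R != 0 by apply: contraNneq P0 => R0; rewrite eR R0 comp_poly0.
apply: (@maximal_root _ 1); rewrite expn1; apply: (IHn _ R) => //.
- suff : (size R < size P)%N by move=> /leq_trans/(_ szPq) h; exact: leq_trans h _.
  have p1 := prime_gt1 (pcharf_prime pE).
  have : ((size R).-1 * p < size P)%N.
    rewrite ltnNge; apply: contraNN R0 => le; rewrite -lead_coef_eq0 /lead_coef.
    have := coef_comp_poly_Xn R ((size R).-1 * p) (charexp_gt0 E).
    by rewrite dvdn_mull // mulnK ?charexp_gt0 // -eR nth_default // => <-.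
  have : (0 < size R)%N by rewrite size_poly_gt0.
  case: (size R) => [//|[|r]] _ /=; first by move=> _; exact: szP1.
  apply: leq_ltn_trans; apply: leq_trans (leq_mul (leqnn r.+1) p1).
  by rewrite muln2 -addnn addSn ltnS leq_addl.
- exact: ring_setX.
- by move=> d; rewrite -exprM.
move: Pt; rewrite {1}eR map_comp_poly map_polyXn /root horner_comp hornerXn.
by [].
Qed.

End Maximal.
End Good.

(** * Every element is good *)

Section AllGood.
Variables (k k' : fieldType) (j : {rmorphism k -> k'}) (V : idomainType).
Variables (i : {rmorphism k -> V}) (HV : valuation_ring V).
Variables (A : set k') (E : fieldType) (uL : {rmorphism k' -> E}).
Variables (uK : {rmorphism {fraction V} -> E}) (w : valsub E).
Hypothesis fA : field_set A.
Hypothesis algA : forall x, algebraicOver (val : subfield_of A -> k') x.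
Hypothesis uLK : forall c, uL (j c) = uK (i c)%:F.
Hypothesis gen : forall x : E, exists s t : seq (k' * {fraction V}),
  x = (\sum_(z <- s) uL z.1 * uK z.2) / (\sum_(z <- t) uL z.1 * uK z.2).
Hypothesis Vmax : forall a, a \isn't a GRing.unit -> uK a%:F \in vs_max w.
Hypothesis unitw : forall s r, (forall z, z \in s -> A z.1) -> klinear j r ->
  \sum_(z <- s) i (r z.1) * z.2 \is a GRing.unit ->
  \sum_(z <- s) uL z.1 * uK z.2%:F \in vs_unit w.

Let rA := field_set_ring fA.

(** A nonzero element of [A] is a primitive tensor. *)
Lemma base_in a : A a -> uL a \in vs_pred w.
Proof.
move=> Aa; have [->|a0] := eqVneq a 0; first by rewrite rmorph0 rpred0.
have [||||r [lr r1 _]] := @klinear_extension _ _ j [set 0] a.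
- by [].
- by move=> x y -> ->; rewrite addr0.
- by move=> x c ->; rewrite mul0r.
- by move=> e; rewrite e eqxx in a0.
have : \sum_(z <- [:: (a, 1)]) uL z.1 * uK z.2%:F \in vs_unit w.
  apply: (unitw (r := r)) => //; first by move=> z; rewrite inE => /eqP ->.
  by rewrite big_seq1 /= r1 rmorph1 mul1r unitr1.
by rewrite big_seq1 tofrac1 rmorph1 mulr1 => /vs_unit_in.
Qed.

Let g0 : {rmorphism subfield_of A -> E} := uL \o (val : subfield_of A -> k').

Let g0w c : g0 c \in vs_pred w.
Proof. by apply: base_in; apply/gen_subfield_set => //; exact: valP. Qed.

Lemma left_alg b : algebraicOver g0 (uL b).
Proof.
have [q q0 qb] := algA b; exists q => //.
by rewrite map_poly_comp /root horner_map (rootP qb) rmorph0.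
Qed.

Lemma left_in b : uL b \in vs_pred w.
Proof. exact: algebraic_in (left_alg b). Qed.

Lemma uK_in x : uK x \in vs_pred w -> exists v : V, x = v%:F.
Proof.
move=> wx; have [->|x0] := eqVneq x 0; first by exists 0; rewrite tofrac0.
have [//|[v e]] := HV x0.
have [uv|/Vmax mv] := boolP (v \is a GRing.unit).
  exists v^-1; rewrite -[x]invrK e; apply: (mulfI (x := v%:F)).
    by rewrite -e invr_eq0.
  by rewrite divff -?tofracM ?divrr ?tofrac1 // -e invr_eq0.
have := vs_maxV mv; rewrite -e fmorph_eq0 invr_eq0 fmorphV invrK wx.
by move=> /(_ x0).
Qed.

Definition composite_set : set E :=
  [set x | exists s : seq (k' * V), x = \sum_(z <- s) uL z.1 * uK z.2%:F].

Lemma composite_ring : ring_set composite_set.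
Proof.
split.
- by exists [:: (1, 1)]; rewrite big_seq1 tofrac1 !rmorph1 mulr1.
- move=> _ _ [s ->] [t ->]; exists (s ++ opp_pairs t).
  rewrite big_cat big_map -sumrN; congr (_ + _); apply: eq_bigr => z _ /=.
  by rewrite rmorphN mulNr.
- move=> _ _ [s ->] [t ->]; exists (mul_pairs s t).
  rewrite big_allpairs_dep big_distrl; apply: eq_bigr => x _.
  rewrite big_distrr; apply: eq_bigr => y _ /=.
  by rewrite tofracM !rmorphM mulrACA.
Qed.

Lemma composite_left b : composite_set (uL b).
Proof. by exists [:: (b, 1)]; rewrite big_seq1 tofrac1 rmorph1 mulr1. Qed.

Lemma composite_right v : composite_set (uK v%:F).
Proof. by exists [:: (1, v)]; rewrite big_seq1 rmorph1 mul1r. Qed.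

Lemma range_composite x : range uK x -> x \in vs_pred w -> composite_set x.
Proof. by move=> [y _ <-] /uK_in[v ->]; exact: composite_right. Qed.

Local Notation good := (good w composite_set (range uK)).

Let rK : {rmorphism V -> {fraction V}} := @FracField.tofrac V.

Lemma uLK_compatible : compatible j (rK \o i) uL uK.
Proof. exact: uLK. Qed.

Definition base_ring : set E := [set tensor_map uLK_compatible x | x in left_part A].

Lemma base_ring_ring : ring_set base_ring.
Proof.
have [P1 PB PM] := left_part_ring j (rK \o i) rA; split.
- by exists 1; rewrite ?rmorph1.
- by move=> _ _ [x Px <-] [y Py <-]; exists (x - y); rewrite ?rmorphB //; exact: PB.
- by move=> _ _ [x Px <-] [y Py <-]; exists (x * y); rewrite ?rmorphM //; exact: PM.
Qed.

Let tensor_map_left b : tensor_map uLK_compatible (tens_left j (rK \o i) b) = uL b.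
Proof. by rewrite tensor_map_tens big_seq1 rmorph1 mulr1. Qed.

Let tensor_map_right x : tensor_map uLK_compatible (tens_right j (rK \o i) x) = uK x.
Proof. by rewrite tensor_map_tens big_seq1 rmorph1 mul1r. Qed.

Lemma good_right x : good (uK x).
Proof.
exists 0%N, (uK x), 1, 1; rewrite expn0 expr1 divr1 mulr1.
by split=> //; split; rewrite ?vs_unit1 //; case: composite_ring.
Qed.

Lemma good_unit x : composite_set x -> x \in vs_unit w -> good x.
Proof.
move=> Cx ux; exists 0%N, 1, 1, x; rewrite expn0 expr1 divr1 mul1r.
split=> //; first by exists 1; rewrite ?rmorph1.
by split; rewrite ?vs_unit1 //; case: composite_ring.
Qed.

Let gM x y : good x -> good y -> good (x * y).
Proof. exact: goodM composite_ring (range_field uK) _ _. Qed.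

(** A nonzero element of A (x) K is an element of [K] times a primitive tensor. *)
Lemma base_ring_good x : base_ring x -> good x.
Proof.
case=> y Py <-; have [->|y0] := eqVneq y 0.
  by rewrite rmorph0 -(rmorph0 uK); exact: good_right.
have rfrac (z : {fraction V}) : exists a b, rK b != 0 /\ z = rK a / rK b.
  exists (\n_(repr z)), (\d_(repr z)); split; last exact: fracE.
  by rewrite tofrac_eq0 denom_ratioP.
have [c [s [r [c0 As lr s1 ->]]]] := left_part_normal HV rfrac Py y0.
rewrite rmorphM /= tensor_map_right; apply: gM; first exact: good_right.
rewrite tensor_map_tens big_map; apply: good_unit; first by exists s.
by apply: (unitw As lr); rewrite s1 unitr1.
Qed.

(** A maximal field of good elements containing the fractions of A (x) K contains [k'],
    each element of which is algebraic over [A]. *)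
Lemma all_good x : good x.
Proof.
have gV y : good y -> good y^-1 by exact: goodV (range_field uK) _.
pose P (B : set E) := field_set B /\ B `<=` good.
have P0 : P (fractions_set base_ring).
  split; first exact: fractions_set_field base_ring_ring.
  move=> _ [a [b [/base_ring_good ga /base_ring_good gb ->]]].
  by apply: gM => //; exact: gV.
have [|B [B0 [fB Bg] Bmax']] := Zorn_above P0.
  move=> F F0 FP _Ftot; split; first by apply: field_set_chain => // X /FP[].
  by move=> y [X /FP[_ Xg] /Xg].
have Bmax D : field_set D -> D `<=` good -> B `<=` D -> D = B.
  by move=> fD Dg BD; apply: Bmax'.
have Bbase y : base_ring y -> B y.
  by move=> hy; apply: B0; exact: fractions_set_sub base_ring_ring _ hy.
have BA a : A a -> B (uL a).
  move=> Aa; apply: Bbase; exists (tens_left j (rK \o i) a); last exact: tensor_map_left.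
  exact: left_part_left.
have BK y : B (uK y).
  apply: Bbase; exists (tens_right j (rK \o i) y); last exact: tensor_map_right.
  by apply: left_part_right; case: fA.
have g0B c : B (g0 c).
  by apply: BA; apply/gen_subfield_set => //; exact: valP.
have BL b : B (uL b).
  have [q q0 qb] := left_alg b.
  have Bq : poly_set B (map_poly g0 q) by move=> l; rewrite coef_map; exact: g0B.
  have [Q eQ] := poly_set_lift fB Bq.
  apply: (maximal_algebraic composite_ring (range_field uK)
    range_composite fB Bg Bmax g0B g0w (composite_left b) (q := Q)).
  - by move=> n; rewrite -rmorphXn; exact: left_alg.
  - rewrite -(map_poly_eq0 (val : subfield_of B -> E)) eQ map_poly_eq0 //.
  - by rewrite eQ.
apply: Bg; have [s [t ->]] := gen x; have [_ _ BV] := fB.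
have rB := field_set_ring fB; have [_ _ BM] := rB.
by apply: BV; apply: ring_set_sum => // z _; exact: BM.
Qed.

End AllGood.

(** * The value group and the spectrum of W *)

Section RingOfValsub.
Variables (E : fieldType) (w : valsub E).

Record vs_ring := VsRing { vs_val :> E; _ : vs_val \in vs_pred w }.

HB.instance Definition _ := [isSub for vs_val].
HB.instance Definition _ := [Choice of vs_ring by <:].
HB.instance Definition _ := [SubChoice_isSubComNzRing of vs_ring by <:].

Definition vs_ring_unit : {pred vs_ring} := fun x => val x \in vs_unit w.
Definition vs_ring_inv (x : vs_ring) : vs_ring := insubd x (val x)^-1.

Lemma vs_ring_mulVx : {in vs_ring_unit, left_inverse 1 vs_ring_inv *%R}.
Proof.
move=> x /vs_unitP[x0 _ wV]; apply: val_inj.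
by rewrite rmorphM rmorph1 /= val_insubd wV mulVf.
Qed.

Lemma vs_ring_unitPl (x y : vs_ring) : y * x = 1 -> vs_ring_unit x.
Proof.
move=> /(congr1 val); rewrite rmorphM rmorph1 /= => e; apply/vs_unitP.
have x0 : val x != 0.
  by apply: contra_eq_neq e => ->; rewrite mulr0 eq_sym oner_neq0.
split=> //; first exact: valP.
by rewrite -[_^-1]mul1r -e mulfK //; exact: valP.
Qed.

Lemma vs_ring_invr_out : {in [predC vs_ring_unit], vs_ring_inv =1 id}.
Proof.
move=> x nux; apply: val_inj; rewrite val_insubd; case: ifP => // wV.
have [->|x0] := eqVneq (val x) 0; first by rewrite invr0.
by case/negP: nux; apply/vs_unitP; split=> //; exact: valP.
Qed.

HB.instance Definition _ := GRing.ComNzRing_hasMulInverse.Build vs_ring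
  vs_ring_mulVx vs_ring_unitPl vs_ring_invr_out.

Lemma vs_ring_integral : GRing.integral_domain_axiom vs_ring.
Proof.
move=> x y /(congr1 val)/eqP; rewrite rmorphM rmorph0 mulf_eq0.
by case/orP=> /eqP h; apply/orP; [left|right]; apply/eqP/val_inj.
Qed.

HB.instance Definition _ := GRing.ComUnitRing_isIntegral.Build vs_ring vs_ring_integral.

Lemma vs_ring_unitE (x : vs_ring) : (x \is a GRing.unit) = (val x \in vs_unit w).
Proof. by []. Qed.

Lemma vs_ring_val_eq0 (x : vs_ring) : (val x == 0) = (x == 0).
Proof.
apply/eqP/eqP => [h|->]; last exact: rmorph0.
by apply: val_inj; rewrite h; apply/esym; exact: rmorph0.
Qed.

Lemma vs_ring_valuation : valuation_ring vs_ring.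
Proof.
move=> x x0; pose n := \n_(repr x); pose d := \d_(repr x).
have d0 : d != 0 by exact: denom_ratioP.
have ex : x = n%:F / d%:F by exact: fracE.
have n0 : n != 0 by apply: contraNneq x0 => n0; rewrite ex n0 tofrac0 mul0r.
have vd : val d != 0 by rewrite vs_ring_val_eq0.
have vn : val n != 0 by rewrite vs_ring_val_eq0.
have [h|h] := vs_total w (val n / val d).
  left; exists (VsRing h); rewrite ex; apply: (canLR (mulfK _)); first by rewrite tofrac_eq0.
  by rewrite -tofracM; congr _%:F; apply: val_inj; rewrite rmorphM /= divfK.
right; rewrite invf_div in h; exists (VsRing h); rewrite ex invf_div.
apply: (canLR (mulfK _)); first by rewrite tofrac_eq0.
by rewrite -tofracM; congr _%:F; apply: val_inj; rewrite rmorphM /= divfK.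
Qed.

Variables (R : comNzRingType) (g : {rmorphism R -> E}).
Hypothesis gw : forall a, g a \in vs_pred w.

Definition to_vs_ring (a : R) : vs_ring := VsRing (gw a).

Lemma to_vs_ring_zmod : zmod_morphism to_vs_ring.
Proof. by move=> a b; apply: val_inj; rewrite rmorphB /= rmorphB. Qed.
Lemma to_vs_ring_monoid : monoid_morphism to_vs_ring.
Proof.
by split=> [|a b]; apply: val_inj; rewrite ?rmorph1 ?rmorphM /= ?rmorph1 ?rmorphM.
Qed.

HB.instance Definition _ := GRing.isZmodMorphism.Build R vs_ring to_vs_ring to_vs_ring_zmod.
HB.instance Definition _ := GRing.isMonoidMorphism.Build R vs_ring to_vs_ring
  to_vs_ring_monoid.

End RingOfValsub.

Lemma prime_expr (R : comNzRingType) (x : Spec R) a n :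
  (0 < n)%N -> (a ^+ n \in (x : pred R)) = (a \in (x : pred R)).
Proof.
case: n => // n _; elim: n => [|n IHn]; first by rewrite expr1.
by rewrite exprS prime_idealrM IHn orbb.
Qed.

Lemma prime_unit (R : comUnitRingType) (x : Spec R) a b :
  b \is a GRing.unit -> (a * b \in (x : pred R)) = (a \in (x : pred R)).
Proof.
move=> ub; rewrite prime_idealrM; case: (a \in _) => //=.
apply/negP => xb; have : 1 \in (x : pred R) by rewrite -(mulVr ub) idealMr.
by rewrite idealr1.
Qed.

Section RadicialDomination.
Variables (V W : idomainType) (HV : valuation_ring V) (HW : valuation_ring W).
Variables (f : domination V W) (p : nat).
Hypothesis p_gt0 : (0 < p)%N.
Hypothesis radical : forall b : W, exists e a u,
  u \is a GRing.unit /\ b ^+ (p ^ e) = f a * u.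

Let pe e : (0 < p ^ e)%N. Proof. by rewrite expn_gt0 p_gt0. Qed.

Lemma mulgroup_mulrn (F : fieldType) (g : mulgroup F) n : val (g *+ n) = val g ^+ n.
Proof.
elim: n => [|n IHn]; first by rewrite mulr0n expr0.
by rewrite mulrS exprS -IHn.
Qed.

Lemma value_torsion_quotient : p_torsion p (cokernel (value_map f)).
Proof.
move=> x; pose g := repr (repr x : value_group W).
pose n := \n_(repr (val g)); pose d := \d_(repr (val g)).
have d0 : d != 0 by exact: denom_ratioP.
have eg : val g = n%:F / d%:F by exact: fracE.
have n0 : n != 0.
  by apply: contraTneq (mulgroup_neq0 g) => n0; rewrite eg n0 tofrac0 mul0r negbK.
have [e [a [u [uu ea]]]] := radical n; have [e' [b [u' [uu' eb]]]] := radical d.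
have a0 : a != 0.
  by apply: contraNneq (expf_neq0 (p ^ e) n0) => a0; rewrite ea a0 rmorph0 mul0r.
have b0 : b != 0.
  by apply: contraNneq (expf_neq0 (p ^ e') d0) => b0; rewrite eb b0 rmorph0 mul0r.
pose a1 := a ^+ (p ^ e'); pose b1 := b ^+ (p ^ e).
have h0 : a1%:F / b1%:F != 0 by rewrite mulf_neq0 ?invr_eq0 ?tofrac_eq0 ?expf_neq0.
pose h := Mulgroup h0.
exists (e + e')%N.
have ex : x = \pi_(cokernel (value_map f)) (\pi_(value_group W) g) by rewrite !reprK.
rewrite ex -!raddfMn; transitivity (\pi_(cokernel (value_map f)) 0); last exact: raddf0.
apply/eqP; rewrite -Quotient.idealrBE subr0; apply/asboolP; exists (\pi_(value_group V) h).
rewrite /= value_map_pi; apply/eqP; rewrite -Quotient.idealrBE; apply/asboolP.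
pose U := u ^+ (p ^ e'); pose U' := u' ^+ (p ^ e).
have uU : U \is a GRing.unit by rewrite unitrX.
have uU' : U' \is a GRing.unit by rewrite unitrX.
have U0 : U%:F != 0.
  by rewrite tofrac_eq0; apply: contraTneq uU => ->; rewrite unitr0.
exists (U' / U); first by rewrite unitrM uU' unitrV.
have -> : (U' / U)%:F = U'%:F / U%:F.
  by apply: (canRL (mulfK U0)); rewrite -tofracM divrK.
have en : n ^+ (p ^ (e + e')) = f a1 * U.
  by rewrite expnD exprM ea exprMn rmorphXn.
have ed : d ^+ (p ^ (e + e')) = f b1 * U'.
  by rewrite addnC expnD exprM eb exprMn rmorphXn.
have A0 : (f a1)%:F != 0.
  by rewrite frac_map_den ?expf_neq0 //; exact: (@dom_inj _ _ f).
have B0 : (f b1)%:F != 0.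
  by rewrite frac_map_den ?expf_neq0 //; exact: (@dom_inj _ _ f).
transitivity (frac_map (@dom_inj _ _ f) (a1%:F / b1%:F) / val (g *+ p ^ (e + e'))) => //.
rewrite mulgroup_mulrn eg frac_map_quot ?expf_neq0 // expr_div_n -!tofracXn en ed.
rewrite !tofracM invf_div mulf_div [_%:F * (_ * U%:F)]mulrCA.
by rewrite -mulf_div divff // mul1r -mulf_div divff // mul1r.
Qed.

(** Powers of [a] and [a'] are associated in [W], hence in [V]. *)
Lemma radical_indep (q : Spec V) b e a u e' a' u' : u \is a GRing.unit ->
  u' \is a GRing.unit -> b ^+ (p ^ e) = f a * u -> b ^+ (p ^ e') = f a' * u' ->
  a \in (q : pred V) -> a' \in (q : pred V).
Proof.
move=> uu uu' ea ea' qa; rewrite -(prime_expr q a' (pe e)).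
have qaX : a ^+ (p ^ e') \in (q : pred V) by rewrite prime_expr.
have [[c ->]|[c ec]] := valuation_dvd HV (a' ^+ (p ^ e)) (a ^+ (p ^ e')).
  by rewrite idealMr.
have [->|a0] := eqVneq (a' ^+ (p ^ e)) 0; first exact: idealr0.
suff uc : c \is a GRing.unit by move: qaX; rewrite ec mulrC prime_unit.
apply: (dom_local (d := f)).
have e1 : f a' ^+ (p ^ e) * (f c * u ^+ (p ^ e')) = f a' ^+ (p ^ e) * u' ^+ (p ^ e).
  rewrite -[RHS]exprMn -ea' -exprM mulnC exprM ea exprMn -[f a ^+ _]rmorphXn ec rmorphM rmorphXn.
  by rewrite [LHS]mulrCA mulrA.
have fa0 : f a' ^+ (p ^ e) != 0.
  by rewrite -rmorphXn -(rmorph0 f) (inj_eq (@dom_inj _ _ f)).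
have : f c * u ^+ (p ^ e') \is a GRing.unit by rewrite (mulfI fa0 e1) unitrX.
by rewrite unitrM => /andP[].
Qed.

(** The elements [b] whose associated [a] lies in [q] form an ideal: of two elements of a
    valuation ring one divides the other, so stability under sums reduces to stability
    under multiples. *)
Lemma lift_prime (q : Spec V) : exists q' : Spec W, forall b e a u,
  u \is a GRing.unit -> b ^+ (p ^ e) = f a * u ->
  (b \in (q' : pred W)) = (a \in (q : pred V)).
Proof.
pose I (b : W) := exists e a u,
  [/\ u \is a GRing.unit, b ^+ (p ^ e) = f a * u & a \in (q : pred V)].
have IM c b : I b -> I (c * b).
  case=> e [a [u [uu ea qa]]]; have [e' [a' [u' [uu' ea']]]] := radical c.
  exists (e + e')%N, (a' ^+ (p ^ e) * a ^+ (p ^ e')), (u' ^+ (p ^ e) * u ^+ (p ^ e')).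
  split; first by rewrite unitrM !unitrX.
    rewrite exprMn {1}addnC !expnD !exprM ea ea' !exprMn !rmorphM !rmorphXn.
    by rewrite mulrACA.
  by rewrite idealMr // prime_expr.
have [|||||q' q'P] := @Spec_of_set W I.
- by exists 0%N, 0, 1; rewrite unitr1 rmorph0 mul0r expn0 expr1 idealr0.
- case=> e [a [u [uu]]]; rewrite expr1n => /(congr1 (fun z => z \is a GRing.unit)).
  rewrite unitr1 unitrM uu andbT => /esym/dom_local ua.
  by rewrite -[a]mul1r prime_unit // idealr1.
- move=> b b' Ib Ib'; have [[c ->]|[c ->]] := valuation_dvd HW b b'.
    by rewrite -[X in _ + X]mul1r -mulrDl; exact: IM.
  by rewrite -[X in X + _]mul1r -mulrDl; exact: IM.
- by move=> b b'; exact: IM.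
- move=> b b' [e [a [u [uu ea qa]]]].
  have [e1 [a1 [u1 [uu1 ea1]]]] := radical b; have [e2 [a2 [u2 [uu2 ea2]]]] := radical b'.
  have h : (b * b') ^+ (p ^ (e1 + e2)) =
      f (a1 ^+ (p ^ e2) * a2 ^+ (p ^ e1)) * (u1 ^+ (p ^ e2) * u2 ^+ (p ^ e1)).
    rewrite exprMn {2}addnC !expnD !exprM ea1 ea2 !exprMn !rmorphM !rmorphXn.
    by rewrite mulrACA.
  have := radical_indep uu _ ea h qa; rewrite unitrM !unitrX // => /(_ isT).
  rewrite prime_idealrM !prime_expr // => /orP[q1|q2]; [left|right].
    by exists e1, a1, u1.
  by exists e2, a2, u2.
exists q' => b e a u uu ea; apply/idP/idP => [/q'P[e' [a' [u' [uu' ea' qa']]]]|qa].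
  exact: radical_indep uu' uu ea' ea qa'.
by apply/q'P; exists e, a, u.
Qed.

Lemma in_Spec_map (R S : comNzRingType) (g : {rmorphism R -> S}) (q : Spec S) a :
  (a \in (Spec_map g q : pred R)) = (g a \in (q : pred S)).
Proof. by []. Qed.

Lemma radical_homeomorphism : homeomorphism (Spec_map f).
Proof.
split.
  apply/continuousP => _ [S ->]; exists (f @` S).
  apply/seteqP; split=> x /=.
    by move=> h h'; apply: h => a Sa; apply: h'; exists a.
  by move=> h h'; apply: h => _ [a Sa <-]; exact: h'.
have [g gP] := choice lift_prime; exists g; split.
- have [e eP] := choice radical.
  have [a aP] := choice eP.
  apply/continuousP => _ [S ->]; exists (a @` S).
  have key x b : (b \in (g x : pred W)) = (a b \in (x : pred V)).
    by have [u [uu eb]] := aP b; exact: gP uu eb.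
  apply/seteqP; split=> x /= h h'; apply: h.
    by move=> b Sb; change (b \in (g x : pred W)); rewrite key; apply: h'; exists b.
  by move=> _ [b Sb <-]; change (a b \in (x : pred V)); rewrite -key; exact: h'.
- move=> x; apply: Spec_ext => b.
  change ((b \in (g (Spec_map f x) : pred W)) = (b \in (x : pred W))).
  have [e [a [u [uu eb]]]] := radical b.
  rewrite (gP _ _ _ _ _ uu eb) in_Spec_map -(prime_expr x b (pe e)) eb.
  by rewrite prime_unit.
- move=> x; apply: Spec_ext => a; change ((f a \in (g x : pred W)) = (a \in (x : pred V))).
  apply: (gP x (f a) 0%N a 1); first exact: unitr1.
  by rewrite expn0 expr1 mulr1.
Qed.

End RadicialDomination.

(** * Residue fields *)

Section MaximalPoint.
Variable R : comNzRingType.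

Lemma closure_Spec (x y : Spec R) :
  closure [set x] y <-> (forall a, a \in (x : pred R) -> a \in (y : pred R)).
Proof.
rewrite closureE; split=> [h|xy].
  apply: (h (zariski_closed [set a | a \in (x : pred R)])); split; last first.
    by move=> _ -> a.
  by rewrite -openC; exists [set a | a \in (x : pred R)].
move=> B [cB xB]; move: cB; rewrite -openC => -[S eS].
have {}eS : B = zariski_closed S by rewrite -[B]setCK eS setCK.
rewrite eS => a Sa; apply: xy; have : B x by exact: xB.
by rewrite eS => /(_ a Sa).
Qed.

(** If an irreducible set [Y] contains the closure of [x], the intersection of the members
    of [Y] is a prime ideal contained in [x], hence equal to [x]; so [Y] consists of
    primes that contain [x]. *)
Lemma maximal_point_minimal (x : Spec R) :
  (forall y : Spec R, (forall a, a \in (y : pred R) -> a \in (x : pred R)) ->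
     forall a, a \in (x : pred R) -> a \in (y : pred R)) ->
  maximal_point x.
Proof.
move=> xmin; exists (closure [set x]) => //; split.
  split; first by exists x; exact/closure_Spec.
  move=> A B cA cB xAB.
  have [Ax|Bx] : (A `|` B) x by apply: xAB; exact/closure_Spec.
    left; rewrite (closure_id A).1 //; apply: closureS.
    by move=> _ ->.
  right; rewrite (closure_id B).1 //; apply: closureS.
  by move=> _ ->.
move=> Y [[y0 Yy0] irrY] xY.
have closedP a : closed [set y : Spec R | a \in (y : pred R)].
  rewrite -openC; exists [set a]; congr (~` _); apply/seteqP; split=> y /=.
    by move=> ya b ->.
  by move=> /(_ a erefl).
have [||||| z zP] := @Spec_of_set R [set a | forall y, Y y -> a \in (y : pred R)].
- by move=> y _; exact: idealr0.
- by move=> /(_ _ Yy0); rewrite idealr1.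
- by move=> a b ha hb y Yy; rewrite rpredD ?ha ?hb.
- by move=> a b hb y Yy; rewrite idealMr ?hb.
- move=> a b hab.
  have [|h|h] := irrY _ _ (closedP a) (closedP b); [|by left|by right].
  by move=> y /hab; rewrite prime_idealrM => /orP[]; [left|right].
have xz a : a \in (x : pred R) -> a \in (z : pred R).
  apply: xmin => b /zP h; apply: h; apply: xY; exact/closure_Spec.
apply/seteqP; split=> // y Yy; apply/closure_Spec => a /xz/zP; exact.
Qed.

End MaximalPoint.

Section IntegralOverSet.
Variables (T : comNzRingType) (S : set T).
Hypothesis rS : ring_set S.

Definition set_pred : {pred T} := fun x => `[< S x >].

Lemma set_pred_subring : subring_closed set_pred.
Proof.
case: rS => S1 SB SM; split; first exact/asboolP.
  by move=> x y /asboolP Sx /asboolP Sy; apply/asboolP; exact: SB.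
by move=> x y /asboolP Sx /asboolP Sy; apply/asboolP; exact: SM.
Qed.

HB.instance Definition _ := GRing.isSubringClosed.Build T set_pred set_pred_subring.

Record set_ring := SetRing { set_ring_val :> T; _ : set_ring_val \in set_pred }.
HB.instance Definition _ := [isSub for set_ring_val].
HB.instance Definition _ := [Choice of set_ring by <:].
HB.instance Definition _ := [SubChoice_isSubComNzRing of set_ring by <:].

Definition set_integral (t : T) : Prop :=
  exists2 p : {poly T}, p \is monic /\ poly_set S p & p.[t] = 0.

Lemma set_integralP t : set_integral t <-> integralOver (val : set_ring -> T) t.
Proof.
split=> [[p [pm Sp] pt]|[p pm pt]]; last first.
  exists (map_poly val p); last exact/rootP.
  split; first exact: monic_map.
  move=> l; rewrite coef_map /=; have := valP (p`_l).
  by rewrite /set_pred unfold_in => /asboolP.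
have gp l : p`_l \in set_pred by apply/asboolP.
pose q := \poly_(l < size p) SetRing (gp l).
have eq : map_poly val q = p.
  apply/polyP => l; rewrite coef_map coef_poly; case: ltnP => // h.
  by rewrite nth_default.
exists q; last by rewrite eq; exact/rootP.
rewrite monicE; apply/eqP/val_inj; rewrite rmorph1.
have szq : size q = size p.
  apply: size_poly_eq; rewrite -(inj_eq val_inj) /= -/(lead_coef p) (monicP pm).
  by rewrite oner_eq0.
by rewrite /lead_coef szq -coef_map eq -/(lead_coef p) (monicP pm).
Qed.

Lemma set_integral_id t : S t -> set_integral t.
Proof.
move=> St; have gt : t \in set_pred by apply/asboolP.
by apply/set_integralP; exact: (integral_id _ (SetRing gt)).
Qed.

Lemma set_integralD t u : set_integral t -> set_integral u -> set_integral (t + u).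
Proof. by move=> /set_integralP it /set_integralP iu; apply/set_integralP/integral_add. Qed.

Lemma set_integralM t u : set_integral t -> set_integral u -> set_integral (t * u).
Proof. by move=> /set_integralP it /set_integralP iu; apply/set_integralP/integral_mul. Qed.

(** A monic polynomial over [S] whose value at [t] lies in [y] has its constant term in
    [x], because [t] and that value do; so the constant term vanishes, and the
    polynomial can be divided by the variable unless [t] lies in [y]. *)
Lemma integral_incomparable (x y : Spec T) :
  (forall t, set_integral t) -> (forall a, S a -> a \in (x : pred T) -> a = 0) ->
  (forall a, a \in (y : pred T) -> a \in (x : pred T)) ->
  forall a, a \in (x : pred T) -> a \in (y : pred T).
Proof.
move=> int Sx yx t xt; have [p [pm Sp] pt] := int t.
have : p.[t] \in (y : pred T) by rewrite pt idealr0.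
have [n] := ubnP (size p); elim: n p pm Sp {pt} => // n IHn p pm Sp szp ypt.
have ep : p = drop_poly 1 p * 'X + (p`_0)%:P.
  rewrite -{1}(poly_take_drop 1 p) addrC; congr (_ + _).
  by apply/polyP => l; rewrite coef_take_poly coefC; case: l.
have szp0 : (0 < size p)%N by rewrite size_poly_gt0 monic_neq0.
have [sz1|sz1] := leqP (size p) 1.
  have p1 : p = 1.
    move/monicP: pm; rewrite (size1_polyC sz1) lead_coefC => ->.
    by rewrite polyC1.
  by move: ypt; rewrite p1 hornerC idealr1.
have dm : drop_poly 1 p \is monic.
  move/monicP: pm; rewrite monicE /lead_coef size_drop_poly coef_drop_poly => <-.
  by rewrite subn1 addn1 prednK // -subn1 subn_gt0.
have ept : p.[t] = (drop_poly 1 p).[t] * t + p`_0.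
  by rewrite {1}ep hornerD hornerM hornerX hornerC.
have p00 : p`_0 = 0.
  apply: Sx => //; have /yx := ypt; rewrite ept => h.
  by rewrite -[p`_0](addKr ((drop_poly 1 p).[t] * t)) rpredD // rpredN idealMr.
move: ypt; rewrite ept p00 addr0 prime_idealrM => /orP[yd|//].
apply: (IHn _ dm) => //.
  by move=> l; rewrite coef_drop_poly.
by rewrite size_drop_poly subn1 prednK.
Qed.

End IntegralOverSet.

Lemma residue_repr (R : comNzRingType) (q : Spec R) (x : residue_field q) :
  exists a b, to_residue q b != 0 /\ x = to_residue q a / to_residue q b.
Proof.
exists (repr \n_(repr x)), (repr \d_(repr x)).
have e (y : quot_domain q) : to_residue q (repr y) = y%:F.
  by congr (_%:F); exact: reprK.
by rewrite !e -fracE tofrac_eq0 denom_ratioP.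
Qed.

Section ResidueFields.
Variables (k k' : fieldType) (j : {rmorphism k -> k'}) (V : idomainType).
Variables (i : {rmorphism k -> V}) (HV : valuation_ring V).
Variables (W : idomainType) (f : {rmorphism V -> W}) (i' : {rmorphism k' -> W}).
Hypothesis i'j : forall c, i' (j c) = f (i c).
Variable q' : Spec W.

Let q : Spec V := Spec_map f q'.
Let i_q : {rmorphism k -> residue_field q} := to_residue q \o i.
Let u : {rmorphism k' -> residue_field q'} := to_residue q' \o i'.
Let v : {rmorphism residue_field q -> residue_field q'} := residue_map f q'.

Definition pair_sum (s : seq (k' * V)) : W := \sum_(z <- s) i' z.1 * f z.2.

Lemma residue_unit (b : W) : b \is a GRing.unit -> to_residue q' b != 0.
Proof.
move=> ub; rewrite tofrac_eq0 to_quot_eq0 -[b]mul1r prime_unit //.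
by rewrite idealr1.
Qed.

Lemma residue_purely_inseparable :
  (forall b : W, exists e s t, pair_sum s \is a GRing.unit /\
     b ^+ (charexp k ^ e) * pair_sum s = pair_sum t) ->
  purely_inseparable (gen_subfield (range u `|` range v)).
Proof.
move=> gen x; set B := gen_subfield _.
have ce : charexp (residue_field q') = charexp k by exact: (charexp_morph (u \o j)).
have sumB s : to_residue q' (pair_sum s) \in B.
  rewrite rmorph_sum; apply: rpred_sum => z _; rewrite rmorphM rpredM //.
    by apply: gen_subfieldP; left; exists z.1.
  apply: gen_subfieldP; right; exists (to_residue q z.2) => //.
  exact: residue_map_to_residue.
have one b : exists e, to_residue q' b ^+ (charexp k ^ e) \in B.
  have [e [s [t [us ebs]]]] := gen b; exists e.
  have s0 := residue_unit us; rewrite -(mulfK s0 (_ ^+ _)) -rmorphXn -rmorphM ebs.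
  by rewrite rpred_div.
have [a [b [b0 ->]]] := residue_repr x.
have [e ea] := one a; have [e' eb] := one b; exists (e + e')%N.
rewrite ce expr_div_n rpred_div //; first by rewrite expnD exprM rpredX.
by rewrite addnC expnD exprM rpredX.
Qed.

Lemma residue_compatible : compatible j i_q u v.
Proof.
move=> c; change (to_residue q' (i' (j c)) = residue_map f q' (to_residue q (i c))).
by rewrite i'j residue_map_to_residue.
Qed.

Variable A : set k'.
Hypothesis fA : field_set A.
Hypothesis algA : forall x, algebraicOver (val : subfield_of A -> k') x.
Hypothesis unitA : forall s r, (forall z, z \in s -> A z.1) -> klinear j r ->
  \sum_(z <- s) i (r z.1) * z.2 \is a GRing.unit -> pair_sum s \is a GRing.unit.

Local Notation T := (tensor j i_q).
Local Notation phi := (tensor_map residue_compatible).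
Let rP := left_part_ring j i_q (field_set_ring fA).

Lemma tensor_integral t : set_integral (left_part (jL := j) (jM := i_q) A) t.
Proof.
elim/tens_ind: t => s; elim: s => [|z s IHs].
  exact: (set_integral_id rP (ring_set0 rP)).
rewrite tens_cons; apply: (set_integralD rP) => //; apply: (set_integralM rP) => //; last first.
  by apply: (set_integral_id rP); apply: left_part_right; case: fA.
have /integral_algebraic[p pm pz] := algA z.1.
exists (map_poly (tens_left j i_q) (map_poly val p)); last first.
  by rewrite horner_map (rootP pz) rmorph0.
split; first by rewrite !monic_map.
move=> l; rewrite !coef_map; apply: left_part_left.
by apply/(gen_subfield_set _ fA); exact: valP.
Qed.

(** A nonzero element of A (x) kappa(q) is a scalar times a primitive tensor, whose image
    is the residue of a unit of [W]. *)
Lemma residue_tensor_inj x : left_part (jL := j) (jM := i_q) A x -> phi x = 0 -> x = 0.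
Proof.
move=> Px phix; apply/eqP; apply: contraT => x0; move/eqP: phix.
have [c [s [r [c0 As lr s1 ->]]]] := left_part_normal HV (@residue_repr V q) Px x0.
rewrite rmorphM mulf_eq0 => /orP[|].
  rewrite /= tensor_map_tens big_seq1 rmorph1 mul1r fmorph_eq0 /= => /eqP e.
  by rewrite e eqxx in c0.
rewrite /= tensor_map_tens big_map.
have -> : \sum_(z <- s) u z.1 * v (to_residue q z.2) = to_residue q' (pair_sum s).
  rewrite rmorph_sum; apply: eq_bigr => z _.
  by rewrite [RHS]rmorphM; congr (_ * _); exact: residue_map_to_residue.
have : pair_sum s \is a GRing.unit by apply: (unitA As lr); rewrite s1 unitr1.
by move/residue_unit/negPf => ->.
Qed.

(** k' (x) kappa(q) is integral over A (x) kappa(q), which meets the kernel trivially; so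
    the kernel contains no smaller prime. *)
Lemma residue_maximal_composite : maximal_composite (compositum residue_compatible).
Proof.
apply: maximal_point_minimal => y yx.
apply: (integral_incomparable tensor_integral) => // a Pa ka.
apply: residue_tensor_inj => //.
have /eqP : tensor_map (ce_compatible (compositum residue_compatible)) a == 0 by exact: ka.
move=> /(congr1 val); rewrite rmorph0 => <-.
elim/tens_ind: a {Pa ka} => s; rewrite !tensor_map_tens rmorph_sum.
by apply: eq_bigr => z _; rewrite rmorphM.
Qed.

End ResidueFields.

Theorem mainTheorem5
    (k k' : fieldType) (j : {rmorphism k -> k'})
    (V : idomainType) (i : {rmorphism k -> V}) (HV : valuation_ring V) :
  exists (W : idomainType) (f : domination V W) (i' : {rmorphism k' -> W}),
    [/\ valuation_ring W,
        (forall c : k, i' (j c) = f (i c)),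
        p_torsion (charexp k) (cokernel (value_map f)),
        homeomorphism (Spec_map f) &
        forall q' : Spec W,
          let q : Spec V := Spec_map f q' in
          let i_q : {rmorphism k -> residue_field q} := to_residue q \o i in
          let u : {rmorphism k' -> residue_field q'} := to_residue q' \o i' in
          let v : {rmorphism residue_field q -> residue_field q'} :=
            residue_map f q' in
          purely_inseparable (gen_subfield (range u `|` range v)) /\
          exists uv : compatible j i_q u v, maximal_composite (compositum uv)].
Proof.
have [A [fA algA [E [uL [uK [w [uLK gen Vw Vmax unitw]]]]]]] := exists_valued_field j i HV.
pose W : idomainType := vs_ring w.
have lin := left_in fA algA unitw.
pose uV : {rmorphism V -> E} := uK \o @FracField.tofrac V.
pose f0 : {rmorphism V -> W} := @to_vs_ring E w V uV Vw.
have f0_inj : injective f0.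
  move=> a b /(congr1 val) /fmorph_inj /eqP; rewrite tofrac_eq => /eqP; exact.
have f0_local a : f0 a \is a GRing.unit -> a \is a GRing.unit.
  by move=> ua; apply: contraLR ua => /Vmax/vs_max_nunit.
pose f : domination V W := Domination f0_inj f0_local.
pose i' : {rmorphism k' -> W} := @to_vs_ring E w k' uL lin.
have ce : charexp E = charexp k by exact: (charexp_morph (uL \o j)).
have good x := all_good HV fA algA uLK gen Vmax unitw x.
have valW (s : seq (k' * V)) : val (pair_sum f i' s) = \sum_(z <- s) uL z.1 * uK z.2%:F.
  by rewrite rmorph_sum; apply: eq_bigr => z _; rewrite rmorphM.
have goodW (b : W) : exists e a s t, [/\ pair_sum f i' s \is a GRing.unit,
    pair_sum f i' t \is a GRing.unit &
    b ^+ (charexp k ^ e) * pair_sum f i' s = f a * pair_sum f i' t].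
  have [e [_ [_ [_ [[a _ <-] [[s ->] us] [[t ->] ut] eb]]]]] := good (val b).
  have es := vs_unit_neq0 us; have et := vs_unit_neq0 ut.
  have wa : uK a \in vs_pred w.
    have -> : uK a = val b ^+ (charexp E ^ e) *
        ((\sum_(z <- s) uL z.1 * uK z.2%:F) / (\sum_(z <- t) uL z.1 * uK z.2%:F)).
      by rewrite eb -mulrA mulf_div [X in _ * (X / _)]mulrC divff ?mulr1 // mulf_neq0.
    apply: rpredM; first by rewrite rpredX //; exact: valP.
    by apply: vs_unit_in; rewrite vs_unitM ?vs_unitV.
  have [a' ea] := uK_in HV Vmax wa; exists e, a', s, t; split.
  - by rewrite vs_ring_unitE valW.
  - by rewrite vs_ring_unitE valW.
  apply: val_inj; rewrite !rmorphM rmorphXn /= !valW -ce eb ea.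
  by rewrite mulrA divfK.
have radical (b : W) : exists e a u,
    u \is a GRing.unit /\ b ^+ (charexp k ^ e) = f a * u.
  have [e [a [s [t [us ut eb]]]]] := goodW b; exists e, a, (pair_sum f i' t / pair_sum f i' s).
  by rewrite unitrM ut unitrV us mulrA -eb mulrK.
have HW : valuation_ring W by exact: vs_ring_valuation.
have i'j c : i' (j c) = f (i c) by apply: val_inj; exact: uLK.
exists W, f, i'; split=> //.
- exact (value_torsion_quotient radical).
- exact (radical_homeomorphism HV HW (charexp_gt0 k) radical).
move=> q' q i_q u v; split.
  apply: (residue_purely_inseparable (f := f) (i' := i') j).
  move=> b; have [e [a [s [t [us ut eb]]]]] := goodW b.
  exists e, s, [seq (z.1, a * z.2) | z <- t]; split=> //; rewrite eb.
  rewrite /pair_sum big_map mulr_sumr; apply: eq_bigr => z _ /=.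
  by rewrite rmorphM mulrCA.
exists (residue_compatible i'j q').
apply (residue_maximal_composite HV i'j q' fA algA).
by move=> s r As lr us; rewrite vs_ring_unitE valW; exact: unitw As lr us.
Qed.
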